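(* Let $k$ be an algebraically closed field with $\operatorname{char}k\ne 2$, let $G=\mathrm{Sp}_{2n}(k)$, and let $d=(d_{-s},\dots,d_s)$ be a proper symplectic dimension vector with $\sum_i d_i=2n$. Let $D(d)$ be the labelled line diagram attached to $d$ (as constructed in the context), and let $$x=\sum \epsilon_{i,j}\,e_{i,j},$$ where the sum is over all arrows from the vertex labelled $i$ to the vertex labelled $j$ in $D(d)$. Then $x$ is a Richardson element for the parabolic subgroup $P(d)$ of $G$; that is, $x$ lies in the Lie algebra $\mathfrak u$ of the unipotent radical of $P(d)$ and the orbit $P(d)\cdot x$ is open and dense in $\mathfrak u$.
   Context: **Setup.** Let $V=k^{2n}$ have basis $v_{-n},\dots,v_{-1},v_1,\dots,v_n$ and skew-symmetric bilinear form given by $(v_i,v_j)=(v_{-i},v_{-j})=0$, $(v_i,v_{-j})=\delta_{i,j}$ for $1\le i,j\le n$. $G=\mathrm{Sp}_{2n}(k)$ is the isometry group, with Lie algebra $\mathfrak{sp}_{2n}(k)$, acted on by the adjoint action. Let $e_{i,j}$ be the linear map of $V$ sending $v_i$ to $v_j$ and all other basis vectors to $0$. A Chevalley basis of $\mathfrak{sp}_{2n}(k)$ is $$\{e_{i,j}-e_{-j,-i}\}_{1\le i,j\le n}\cup\{e_{i,-j}+e_{j,-i},\ e_{-i,j}+e_{-j,i}\}_{1\le i<j\le n}\cup\{e_{k,-k},\ e_{-k,k}\}_{1\le k\le n},$$ and $\epsilon_{i,j}=\pm1$ denotes the coefficient of $e_{i,j}$ in this basis if it appears. **Dimension vectors and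 parabolics.** Given $(d_1,\dots,d_s)\in\mathbb Z_{\ge0}^s$ with $\sum_{i=1}^s d_i\le n$, put $d_0=2n-2\sum_{i=1}^s d_i$ and $d_{-i}=d_i$; then $d=(d_{-s},\dots,d_s)$ is a symplectic dimension vector. It is proper if $d_i\neq0$ for all $i\ne0$. Put $c_i=d_0/2+\sum_{j=1}^{i-1}d_j$ for $1\le i\le s+1$ and let $V_{-i}$ be the span of $v_{-n},v_{-n+1},\dots,v_{-c_i-1}$. $P(d)$ is the stabilizer in $G$ of the isotropic flag $0=V_{-(s+1)}\subseteq V_{-s}\subseteq\dots\subseteq V_{-1}$. **Small diagrams.** Let $f=(f_{-s},\dots,f_s)$ be a symplectic dimension vector (of some size, zero entries allowed) with all entries in $\{0,1,2\}$. Define an (unlabelled) diagram $D(f)$ of vertices in the plane and arrows: Case 1: $f_0=0$ and all nonzero entries are $1$. Vertices at $(i,0)$ for all $i$ with $f_i\ne0$. From each vertex except the leftmost, draw an arrow to the next vertex to its left. Case 2: $f_0=2$. Vertices at $(i,1)$ and $(-i,-1)$ for $i\ge0$ with $f_i\neq0$, and at $(-i,1)$ and $(i,-1)$ for $i>0$ with $f_i=2$. From each vertex that is not leftmost in its row, draw an arrow to the next vertex to its left in its row. If four or more entries of $f$ equal $1$, let $l>0$ be minimal with $f_l>0$ and draw an additional arrow from $(l,1)$ to $(-l,-1)$. Case 3: $f_0=0$ and all nonzero entries are $2$. Vertices at $(i,1)$ and $(i,-1)$ for all $i$ with $f_i=2$. From each vertex that is not leftmost in its row, draw an arrow to the next vertex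 to its left in its row. Case 4: $f_0=0$ and $f$ has both entries $1$ and entries $2$. Vertices at $(i,1)$ and $(-i,-1)$ for $i>0$ with $f_i\ne0$, and at $(i,-1)$ and $(-i,1)$ for $i>0$ with $f_i=2$. Let $l,l'>0$ be minimal such that $f_l\ne0$ and $f_{l'}=2$ respectively ($l=l'$ allowed). From each vertex that is not leftmost in its row and is not at $(l,1)$ or $(l',-1)$, draw an arrow to the next vertex to its left in its row. Draw additional arrows from $(l,1)$ to $(-l,-1)$ and from $(l',-1)$ to $(-l',1)$. **Decomposition of $d$.** A proper $d$ is decomposed as $d=d^0+d^1+\dots+d^m$ as follows. Initially set $d^0=0$. Suppose $d^0,\dots,d^{j-1}$ ($j\ge1$) are defined and let $c^j=d-\sum_{i=0}^{j-1}d^i$. Use the first of the following cases that applies. Case A: $c^j_0>0$. Put $d^j_i=0,1,2$ according as $c^j_i=0$, $c^j_i=1$, $c^j_i\ge2$. Case B: $c^j_0=0$ and all nonzero entries of $c^j$ are $\ge2$. Put $d^j_i=0$ if $c^j_i=0$, and $d^j_i=2$ if $c^j_i\ge2$. Case C: $c^j_0=0$ and $c^j$ has an entry equal to $1$ and a positive even entry. Let $a>0$ be the least positive even entry of $c^j$. Put $d^j_i=0$ if $c^j_i=0$; $d^j_i=1$ if $c^j_i\in\{1,3,\dots,a-1\}$; $d^j_i=2$ if $c^j_i\ge a$. Case D: $c^j_0=0$ and all nonzero entries of $c^j$ are odd. (Then necessarily $d^0=0$ so far.) Redefine $d^0$ by $d^0_i=0$ if $c^j_i=0$, and $d^0_i=1$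 if $c^j_i\ge1$; then update $c^j$ (i.e. recompute $c^j=d-\sum_{i=0}^{j-1}d^i$ with the new $d^0$) and continue with the same $j$. Continue until $c^j=0$. **The diagram $D(d)$.** If $d^0\neq0$, draw the small diagram $D(d^0)$; if $d^0=0$ nothing is drawn at this step. Then for each $j=1,\dots,m$ insert the small diagram $D(d^j)$ stretched vertically so that a vertex at $(i,\pm1)$ is moved to $(i,\pm j)$, arrows being stretched accordingly. Finally label the $2n$ vertices by $-n,\dots,-1,1,\dots,n$ so that labels increase from left to right and, within each column (fixed first coordinate), from bottom to top. *)

(* Defs.v *)
From mathcomp Require Import all_boot all_order all_algebra.
From mathcomp.multinomials Require Import mpoly.

Set Implicit Arguments.
Unset Strict Implicit.
Unset Printing Implicit Defensive.

Import Order.TTheory GRing.Theory Num.Theory.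
Local Open Scope ring_scope.

(* Vectors are row vectors and linear maps act on the right: the map with
   matrix g is v |-> v *m g, so that a composite of maps [g o h] has matrix
   [h *m g]. Sets of matrices are predicates ['M[k]_N -> Prop]. *)

(** * Linear algebraic groups *)

Definition eval_mx (k : fieldType) (N : nat) (f : {mpoly k[N * N]})
    (x : 'M[k]_N) : k :=
  f.@[fun i => mxvec x 0 i].

Definition zclosed (k : fieldType) (N : nat) (A : 'M[k]_N -> Prop) : Prop :=
  exists S : {mpoly k[N * N]} -> Prop,
    forall x, A x <-> (forall f, S f -> eval_mx f x = 0).

(* [A] is an open subset of [U] for the topology induced on [U]. *)
Definition zopen_in (k : fieldType) (N : nat) (U A : 'M[k]_N -> Prop) : Prop :=
  exists2 C : 'M[k]_N -> Prop, zclosed C & forall x, A x <-> U x /\ ~ C x.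

(* [A] is a dense subset of [U]. *)
Definition zdense_in (k : fieldType) (N : nat) (U A : 'M[k]_N -> Prop) : Prop :=
  (forall x, A x -> U x) /\
  (forall C : 'M[k]_N -> Prop, zclosed C ->
     (forall x, A x -> C x) -> forall x, U x -> C x).

Definition zconnected (k : fieldType) (N : nat) (A : 'M[k]_N -> Prop) : Prop :=
  forall C D : 'M[k]_N -> Prop, zclosed C -> zclosed D ->
    (forall x, A x -> C x \/ D x) -> (forall x, A x -> ~ (C x /\ D x)) ->
    (forall x, A x -> C x) \/ (forall x, A x -> D x).

Definition is_mxgroup (k : fieldType) (N : nat) (H : 'M[k]_N -> Prop) : Prop :=
  [/\ forall g, H g -> g \in unitmx,
      H 1%:M,
      forall g h, H g -> H h -> H (g *m h)
    & forall g, H g -> H (invmx g)].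

Definition normal_in (k : fieldType) (N : nat) (P H : 'M[k]_N -> Prop) : Prop :=
  (forall h, H h -> P h) /\
  (forall g h, P g -> H h -> H (invmx g *m h *m g)).

Definition unipotent (k : fieldType) (N : nat) (g : 'M[k]_N) : Prop :=
  exists m : nat, (g - 1%:M) ^+ m = 0.

Definition connected_normal_unipotent (k : fieldType) (N : nat)
    (P H : 'M[k]_N -> Prop) : Prop :=
  [/\ is_mxgroup H,
      (exists2 C : 'M[k]_N -> Prop, zclosed C & forall g, H g <-> P g /\ C g),
      zconnected H, normal_in P H & forall h, H h -> unipotent h].

(* The closed connected normal unipotent subgroups of an algebraic group have
   a largest member, the unipotent radical, which is thus their union. *)
Definition unipotent_radical (k : fieldType) (N : nat) (P : 'M[k]_N -> Prop)
    (g : 'M[k]_N) : Prop :=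
  exists2 H : 'M[k]_N -> Prop, connected_normal_unipotent P H & H g.

(* The tangent space at the identity: the common zeros of the differentials at
   the identity of the polynomials that vanish on [H]. *)
Definition lie_algebra (k : fieldType) (N : nat) (H : 'M[k]_N -> Prop)
    (X : 'M[k]_N) : Prop :=
  forall f : {mpoly k[N * N]}, (forall g, H g -> eval_mx f g = 0) ->
    \sum_(i < N * N) eval_mx f^`M(i) 1%:M * mxvec X 0 i = 0.

(* The orbit of [x] under [g . x = g x g^-1] (composition of linear maps). *)
Definition adjoint_orbit (k : fieldType) (N : nat) (P : 'M[k]_N -> Prop)
    (x y : 'M[k]_N) : Prop :=
  exists2 g, P g & y = invmx g *m x *m g.

Definition richardson_element (k : fieldType) (N : nat) (P : 'M[k]_N -> Prop)
    (x : 'M[k]_N) : Prop :=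
  let u := lie_algebra (unipotent_radical P) in
  [/\ u x, zopen_in u (adjoint_orbit P x) & zdense_in u (adjoint_orbit P x)].

(** * The symplectic group *)

(* The basis v_{-n}, .., v_{-1}, v_1, .., v_n is the standard basis of
   ['rV_(n + n)] in this order; [label p] is the index of the [p]-th vector. *)
Definition label (n : nat) (p : 'I_(n + n)) : int :=
  if (p < n)%N then p%:Z - n%:Z else p%:Z - n%:Z + 1.

Definition bvec (k : fieldType) (n : nat) (a : int) : 'rV[k]_(n + n) :=
  \row_p (label p == a)%:R.

Definition emx (k : fieldType) (n : nat) (a b : int) : 'M[k]_(n + n) :=
  \matrix_(p, q) ((label p == a) && (label q == b))%:R.

Definition gram (k : fieldType) (n : nat) : 'M[k]_(n + n) :=
  \matrix_(p, q)
    (if label p + label q == 0 then (if 0 < label p then 1 else -1) else 0).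

Definition sform (k : fieldType) (n : nat) (u w : 'rV[k]_(n + n)) : k :=
  (u *m gram k n *m w^T) 0 0.

Definition Sp (k : fieldType) (n : nat) (g : 'M[k]_(n + n)) : Prop :=
  g \in unitmx /\ forall u w, sform (u *m g) (w *m g) = sform u w.

Definition chevalley_basis (k : fieldType) (n : nat) : seq 'M[k]_(n + n) :=
  let e := emx k n in
  let I := [seq i%:Z | i <- iota 1 n] in
  let pairs := [seq (i, j) | i <- I, j <- I] in
  [seq e t.1 t.2 - e (- t.2) (- t.1) | t <- pairs]
  ++ [seq e t.1 (- t.2) + e t.2 (- t.1) | t <- pairs & t.1 < t.2]
  ++ [seq e (- t.1) t.2 + e (- t.2) t.1 | t <- pairs & t.1 < t.2]
  ++ [seq e i (- i) | i <- I] ++ [seq e (- i) i | i <- I].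

(* The coefficient of [e_{label p, label q}] in the member of the Chevalley
   basis in which it appears. *)
Definition eps (k : fieldType) (n : nat) (p q : 'I_(n + n)) : k :=
  (head 0 [seq b : 'M[k]_(n + n) <- chevalley_basis k n | b p q != 0]
     : 'M[k]_(n + n)) p q.

(** * Symplectic dimension vectors *)

(* A vector (d_{-s}, .., d_s) is a function [int -> nat] with support in
   [-s, s]. *)
Definition symplectic_dimvec (n s : nat) (d : int -> nat) : Prop :=
  [/\ forall i : int, s%:Z < `|i| -> d i = 0%N,
      forall i : int, d (- i) = d i,
      (\sum_(1 <= i < s.+1) d i%:Z <= n)%N
    & d 0 = (n.*2 - (\sum_(1 <= i < s.+1) d i%:Z).*2)%N].

Definition proper_dimvec (s : nat) (d : int -> nat) : Prop :=
  forall i : int, `|i| <= s%:Z -> i != 0 -> d i != 0%N.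

Definition cpart (d : int -> nat) (i : nat) : nat :=
  ((d 0)./2 + \sum_(1 <= j < i) d j%:Z)%N.

(* [flag k n d i] spans V_{-i}. *)
Definition flag (k : fieldType) (n : nat) (d : int -> nat) (i : nat) :
    'M[k]_(n + n) :=
  (\sum_(p < n + n | (label p <= - (cpart d i)%:Z - 1)%R)
     <<bvec k n (label p)>>)%MS.

Definition parabolic (k : fieldType) (n s : nat) (d : int -> nat)
    (g : 'M[k]_(n + n)) : Prop :=
  Sp g /\ forall i : nat, (1 <= i <= s.+1)%N ->
    (flag k n d i *m g == flag k n d i)%MS.

(** * Small diagrams *)

Definition vertex : Type := (int * int)%type.
Definition arrow : Type := (vertex * vertex)%type.

Record diagram := Diagram { vertices : seq vertex; arrows : seq arrow }.

Definition left_neighbour (V : seq vertex) (v w : vertex) : bool :=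
  [&& w \in V, w.2 == v.2, w.1 < v.1
    & all (fun u : vertex => ~~ ((u.2 == v.2) && (w.1 < u.1 < v.1))) V].

(* The arrows to the next vertex in the row, except from the vertices [ex]. *)
Definition row_arrows (V ex : seq vertex) : seq arrow :=
  [seq a <- [seq (v, w) | v <- V, w <- V]
     | (a.1 \notin ex) && left_neighbour V a.1 a.2].

Definition columns (s : nat) : seq int :=
  [seq i%:Z - s%:Z | i <- iota 0 s.*2.+1].

Definition pos_columns (s : nat) : seq int := [seq i%:Z | i <- iota 1 s].

Definition small_diagram (s : nat) (f : int -> nat) : diagram :=
  let cols := columns s in
  let pos := pos_columns s in
  let nonneg := 0 :: pos in
  let l := head 0 [seq i <- pos | (0 < f i)%N] in
  let l' := head 0 [seq i <- pos | f i == 2%N] in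
  if f 0 == 2%N then
    let V := [seq (i, 1) | i <- nonneg & f i != 0%N]
          ++ [seq (- i, -1) | i <- nonneg & f i != 0%N]
          ++ [seq (- i, 1) | i <- pos & f i == 2%N]
          ++ [seq (i, -1) | i <- pos & f i == 2%N] in
    let extra := if (4 <= count (fun i => f i == 1%N) cols)%N
                 then [:: ((l, 1), (- l, -1))] else [::] in
    Diagram V (row_arrows V [::] ++ extra)
  else if all (fun i => (f i == 0%N) || (f i == 1%N)) cols then
    let V := [seq (i, 0) | i <- cols & f i != 0%N] in
    Diagram V (row_arrows V [::])
  else if all (fun i => (f i == 0%N) || (f i == 2%N)) cols then
    let V := [seq (i, 1) | i <- cols & f i == 2%N]
          ++ [seq (i, -1) | i <- cols & f i == 2%N] in
    Diagram V (row_arrows V [::])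
  else
    let V := [seq (i, 1) | i <- pos & f i != 0%N]
          ++ [seq (- i, -1) | i <- pos & f i != 0%N]
          ++ [seq (i, -1) | i <- pos & f i == 2%N]
          ++ [seq (- i, 1) | i <- pos & f i == 2%N] in
    Diagram V (row_arrows V [:: (l, 1); (l', -1)]
               ++ [:: ((l, 1), (- l, -1)); ((l', -1), (- l', 1))]).

(** * The decomposition d = d^0 + d^1 + .. + d^m *)

(* The pair (d^0, [:: d^1; ..; d^(j-1)]) constructed so far. *)
Definition decomp_state : Type := ((int -> nat) * seq (int -> nat))%type.

Definition remainder (d : int -> nat) (st : decomp_state) (i : int) : nat :=
  (d i - (st.1 i + sumn [seq f i | f <- st.2]))%N.

Definition decomp_step (s : nat) (d : int -> nat) (st : decomp_state) :
    decomp_state :=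
  let c := remainder d st in
  let cols := columns s in
  let evens := [seq c i | i <- cols & (0 < c i)%N && ~~ odd (c i)] in
  if all (fun i => c i == 0%N) cols then st
  else if (0 < c 0)%N then
    (st.1, rcons st.2 (fun i => minn (c i) 2))
  else if all (fun i => (c i == 0%N) || (2 <= c i)%N) cols then
    (st.1, rcons st.2 (fun i => if c i == 0%N then 0%N else 2%N))
  else if evens is _ :: _ then
    let a := head 0%N (sort leq evens) in
    (st.1, rcons st.2
             (fun i => if c i == 0%N then 0%N
                       else if (c i < a)%N then 1%N else 2%N))
  else
    (fun i => if c i == 0%N then 0%N else 1%N, st.2).

(* A step that does not reach [c = 0] decreases the sum of the entries of [c],
   so the procedure has stopped after [\sum_i d_i] steps. *)
Definition decomposition (s : nat) (d : int -> nat) : decomp_state :=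
  iter (sumn [seq d i | i <- columns s]) (decomp_step s d)
       (fun=> 0%N, [::]).

(** * The line diagram D(d) and the element x *)

Definition stretch_vertex (j : nat) (v : vertex) : vertex := (v.1, v.2 * j%:Z).

Definition stretch (j : nat) (D : diagram) : diagram :=
  Diagram [seq stretch_vertex j v | v <- vertices D]
          [seq (stretch_vertex j a.1, stretch_vertex j a.2) | a <- arrows D].

Definition superpose (D E : diagram) : diagram :=
  Diagram (vertices D ++ vertices E) (arrows D ++ arrows E).

(* [small_diagram s (fun=> 0%N)] is empty, so nothing is drawn if d^0 = 0. *)
Definition line_diagram (s : nat) (d : int -> nat) : diagram :=
  let st := decomposition s d in
  foldl superpose (small_diagram s st.1)
    [seq stretch j.+1 (small_diagram s (nth (fun=> 0%N) st.2 j))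
       | j <- iota 0 (size st.2)].

(* From left to right and, within a column, from bottom to top. *)
Definition vertex_le (v w : vertex) : bool :=
  (v.1 < w.1) || ((v.1 == w.1) && (v.2 <= w.2)).

(* The vertex of D(d) that is labelled [label p]. *)
Definition labelled_vertex (n s : nat) (d : int -> nat) (p : 'I_(n + n)) :
    vertex :=
  nth (0, 0) (sort vertex_le (vertices (line_diagram s d))) p.

Definition diagram_element (k : fieldType) (n s : nat) (d : int -> nat) :
    'M[k]_(n + n) :=
  \sum_(p < n + n) \sum_(q < n + n
      | (labelled_vertex s d p, labelled_vertex s d q)
          \in arrows (line_diagram s d))
    eps k p q *: emx k n (label p) (label q).

(* Main.v *)
(* Sort the basis of V by the columns of D(d). The Lie algebra p of P(d) consists
   of the skew-adjoint matrices that do not raise columns, and the nilradical u of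
   those that lower every column. Two facts give the theorem.

   If [p, x] = u, then the orbit of x is open and dense. For y in u, solving
   x h = h (x + t (y - x)), h(0) = 1, order by order in t and then exactly over
   k[t] shows that the parabolic of GL(V) conjugates x to all but finitely many
   points of the line through x and y; as char k <> 2, a polar decomposition moves
   the conjugating element into Sp(V). So the orbit is dense and contains each
   element y with [p, y] = u, an open condition.

   By duality for the trace form, [p, x] = u holds if each z in sp(V) with [z, x]
   in u lies in p. For the element x of D(d) the equations ([z, x])_{vw} = 0
   propagate the vanishing of the entries z_{vw}, where w is to the right of v,
   along the rows of v and w until one of them ends, which settles all pairs of
   rows that are nested. The greedy decomposition of d makes all rows nested except
   the two rows of a block through the middle column; these are treated by means
   of the skew symmetry of z and, if they differ by two or more vertices on a side,
   of the additional arrow. *)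

From HB Require Import structures.
Require Import Defs.
From mathcomp Require Import all_boot all_order all_algebra fraction generic_quotient.
From mathcomp.multinomials Require Import mpoly.
From mathcomp Require Import zify ring.

Set Implicit Arguments.
Unset Strict Implicit.
Unset Printing Implicit Defensive.

Import Order.TTheory GRing.Theory Num.Theory.
Local Open Scope ring_scope.

(** No exponentials and no dimensions of orbits enter: the equality [p, x] = u is turned into actual
    conjugations by solving over k[t], in any characteristic but 2. The isometry condition g g^* = 1
    is quadratic and is kept only modulo powers of t; the passage from approximate to exact
    solutions uses the linear equation in h alone, and this is why isometry has to be restored
    afterwards. The space u must also be identified with the tangent space of the unipotent radical,
    a union of subgroups by definition. The isometries g for which g - 1 lowers every column form a
    connected group U, contracted to 1 by a cocharacter; conversely, traces of products of two
    conjugates force a normal unipotent subgroup to have trivial diagonal blocks, hence to lie in U.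
    Rows are replaced by chains: in a block with entries 1 and 2 that avoids the middle column, the
    two additional arrows join half rows crosswise, and the chains obtained are the columns with
    entry at least 1 and those with entry 2. Away from the middle all chains are thus level sets of
    functions monotone in d, and such sets are comparable. *)

Lemma two_eq0 (k : fieldType) (a : k) : (2%:R : k) != 0 -> a + a = 0 -> a = 0.
Proof.
by move=> k2 /eqP; rewrite -mulr2n -mulr_natr mulf_eq0 (negPf k2) orbF => /eqP.
Qed.

(** * The adjoint with respect to the symplectic form *)

Section Adjoint.

Variable n : nat.

Lemma rev_ord_eq (p q : 'I_(n + n)) : (rev_ord p == q) = (p == rev_ord q).
Proof. by apply/eqP/eqP => [<-|->]; rewrite rev_ordK. Qed.

Lemma rev_ord_neq (p : 'I_(n + n)) : (rev_ord p == p) = false.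
Proof. by apply/negP => /eqP /(congr1 val) /=; have := ltn_ord p; lia. Qed.

Lemma label_rev (p : 'I_(n + n)) : label (rev_ord p) = - label p.
Proof. by rewrite /label /=; have hp := ltn_ord p; (do 2 case: ltnP => ?); lia. Qed.

Lemma label_le (p q : 'I_(n + n)) : (label p <= label q) = (p <= q)%N.
Proof. by rewrite /label; (do 2 case: ltnP => ?); lia. Qed.

Lemma label_inj : injective (@label n).
Proof.
by move=> p q pq; apply/val_inj/eqP; rewrite eqn_leq -!label_le pq lexx.
Qed.

Lemma label_gt0 (p : 'I_(n + n)) : (0 < label p) = (n <= p)%N.
Proof. by rewrite /label; case: ltnP => ?; lia. Qed.

Section Ring.

Variable R : comNzRingType.
Implicit Types A B : 'M[R]_(n + n).

Definition lsign (p : 'I_(n + n)) : R := if (n <= p)%N then 1 else -1.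

Lemma lsign_rev p : lsign (rev_ord p) = - lsign p.
Proof.
rewrite /lsign /=; have hp := ltn_ord p.
by (do 2 case: leqP => ?); rewrite ?opprK //; lia.
Qed.

Lemma lsign_sqr p : lsign p * lsign p = 1.
Proof. by rewrite /lsign; case: leqP => _; rewrite ?mulrNN mulr1. Qed.

Lemma lsign_neq0 p : lsign p != 0.
Proof. by rewrite /lsign; case: leqP => _; rewrite ?oppr_eq0 oner_eq0. Qed.

(** In terms of the Gram matrix J this is J A^T J^-1, see [sadj_gram]. The entrywise formula makes
    sense over every commutative ring, so the adjoint commutes with the evaluation of polynomial
    entries. *)
Definition sadj A : 'M[R]_(n + n) :=
  \matrix_(p, q) (lsign p * lsign q * A (rev_ord q) (rev_ord p)).

Lemma sadj_is_linear : linear sadj.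
Proof. by move=> a A B; apply/matrixP => p q; rewrite !mxE; ring. Qed.

HB.instance Definition _ :=
  GRing.isLinear.Build R 'M[R]_(n + n) 'M[R]_(n + n) _ sadj sadj_is_linear.

Lemma sadjK : involutive sadj.
Proof.
move=> A; apply/matrixP => p q; rewrite !mxE !lsign_rev !rev_ordK.
have -> : lsign p * lsign q * (- lsign q * - lsign p * A p q) =
  (lsign p * lsign p) * (lsign q * lsign q) * A p q by ring.
by rewrite !lsign_sqr !mul1r.
Qed.

Lemma sadj1 : sadj 1%:M = 1%:M.
Proof.
apply/matrixP => p q; rewrite !mxE (inj_eq rev_ord_inj) eq_sym.
by case: eqP => [->|_]; rewrite ?lsign_sqr ?mulr1 ?mulr0.
Qed.

Lemma sadjM A B : sadj (A *m B) = sadj B *m sadj A.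
Proof.
apply/matrixP => p q; rewrite !mxE mulr_sumr [RHS](reindex_inj rev_ord_inj) /=.
apply: eq_bigr => r _; rewrite !mxE !rev_ordK.
transitivity (lsign (rev_ord r) * lsign (rev_ord r) *
   (lsign p * lsign q * (A (rev_ord q) r * B r (rev_ord p)))); last by ring.
by rewrite lsign_sqr mul1r.
Qed.

Lemma sadj_skewP A :
  sadj A = - A <->
  forall p q, A (rev_ord q) (rev_ord p) = - (lsign p * lsign q * A p q).
Proof.
split=> [skA p q | skA].
  have /matrixP/(_ p q) := skA; rewrite !mxE => /(congr1 ( *%R (lsign p * lsign q))).
  have -> : lsign p * lsign q * (lsign p * lsign q * A (rev_ord q) (rev_ord p)) =
    (lsign p * lsign p) * (lsign q * lsign q) * A (rev_ord q) (rev_ord p) by ring.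
  by rewrite !lsign_sqr !mul1r mulrN.
apply/matrixP => p q; rewrite !mxE skA.
transitivity (- ((lsign p * lsign p) * (lsign q * lsign q) * A p q)); first by ring.
by rewrite !lsign_sqr !mul1r.
Qed.

End Ring.

Lemma map_sadj (R S : comNzRingType) (f : {rmorphism R -> S}) (A : 'M[R]_(n + n)) :
  map_mx f (sadj A) = sadj (map_mx f A).
Proof.
apply/matrixP => p q; rewrite !mxE !rmorphM /=.
by rewrite /lsign; do 2 case: leqP => _; rewrite ?rmorphN ?rmorph1.
Qed.

End Adjoint.

(** * Matrices filtered by columns *)

Section Filtration.

Variables (n : nat) (col : 'I_(n + n) -> int).
Hypothesis col_rev : forall p, col (rev_ord p) = - col p.

(** Vectors are rows, so [A p q] is the coefficient of v_q in the image of v_p, and the condition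
    says that A moves every vector at least e columns to the left. Degree 0 describes the parabolic,
    degree 1 its nilradical. *)
Definition lowers (R : comNzRingType) (e : int) (A : 'M[R]_(n + n)) : Prop :=
  forall p q, col p < col q + e -> A p q = 0.

Section Ring.

Variable R : comNzRingType.
Implicit Types A B : 'M[R]_(n + n).

Lemma lowersW e e' A : e <= e' -> lowers e' A -> lowers e A.
Proof. by move=> ee' lA p q pq; apply: lA; lia. Qed.

Lemma lowersM e e' A B : lowers e A -> lowers e' B -> lowers (e + e') (A *m B).
Proof.
move=> lA lB p q pq; rewrite mxE big1 // => r _.
have [/lA->|rp] := ltP (col p) (col r + e); first by rewrite mul0r.
by rewrite lB ?mulr0 //; lia.
Qed.

Lemma lowers_mul0 A B : lowers 0 A -> lowers 0 B -> lowers 0 (A *m B).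
Proof. exact: lowersM. Qed.

Lemma lowers1 : lowers 0 (1%:M : 'M[R]_(n + n)).
Proof.
by move=> p q pq; rewrite mxE; case: eqP pq => // ->; rewrite addr0 ltxx.
Qed.

Lemma lowers0 e : lowers e (0 : 'M[R]_(n + n)).
Proof. by move=> p q _; rewrite mxE. Qed.

Lemma lowersD e A B : lowers e A -> lowers e B -> lowers e (A + B).
Proof. by move=> lA lB p q pq; rewrite mxE lA ?lB ?addr0. Qed.

Lemma lowersZ e a A : lowers e A -> lowers e (a *: A).
Proof. by move=> lA p q pq; rewrite mxE lA ?mulr0. Qed.

Lemma lowersN e A : lowers e A -> lowers e (- A).
Proof. by move=> lA p q pq; rewrite mxE lA ?oppr0. Qed.

Lemma lowersB e A B : lowers e A -> lowers e B -> lowers e (A - B).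
Proof. by move=> lA lB; apply/lowersD/lowersN. Qed.

Lemma lowers_sadj e A : lowers e A -> lowers e (sadj A).
Proof. by move=> lA p q pq; rewrite mxE lA ?mulr0 // !col_rev; lia. Qed.

(** The projection onto the matrices with [lowers e]; it makes membership in this subspace part of a
    linear map defined on all matrices. *)
Definition gmask (e : int) A : 'M[R]_(n + n) :=
  \matrix_(p, q) if col p < col q + e then 0 else A p q.

Lemma gmask_is_linear e : linear (gmask e).
Proof.
move=> a A B; apply/matrixP => p q; rewrite !mxE; case: ifP => _ //.
by rewrite mulr0 addr0.
Qed.

HB.instance Definition _ e :=
  GRing.isLinear.Build R 'M[R]_(n + n) 'M[R]_(n + n) _ (gmask e)
    (gmask_is_linear e).

Lemma gmaskP e A : lowers e (gmask e A).
Proof. by move=> p q pq; rewrite mxE pq. Qed.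

Lemma gmask_id e A : lowers e A -> gmask e A = A.
Proof. by move=> lA; apply/matrixP => p q; rewrite mxE; case: ifP => // /lA. Qed.

Lemma gmask_sadj e A : gmask e (sadj A) = sadj (gmask e A).
Proof.
apply/matrixP => p q; rewrite !mxE !col_rev.
have -> : (- col q < - col p + e) = (col p < col q + e) by lia.
by case: ifP => _; rewrite ?mulr0.
Qed.

End Ring.

Lemma lowers_map (R S : comNzRingType) (f : {rmorphism R -> S}) e
    (A : 'M[R]_(n + n)) :
  lowers e A -> lowers e (map_mx f A).
Proof. by move=> lA p q pq; rewrite mxE lA ?rmorph0. Qed.

End Filtration.

(** * The open orbit of a parabolic subgroup *)

Lemma eigenvector_exp (F : fieldType) (N m : nat) (A : 'M[F]_N) (v : 'rV_N) z :
  v *m A = z *: v -> v *m A ^+ m = z ^+ m *: v.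
Proof.
move=> vA; elim: m => [|m IHm]; first by rewrite mulmx1 scale1r.
by rewrite exprSr mulmxA IHm -scalemxAl vA scalerA exprSr.
Qed.

(** * Traces of nilpotent matrices and inverse square roots over a closed field *)

Section ClosedField.

Variable k : closedFieldType.

(** The characteristic polynomial splits and its roots, being eigenvalues of a nilpotent matrix,
    vanish; it is therefore a power of ['X], without subleading coefficient. *)
Lemma mxtrace_nilpotent (N m : nat) (A : 'M[k]_N) : A ^+ m = 0 -> \tr A = 0.
Proof.
case: N A => [|N] A nilA; first by rewrite /mxtrace big_ord0.
have [r pE] := closed_field_poly_normal (char_poly A).
rewrite (monicP (char_poly_monic A)) scale1r in pE.
have r0 z : z \in r -> z = 0.
  move=> zr; have : eigenvalue A z.
    by rewrite eigenvalue_root_char pE root_prod_XsubC.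
  case/eigenvalueP => v vA v0.
  have := eigenvector_exp m vA.
  rewrite nilA mulmx0 => /esym/eqP; rewrite scaler_eq0 (negPf v0) orbF.
  by rewrite expf_eq0 => /andP[_ /eqP].
have {}pE : char_poly A = 'X^(size r).
  rewrite pE; elim: r r0 {pE} => [|z r IHr] r0; first by rewrite big_nil.
  rewrite big_cons IHr; last by move=> y yr; apply: r0; rewrite inE yr orbT.
  by rewrite (r0 z) ?mem_head // subr0 exprS.
have := size_char_poly A; rewrite pE size_polyXn => -[sr].
have /esym := char_poly_trace A isT.
by rewrite pE sr coefXn /= ltn_eqF // => /eqP; rewrite oppr_eq0 => /eqP.
Qed.

Hypothesis char_k : (2%:R : k) != 0.

Lemma sqrt_exists (a : k) : exists b, b ^+ 2 = a.
Proof.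
have [b bE] := @solve_monicpoly k 2 (fun i => if i == 0%N then a else 0) isT.
by exists b; rewrite bE !big_ord_recl big_ord0 /= mul0r !addr0 expr0 mulr1.
Qed.

(** Newton interpolation: at a new node a the value is corrected by a multiple of the product that
    vanishes at the old nodes. *)
Lemma inv_sqrt_interpolation (s : seq k) : 0 \notin s ->
  exists r : {poly k}, forall a, a \in s -> r.[a] ^+ 2 * a = 1.
Proof.
elim: s => [|a s IHs]; first by exists 0.
rewrite inE negb_or eq_sym => /andP[a0 /IHs[r rE]].
have [as_|nas] := boolP (a \in s).
  by exists r => b; rewrite inE => /predU1P[->|]; apply: rE.
have [b bE] := sqrt_exists a^-1.
pose p := \prod_(z <- s) ('X - z%:P).
have pa : p.[a] != 0.
  by rewrite -[_ == 0]/(root p a) root_prod_XsubC.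
exists (r + ((b - r.[a]) / p.[a]) *: p) => c; rewrite inE => /predU1P[->|cs].
  by rewrite !hornerE mulfVK // addrC subrK bE mulVf.
have -> : (r + ((b - r.[a]) / p.[a]) *: p).[c] = r.[c]; last exact: rE.
rewrite !hornerE; suff -> : p.[c] = 0 by rewrite mulr0 addr0.
by apply/rootP; rewrite root_prod_XsubC.
Qed.

(** Interpolation makes the error [r0 ^+ 2 * 'X - 1] vanish at each root of p; Newton's iteration
    for the inverse square root then squares the error until the multiplicities of the roots are
    reached. *)
Lemma inv_sqrt_modp (p : {poly k}) : p.[0] != 0 ->
  exists r : {poly k}, p %| r ^+ 2 * 'X - 1.
Proof.
move=> p0; have [s pE] := closed_field_poly_normal p.
have lp : lead_coef p != 0.
  by apply: contraNneq p0 => lp0; rewrite pE lp0 scale0r horner0.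
have s0 : 0 \notin s.
  apply: contra p0 => s0; rewrite pE hornerZ mulf_eq0 -rootE root_prod_XsubC.
  by rewrite s0 orbT.
have [r0 r0E] := inv_sqrt_interpolation s0.
have base : p %| (r0 ^+ 2 * 'X - 1) ^+ size s.
  rewrite pE dvdpZl //.
  elim: s r0E {pE s0} => [|a s IHs] r0E; first by rewrite big_nil.
  rewrite big_cons /= exprS dvdp_mul ?IHs //.
    by rewrite dvdp_XsubCl rootE !hornerE r0E ?mem_head // subrr.
  by move=> b bs; rewrite r0E // inE bs orbT.
have [c c2] : exists c : k, c + c = 1.
  by exists 2%:R^-1; rewrite -[X in X + X]mul1r -mulrDl; apply: mulfV.
have newton j : exists r : {poly k}, (r0 ^+ 2 * 'X - 1) ^+ (2 ^ j) %| r ^+ 2 * 'X - 1.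
  elim: j => [|j [r re]]; first by exists r0; rewrite expn0 expr1.
  pose e := r ^+ 2 * 'X - 1; pose C : {poly k} := c%:P.
  (* Newton's step for the inverse square root, with C = 1/2: in the new error the coefficient 1 -
     (C + C) of e is 0. *)
  exists (r * (1 - C * e)).
  have CC : C + C = 1 by rewrite -polyCD c2.
  have -> : (r * (1 - C * e)) ^+ 2 * 'X - 1 = e ^+ 2 * (C ^+ 2 + C ^+ 2 * e - (C + C)) + e * (1 - (C + C)).
    by rewrite /e; ring.
  rewrite CC subrr mulr0 addr0 dvdp_mulr // expnS mulnC exprM.
  exact: dvdp_exp2r.
have [r rE] := newton (size s); exists r; apply: dvdp_trans rE.
by apply: dvdp_trans base _; apply: dvdp_exp2l; rewrite ltnW // ltn_expl.
Qed.

(** By Cayley-Hamilton an inverse square root of ['X] modulo the characteristic polynomial can be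
    evaluated at Q. The second conclusion records that S is a polynomial in Q, as an induction
    principle along Horner's scheme. *)
Lemma inv_sqrt_mx (N : nat) (Q : 'M[k]_N) : Q \in unitmx ->
  exists2 S : 'M[k]_N, S *m S *m Q = 1%:M &
    forall P : 'M[k]_N -> Prop, P 0 ->
      (forall c A, P A -> P (A *m Q + c%:M)) -> P S.
Proof.
case: N Q => [|N] Q uQ.
  by exists 0 => [|P P0 _]; first by apply/matrixP => - [].
have p0 : (char_poly Q).[0] != 0.
  by rewrite horner_coef0 char_poly_det mulf_neq0 ?signr_eq0 // -unitfE -unitmxE.
have [r /dvdpP [h rh]] := inv_sqrt_modp p0.
exists (horner_mx Q r).
  have : horner_mx Q (r ^+ 2 * 'X - 1) = 0.
    by rewrite rh rmorphM /= Cayley_Hamilton mulr0.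
  rewrite rmorphB rmorphM rmorphXn rmorph1 /= horner_mx_X => /eqP.
  by rewrite subr_eq0 expr2 => /eqP.
move=> P P0 Pstep; elim/poly_ind: r {rh} => [|r c Pr]; first by rewrite rmorph0.
by rewrite rmorphD rmorphM /= horner_mx_X horner_mx_C; apply: Pstep.
Qed.

Lemma poly_nonroot (p : {poly k}) : p != 0 -> exists t, p.[t] != 0.
Proof.
move=> p0; have [/size1_polyC pE|p1] := leqP (size p) 1.
  by exists 0; rewrite pE hornerC; apply: contraNneq p0 => c0; rewrite pE c0.
(* A root of p + 1 is a point where p takes the value -1. *)
have /closed_rootP[t] : size (p + 1) != 1%N.
  by rewrite size_polyDl ?size_poly1 // neq_ltn p1 orbT.
rewrite rootE !hornerE addr_eq0 => /eqP pt.
by exists t; rewrite pt oppr_eq0 oner_eq0.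
Qed.

Lemma poly_eq0_horner (p : {poly k}) : (forall t, p.[t] = 0) -> p = 0.
Proof.
by move=> p0; apply/eqP; apply: contraT => /poly_nonroot[t]; rewrite p0 eqxx.
Qed.

End ClosedField.

(** * Linear systems over k[t]: from approximate to exact solutions *)

Section Kernels.
Local Open Scope quotient_scope.

Section Denominators.

Variable R : idomainType.
Local Notation tofrac := (@FracField.tofrac R).

Lemma fraction_clear (x : {fraction R}) :
  exists2 d : R, d != 0 & exists a, tofrac d * x = tofrac a.
Proof.
rewrite -[x]reprK; move: (repr x) => r; exists \d_r; first exact: denom_ratioP.
exists \n_r; unlock FracField.tofrac; rewrite -[LHS]FracField.pi_mul.
apply/eqmodP; rewrite /= FracField.equivfE /FracField.mulf.
by rewrite !numden_Ratio ?mulf_neq0 ?oner_neq0 ?denom_ratioP // !mul1r mulr1.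
Qed.

Lemma mx_fraction_clear (m n : nat) (M : 'M[{fraction R}]_(m, n)) :
  exists2 d : R, d != 0 & exists A, tofrac d *: M = map_mx tofrac A.
Proof.
have entry (i : 'I_m * 'I_n) : {da : R * R | (da.1 != 0) && (tofrac da.1 * M i.1 i.2 == tofrac da.2)}.
  apply: sigW; have [d d0 [a da]] := fraction_clear (M i.1 i.2).
  by exists (d, a); rewrite d0 da eqxx.
pose d i := (sval (entry i)).1; pose a i := (sval (entry i)).2.
have d0 i : d i != 0 by rewrite /d; case: (entry i) => ? /= /andP[].
have dE i : tofrac (d i) * M i.1 i.2 = tofrac (a i).
  by rewrite /d /a; case: (entry i) => ? /= /andP[_ /eqP].
exists (\prod_i d i); first by apply/prodf_neq0 => i _; apply: d0.
exists (\matrix_(i, j) (a (i, j) * \prod_(l | l != (i, j)) d l)).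
apply/matrixP => i j; rewrite !mxE (bigD1 (i, j)) //= !rmorphM /= -dE /=; ring.
Qed.

(** A generalized inverse over the fraction field, multiplied by a common denominator d. *)
Lemma quasi_inverse (m n : nat) (M : 'M[R]_(m, n)) :
  exists2 d : R, d != 0 & exists A : 'M[R]_(n, m), M *m A *m M = d *: M.
Proof.
have [d d0 [A dA]] := mx_fraction_clear (pinvmx (map_mx tofrac M)).
exists d => //; exists A.
suff /matrixP E : map_mx tofrac (M *m A *m M) = map_mx tofrac (d *: M).
  apply/matrixP => i j; apply/eqP; rewrite -tofrac_eq; apply/eqP.
  by have := E i j; rewrite [LHS]mxE [RHS]mxE.
rewrite !map_mxM -dA map_mxZ /= -scalemxAr -scalemxAl.
by rewrite mulmxKpV // submx_refl.
Qed.

End Denominators.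

Section PolyKernel.

Variable k : fieldType.

Definition mx_at (t : k) (m n : nat) (A : 'M[{poly k}]_(m, n)) : 'M[k]_(m, n) :=
  map_mx (horner_eval t) A.

(* A solution modulo a high power of ['X] agrees modulo ['X] with a solution:
   if M A M = d M then [d v - v M A] is a solution, and it remains to divide it
   by the power of ['X] in d. *)
Lemma kernel_lift (a b : nat) (M : 'M[{poly k}]_(a, b)) :
  exists N : nat, forall (v : 'rV_a) e, v *m M = 'X^N *: e ->
    exists2 w, w *m M = 0 & mx_at 0 w = mx_at 0 v.
Proof.
have [d d0 [A MAM]] := quasi_inverse M.
have [j [q q0 dE]] := multiplicity_XsubC d 0.
rewrite subr0 in dE; rewrite d0 /= rootE in q0.
(* One power more than the order of d at 0: the correction term then keeps a factor ['X], and w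
   agrees at 0 with [q *: v], where q does not vanish. *)
exists j.+1 => v e vM.
have Xj0 : 'X^j != 0 :> {poly k} by rewrite expf_neq0 ?polyX_eq0.
pose w := q *: v - 'X *: (e *m A).
have wE : 'X^j *: w = d *: v - v *m M *m A.
  by rewrite scalerBr !scalerA dE vM -scalemxAl exprS [q * _]mulrC ['X * _]mulrC.
have wM : w *m M = 0.
  have : 'X^j *: (w *m M) = 0.
    rewrite scalemxAl wE mulmxBl -scalemxAl -!mulmxA [M *m (A *m M)]mulmxA MAM.
    by rewrite -scalemxAr subrr.
  move=> /rowP E; apply/rowP => i; have /eqP := E i.
  by rewrite !mxE mulf_eq0 (negPf Xj0) => /eqP.
exists (q.[0]^-1%:P *: w); first by rewrite -scalemxAl wM scaler0.
apply/rowP => i; rewrite !mxE /horner_eval !hornerE /=.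
by rewrite ?(mul0r, subr0, oppr0, addr0) mulKf.
Qed.

End PolyKernel.

End Kernels.

Section PolyMatrix.

Variable k : fieldType.

Definition cmx (m n : nat) (A : 'M[k]_(m, n)) : 'M[{poly k}]_(m, n) := map_mx polyC A.

Variable t : k.

Lemma mx_atM (m n p : nat) (A : 'M[{poly k}]_(m, n)) (B : 'M_(n, p)) :
  mx_at t (A *m B) = mx_at t A *m mx_at t B.
Proof. exact: map_mxM. Qed.

Lemma mx_atD (m n : nat) (A B : 'M[{poly k}]_(m, n)) : mx_at t (A + B) = mx_at t A + mx_at t B.
Proof. exact: map_mxD. Qed.

Lemma mx_atB (m n : nat) (A B : 'M[{poly k}]_(m, n)) : mx_at t (A - B) = mx_at t A - mx_at t B.
Proof. exact: map_mxB. Qed.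

Lemma mx_atN (m n : nat) (A : 'M[{poly k}]_(m, n)) : mx_at t (- A) = - mx_at t A.
Proof. exact: map_mxN. Qed.

Lemma mx_atZ (m n : nat) a (A : 'M[{poly k}]_(m, n)) : mx_at t (a *: A) = a.[t] *: mx_at t A.
Proof. exact: map_mxZ. Qed.

Lemma mx_at1 (n : nat) : mx_at t (1%:M : 'M_n) = 1%:M.
Proof. by rewrite /mx_at map_mx1. Qed.

Lemma mx_at_cmx (m n : nat) (A : 'M_(m, n)) : mx_at t (cmx A) = A.
Proof. by apply/matrixP => i j; rewrite !mxE /horner_eval hornerC. Qed.

Lemma mx_at_sadj (n : nat) (A : 'M[{poly k}]_(n + n)) : mx_at t (sadj A) = sadj (mx_at t A).
Proof. exact: map_sadj. Qed.

Definition mx_atE := (mx_atM, mx_atD, mx_atB, mx_atN, mx_atZ, mx_at1, mx_at_cmx, mx_at_sadj).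

End PolyMatrix.

Lemma mx_at0_divX (k : fieldType) (m n : nat) (A : 'M[{poly k}]_(m, n)) :
  mx_at 0 A = 0 -> exists B, A = 'X *: B.
Proof.
move=> A0; exists (map_mx (fun p => p %/ 'X) A); apply/matrixP => i j.
rewrite !mxE mulrC divpK // -['X]subr0 dvdp_XsubCl rootE.
by have /matrixP/(_ i j) := A0; rewrite !mxE /horner_eval => ->.
Qed.

Lemma scaler_Xn_inj (k : fieldType) (m n : nat) j (A B : 'M[{poly k}]_(m, n)) :
  'X^j *: A = 'X^j *: B -> A = B.
Proof.
move=> /matrixP E; apply/matrixP => i l; have := E i l; rewrite !mxE.
by apply: mulfI; rewrite expf_neq0 ?polyX_eq0.
Qed.

(** * Conjugating x along a line, order by order in t *)

Section FormalConjugation.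

Variables (n : nat) (col : 'I_(n + n) -> int).
Hypothesis col_rev : forall p, col (rev_ord p) = - col p.

Definition sp_lie (R : comNzRingType) (A : 'M[R]_(n + n)) : Prop := sadj A = - A.

Definition para_lie (R : comNzRingType) (Z : 'M[R]_(n + n)) : Prop :=
  sp_lie Z /\ lowers col 0 Z.
Definition nil_lie (R : comNzRingType) (X : 'M[R]_(n + n)) : Prop :=
  sp_lie X /\ lowers col 1 X.
Definition para_group (R : comNzRingType) (g : 'M[R]_(n + n)) : Prop :=
  g *m sadj g = 1%:M /\ lowers col 0 g.

Variable k : closedFieldType.
Implicit Types x y g h Z W : 'M[k]_(n + n).

Definition ad_onto x : Prop :=
  forall W, nil_lie W -> exists2 Z, para_lie Z & Z *m x - x *m Z = W.

Hypothesis char_k : (2%:R : k) != 0.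

Lemma sp_lieD (R : comNzRingType) (A B : 'M[R]_(n + n)) : sp_lie A -> sp_lie B -> sp_lie (A + B).
Proof. by rewrite /sp_lie linearD /= => -> ->; rewrite opprD. Qed.

Lemma sp_lieN (R : comNzRingType) (A : 'M[R]_(n + n)) : sp_lie A -> sp_lie (- A).
Proof. by rewrite /sp_lie linearN /= => ->. Qed.

Lemma sp_lieZ (R : comNzRingType) a (A : 'M[R]_(n + n)) : sp_lie A -> sp_lie (a *: A).
Proof. by rewrite /sp_lie linearZ /= => ->; rewrite scalerN. Qed.

Lemma sp_lie_conj (R : comNzRingType) (h A : 'M[R]_(n + n)) :
  sp_lie A -> sp_lie (sadj h *m A *m h).
Proof. by rewrite /sp_lie !sadjM sadjK => ->; rewrite mulNmx mulmxN mulmxA. Qed.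

Lemma sp_lie_cmx x : sp_lie x -> sp_lie (cmx x).
Proof. by rewrite /sp_lie /cmx -map_sadj => ->; rewrite map_mxN. Qed.

Lemma nil_lie_line x y t : nil_lie x -> nil_lie y -> nil_lie (x + t *: (y - x)).
Proof.
move=> [sx lx] [sy ly]; split; first by do ?[apply: sp_lieD | apply: sp_lieZ | apply: sp_lieN].
by do ?[apply: lowersD | apply: lowersZ | apply: lowersN].
Qed.

Definition line x y : 'M[{poly k}]_(n + n) := cmx x + 'X *: cmx (y - x).

Lemma line_at t x y : mx_at t (line x y) = x + t *: (y - x).
Proof. by rewrite /line !mx_atE hornerX. Qed.

Lemma nil_lie_cmx x : nil_lie x -> nil_lie (cmx x).
Proof. by move=> [sx lx]; split; [exact: sp_lie_cmx | exact: lowers_map]. Qed.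

Lemma nil_line x y : nil_lie x -> nil_lie y -> nil_lie (line x y).
Proof.
move=> nx ny; rewrite /line /cmx map_mxB -/(cmx _) -/(cmx _).
have [sx lx] := nil_lie_cmx nx; have [sy ly] := nil_lie_cmx ny.
split; first by do ?[apply: sp_lieD | apply: sp_lieZ | apply: sp_lieN].
by do ?[apply: lowersD | apply: lowersZ | apply: lowersN].
Qed.

Lemma lowers_divXn j e (A : 'M[{poly k}]_(n + n)) :
  lowers col e ('X^j *: A) -> lowers col e A.
Proof.
move=> lA p q /lA/eqP; rewrite mxE mulf_eq0 expf_eq0 polyX_eq0 andbF /=.
by move/eqP.
Qed.

(** Isometry is carried along because [ad_onto] only solves equations with a skew-adjoint right-hand
    side. Let T be the power of ['X] reached so far, T S the failure of isometry and T W that of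
    conjugation; h is multiplied by 1 + T C, where the self-adjoint part of C repairs the first and
    its part in p the second. *)
Lemma lift_mod x y N : nil_lie x -> nil_lie y -> ad_onto x ->
  exists h : 'M[{poly k}]_(n + n),
    [/\ lowers col 0 h, mx_at 0 h = 1%:M,
        exists S : 'M[{poly k}]_(n + n), sadj h *m h = 1%:M + 'X^(N.+1) *: S
      & exists W : 'M[{poly k}]_(n + n), cmx x *m h - h *m line x y = 'X^(N.+1) *: W].
Proof.
move=> nx ny ontox; have [half half2] : exists c : k, c + c = 1.
  by exists 2%:R^-1; rewrite -[X in X + X]mul1r -mulrDl; apply: mulfV.
have [sX lX] := nil_lie_cmx nx; have [sY lY] := nil_line nx ny.
elim: N => [|N [h [lh h0 [S hS] [W hW]]]].
  exists 1%:M; split; first exact: lowers1; first by rewrite mx_at1.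
    by exists 0; rewrite sadj1 mulmx1 scaler0 addr0.
  exists (- cmx (y - x)); rewrite mulmx1 mul1mx /line opprD addrA subrr add0r.
  by rewrite scalerN.
set T := 'X^(N.+1) in hS hW *; set X := cmx x in sX lX hW; set Y := line x y in sY lY hW *.
pose S0 := mx_at 0 S; pose W0 := mx_at 0 W.
have Y0 : mx_at 0 Y = x by rewrite line_at scale0r addr0.
have TS : T *: S = sadj h *m h - 1%:M by rewrite hS addrC addKr.
have lS : lowers col 0 S.
  apply: (@lowers_divXn N.+1); rewrite -/T.
  rewrite TS.
  by apply: lowersB (@lowers1 _ _ _); apply: lowers_mul0 => //; apply: lowers_sadj.
have lW : lowers col 1 W.
  apply: (@lowers_divXn N.+1); rewrite -/T -hW.
  by apply: lowersB; [apply: (@lowersM _ _ _ 1 0) | apply: (@lowersM _ _ _ 0 1)].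
have aS : sadj S = S.
  apply: (@scaler_Xn_inj _ _ _ N.+1); rewrite -/T -linearZ /=.
  rewrite TS.
  by rewrite linearB /= sadjM sadjK sadj1.
have aS0 : sadj S0 = S0 by rewrite /S0 -mx_at_sadj aS.
(* Multiplied by T this becomes [sadj h *m X *m h - Y], a difference of skew-adjoint matrices. *)
have sK : sp_lie (S *m Y + sadj h *m W).
  apply: (@scaler_Xn_inj _ _ _ N.+1); rewrite -/T -linearZ /= scalerN.
  have -> : T *: (S *m Y + sadj h *m W) = sadj h *m X *m h - Y.
    rewrite scalerDr scalemxAl TS scalemxAr -hW mulmxBr !mulmxA mulmxBl mul1mx.
    move: (sadj h *m h *m Y) => a.
    by apply/matrixP => i j; rewrite !mxE; ring.
  by apply: sp_lieD; [apply: sp_lie_conj | apply: sp_lieN].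
have {sK} sK0 : sp_lie (S0 *m x + W0).
  move: sK => /(congr1 (@mx_at _ 0 _ _)).
  by rewrite mx_at_sadj mx_atN mx_atD !mx_atM mx_at_sadj Y0 h0 sadj1 mul1mx.
(* The error left for Z once the self-adjoint part [- half *: S0] of C0 has acted. It is
   skew-adjoint, since [x *m S0 + S0 *m x] is. *)
pose W' := S0 *m x + W0 - half *: (x *m S0 + S0 *m x).
have [sx lx] := nx.
have lS0 : lowers col 0 S0 by apply: lowers_map.
have nW' : nil_lie W'.
  split.
    apply: sp_lieD => //; apply/sp_lieN/sp_lieZ; rewrite /sp_lie linearD /= !sadjM aS0 sx.
    by rewrite mulmxN mulNmx opprD addrC.
  have l1 : lowers col 1 (S0 *m x) by apply: (@lowersM _ _ _ 0 1).
  apply: lowersB; first by apply: lowersD => //; apply: lowers_map.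
  by apply/lowersZ/lowersD => //; apply: (@lowersM _ _ _ 1 0).
have [Z [sZ lZ] ZE] := ontox _ nW'.
pose C0 := Z - half *: S0; pose C := cmx C0.
have lC : lowers col 0 C by apply/lowers_map/lowersB/lowersZ.
have CC : sadj C0 + C0 = - S0.
  rewrite /C0 linearB /= linearZ /= aS0 sZ addrACA addNr add0r -opprD -scalerDl.
  by rewrite half2 scale1r.
have [S1 S1E] : exists S1 : 'M[{poly k}]_(n + n), S + (sadj C + C) = 'X *: S1.
  by apply: mx_at0_divX; rewrite !mx_atE CC subrr.
have [W1 W1E] : exists W1 : 'M[{poly k}]_(n + n), W + (X *m h *m C - h *m C *m Y) = 'X *: W1.
  apply: mx_at0_divX; rewrite mx_atD mx_atB !mx_atM Y0 h0 !mx_at_cmx mulmx1 mul1mx -/W0.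
  rewrite /C0 mulmxBr mulmxBl -scalemxAr -scalemxAl.
  have /(canRL (subrK _)) -> := ZE.
  have h2 := half2; rewrite /W'; clear -h2.
  move: (x *m Z) (x *m S0) (S0 *m x) W0 => a b c d.
  apply/matrixP => i j; rewrite !mxE.
  transitivity ((half + half) * c i j - c i j); first by ring.
  by rewrite h2 mul1r subrr.
exists (h + T *: (h *m C)); split.
- by apply/lowersD/lowersZ => //; apply: lowers_mul0.
- by rewrite !mx_atE h0 hornerXn expr0n scale0r addr0.
- exists (S1 + 'X^N *: (sadj C *m S + S *m C + sadj C *m C + T *: (sadj C *m S *m C))).
  rewrite [sadj (h + _)]linearD /= [sadj (T *: _)]linearZ /= sadjM mulmxDl !mulmxDr -!scalemxAl -!scalemxAr.
  have TE : T = 'X * 'X^N by rewrite /T exprS.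
  have -> : sadj C *m sadj h *m (h *m C) = sadj C *m C + T *: (sadj C *m S *m C).
    by rewrite mulmxA -(mulmxA (sadj C)) hS mulmxDr mulmx1 mulmxDl -scalemxAr -scalemxAl.
  have -> : sadj C *m sadj h *m h = sadj C + T *: (sadj C *m S).
    by rewrite -mulmxA hS mulmxDr mulmx1 -scalemxAr.
  have -> : sadj h *m (h *m C) = C + T *: (S *m C).
    by rewrite mulmxA hS mulmxDl mul1mx -scalemxAl.
  rewrite hS; move: S1E.
  move: (sadj C *m C) (sadj C *m S) (S *m C) (sadj C *m S *m C) => b c d a S1E.
  transitivity (1%:M + (T *: ('X *: S1) + T *: (T *: (c + d + b + T *: a)))).
    by rewrite -S1E; apply/matrixP => i j; rewrite !mxE; ring.
  apply/matrixP => i j; rewrite !mxE exprS -/T TE; ring.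
- exists W1; rewrite exprSr -scalerA -W1E scalerDr -hW.
  by rewrite mulmxDr mulmxDl -!scalemxAr -!scalemxAl scalerBr !mulmxA opprD addrACA.
Qed.

End FormalConjugation.

Definition commutator (R : comNzRingType) (N : nat) (x Z : 'M[R]_N) : 'M[R]_N :=
  Z *m x - x *m Z.

(** * The orbit of an element x with [p, x] = u *)

Section Orbits.

Variables (n : nat) (col : 'I_(n + n) -> int).
Hypothesis col_rev : forall p, col (rev_ord p) = - col p.
Variable k : closedFieldType.
Implicit Types x y g h Z W : 'M[k]_(n + n).
Hypothesis char_k : (2%:R : k) != 0.

Local Notation nil_lie := (nil_lie col).
Local Notation para_lie := (para_lie col).
Local Notation para_group := (para_group col).
Local Notation ad_onto := (ad_onto col).

Section Transport.

Variables (x y : 'M[{poly k}]_(n + n)).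

(** With the mask inside the map, any solution of the linear system yields one that does not raise
    columns. *)
Definition transport (H : 'M[{poly k}]_(n + n)) : 'M[{poly k}]_(n + n) :=
  x *m gmask col 0 H - gmask col 0 H *m y.

Lemma transport_is_linear : linear transport.
Proof.
move=> a A B; rewrite /transport linearP mulmxDl mulmxDr -scalemxAl -scalemxAr.
by rewrite scalerBr opprD addrACA.
Qed.

HB.instance Definition _ :=
  GRing.isLinear.Build _ _ _ _ transport transport_is_linear.

End Transport.

(** Isometry is given up here: without it the equation is linear in h, and [kernel_lift] replaces an
    approximate solution of high order by an exact one with the same value at 0. *)
Lemma lift_exact x y : nil_lie x -> nil_lie y -> ad_onto x ->
  exists h : 'M[{poly k}]_(n + n),
    [/\ lowers col 0 h, mx_at 0 h = 1%:M & cmx x *m h = h *m line x y].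
Proof.
move=> nx ny ontox.
have [N lift] := kernel_lift (lin_mx (transport (cmx x) (line x y))).
have [h [lh h0 _ [W hW]]] := lift_mod col_rev char_k N nx ny ontox.
have [|w w0 wE] := lift (mxvec h) (mxvec ('X *: W)).
  rewrite mul_vec_lin /= -linearZ /=; congr (mxvec _).
  by rewrite /transport gmask_id // hW scalerA -exprSr.
exists (gmask col 0 (vec_mx w)); split; first exact: gmaskP.
  have -> : mx_at 0 (gmask col 0 (vec_mx w)) = gmask col 0 (mx_at 0 (vec_mx w)).
    by apply/matrixP => i j; rewrite !mxE; case: ifP => //; rewrite /horner_eval horner0.
  have -> : mx_at 0 (vec_mx w) = 1%:M.
    by rewrite /mx_at map_vec_mx -/(mx_at 0 w) wE -map_vec_mx mxvecK -/(mx_at 0 h) h0.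
  by rewrite gmask_id //; apply: lowers1.
have : transport (cmx x) (line x y) (vec_mx w) = 0.
  by apply: (can_inj mxvecK); rewrite -mul_vec_lin vec_mxK w0 linear0.
by move/eqP; rewrite subr_eq0 => /eqP.
Qed.

(* The polar decomposition [h = s^-1 (s h)] in which [s] is a polynomial in
   [h h^*] turns conjugacy under the parabolic of GL into conjugacy under the
   parabolic of Sp. *)
Lemma polar_conj x y h : sp_lie x -> sp_lie y -> lowers col 0 h ->
  h \in unitmx -> x *m h = h *m y -> exists2 g, para_group g & x *m g = g *m y.
Proof.
move=> sx sy lh uh xh; pose Q := h *m sadj h.
have uadj : sadj h \in unitmx.
  have : sadj (h *m invmx h) = 1%:M by rewrite mulmxV // sadj1.
  by rewrite sadjM => /mulmx1_unit[].
have uQ : Q \in unitmx by rewrite unitmx_mul uh.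
have lQ : lowers col 0 Q by apply: lowers_mul0 => //; apply: lowers_sadj.
have aQ : sadj Q = Q by rewrite sadjM sadjK.
have xQ : x *m Q = Q *m x.
  rewrite mulmxA xh -!mulmxA; congr (_ *m _).
  have := congr1 (@sadj n k) xh; rewrite !sadjM sx sy mulmxN mulNmx.
  by move/oppr_inj => ->.
have [s ssQ sP] := inv_sqrt_mx char_k uQ.
have [ls as_ sx_ sQ] : [/\ lowers col 0 s, sadj s = s, s *m x = x *m s & s *m Q = Q *m s].
  apply: (sP (fun A => [/\ lowers col 0 A, sadj A = A, A *m x = x *m A & A *m Q = Q *m A])).
    by split; rewrite ?mulmx0 ?mul0mx ?linear0 //; apply: lowers0.
  move=> c A [lA aA Ax AQ]; split.
  - by apply: lowersD; [apply: lowers_mul0 | rewrite -scalemx1; apply/lowersZ/lowers1].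
  - by rewrite linearD /= sadjM aA aQ AQ -[c%:M]scalemx1 linearZ /= sadj1.
  - rewrite mulmxDl mulmxDr mul_scalar_mx mul_mx_scalar; congr (_ + _).
    by rewrite -mulmxA -xQ !mulmxA Ax.
  - rewrite mulmxDl mulmxDr mul_scalar_mx mul_mx_scalar; congr (_ + _).
    by rewrite {1}AQ mulmxA.
exists (s *m h); last by rewrite mulmxA -sx_ -!mulmxA xh.
split; last exact: lowers_mul0.
by rewrite sadjM as_ mulmxA -(mulmxA s) -/Q -(mulmxA s) -sQ mulmxA.
Qed.

(** The exceptional parameters are the zeros of [\det h], a polynomial with value 1 at 0. *)
Lemma conj_generic x y : nil_lie x -> nil_lie y -> ad_onto x ->
  exists2 p : {poly k}, p != 0 & forall t, p.[t] != 0 ->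
    exists2 g, para_group g & x *m g = g *m (x + t *: (y - x)).
Proof.
move=> nx ny ontox; have [h [lh h0 xh]] := lift_exact nx ny ontox.
have detE t : (\det h).[t] = \det (mx_at t h) by rewrite /mx_at det_map_mx.
exists (\det h).
  apply: contraTneq isT => d0; have := detE 0; rewrite d0 h0 det1 horner0.
  by move/esym/eqP; rewrite oner_eq0.
move=> t; rewrite detE -unitfE => uh.
have nz := nil_lie_line t nx ny.
apply: (@polar_conj _ _ (mx_at t h)); [exact: nx.1 | exact: nz.1 | | by [] |].
  exact: lowers_map.
by rewrite -line_at -mx_atM -xh mx_atM mx_at_cmx.
Qed.

Lemma para_group_sadj g : para_group g -> para_group (sadj g).
Proof.
by move=> [gg lg]; split; [rewrite sadjK; apply: mulmx1C | apply: lowers_sadj].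
Qed.

Lemma para_groupM g h : para_group g -> para_group h -> para_group (g *m h).
Proof.
move=> [gg lg] [hh lh]; split; last exact: lowers_mul0.
by rewrite sadjM mulmxA -(mulmxA g) hh mulmx1.
Qed.

Lemma ad_onto_conj x y g : para_group g -> x *m g = g *m y -> ad_onto x -> ad_onto y.
Proof.
move=> pg xg ontox W [sW lW]; have [gg lg] := pg; have g'g := mulmx1C gg.
have la := (para_group_sadj pg).2.
have yE : y = sadj g *m x *m g by rewrite -mulmxA xg mulmxA g'g mul1mx.
have nW : nil_lie (g *m W *m sadj g).
  split; first by have := sp_lie_conj (sadj g) sW; rewrite sadjK.
  by apply: (@lowersM _ _ _ 1 0) => //; apply: (@lowersM _ _ _ 0 1).
have [Z [sZ lZ] ZE] := ontox _ nW.
exists (sadj g *m Z *m g).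
  by split; [apply: sp_lie_conj | do 2?apply: lowers_mul0].
have /(congr1 (fun A => sadj g *m A *m g)) /= := ZE.
rewrite !mulmxA g'g mul1mx -(mulmxA W) g'g mulmx1 => <-.
rewrite yE mulmxBr mulmxBl !mulmxA; congr (_ - _).
  by rewrite -(mulmxA _ g (sadj g)) gg mulmx1.
by rewrite -(mulmxA _ g (sadj g)) gg mulmx1.
Qed.

(** Almost all points of the line through x and y are conjugate to x, and almost all are conjugate
    to y; so some point is conjugate to both. *)
Lemma single_orbit x y : nil_lie x -> nil_lie y -> ad_onto x -> ad_onto y ->
  exists2 g, para_group g & x *m g = g *m y.
Proof.
move=> nx ny ox oy.
have [p p0 pP] := conj_generic nx ny ox; have [q q0 qP] := conj_generic ny nx oy.
(* Seen from y the line is run through backwards, with parameter 1 - t. *)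
have q'0 : q \Po (1 - 'X) != 0.
  have [t qt] := poly_nonroot q0; apply: contraNneq qt => q'0.
  by have := congr1 (horner_eval (1 - t)) q'0; rewrite /horner_eval horner_comp !hornerE subKr => ->.
have [t] := poly_nonroot (mulf_neq0 p0 q'0); rewrite hornerM mulf_eq0 negb_or.
rewrite horner_comp !hornerE => /andP[/pP[g pg xg] /qP[h ph yh]].
exists (g *m sadj h); first exact/para_groupM/para_group_sadj.
have zE : y + (1 - t) *: (x - y) = x + t *: (y - x).
  by apply/matrixP => i j; rewrite !mxE; ring.
rewrite zE in yh; have [hh _] := ph.
have -> : y = h *m (x + t *: (y - x)) *m sadj h by rewrite -yh -mulmxA hh mulmx1.
by rewrite [LHS]mulmxA xg -!mulmxA (mulmxA (sadj h)) (mulmx1C hh) mul1mx.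
Qed.

(** Masking half of [W - sadj W] projects all matrices linearly onto u, or onto p for [para_proj];
    so u and [p, y] become row spaces of matrices. *)
Definition nil_proj W : 'M[k]_(n + n) := gmask col 1 (2%:R^-1 *: (W - sadj W)).
Definition para_proj W : 'M[k]_(n + n) := gmask col 0 (2%:R^-1 *: (W - sadj W)).

Lemma skew_proj_is_linear e : linear (fun W => gmask col e (2%:R^-1 *: (W - sadj W))).
Proof.
move=> a A B; rewrite -linearP; congr (gmask _ _ _).
by rewrite linearP /=; apply/matrixP => i j; rewrite !mxE; ring.
Qed.

HB.instance Definition _ :=
  GRing.isLinear.Build _ _ _ _ nil_proj (skew_proj_is_linear 1).
HB.instance Definition _ :=
  GRing.isLinear.Build _ _ _ _ para_proj (skew_proj_is_linear 0).

Lemma sp_lie_proj e W : sp_lie (gmask col e (2%:R^-1 *: (W - sadj W))).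
Proof.
rewrite /sp_lie -gmask_sadj // linearZ /= linearB /= sadjK -linearN -scalerN.
by rewrite opprB.
Qed.

Lemma proj_id e W : sp_lie W -> lowers col e W ->
  gmask col e (2%:R^-1 *: (W - sadj W)) = W.
Proof.
move=> -> lW; rewrite opprK gmask_id; last exact/lowersZ/lowersD.
by rewrite -mulr2n -scaler_nat scalerA mulVf // scale1r.
Qed.

Lemma commutator_is_linear (R : comNzRingType) (N : nat) (y : 'M[R]_N) :
  linear (commutator y).
Proof.
move=> a A B; rewrite /commutator mulmxDl mulmxDr -scalemxAl -scalemxAr.
by rewrite scalerBr opprD addrACA.
Qed.

HB.instance Definition _ (R : comNzRingType) (N : nat) (y : 'M[R]_N) :=
  GRing.isLinear.Build _ _ _ _ (commutator y) (@commutator_is_linear R N y).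

Definition ad_mx y := lin_mx para_proj *m lin_mx (commutator y).
Let rk := \rank (lin_mx nil_proj).

(** As [p, y] lies in u for every y in u, equality amounts to an inequality of ranks, hence to the
    nonvanishing of a minor. *)
Lemma ad_ontoP y : nil_lie y -> (ad_onto y <-> (rk <= \rank (ad_mx y))%N).
Proof.
move=> [sy ly].
have sub : (ad_mx y <= lin_mx nil_proj)%MS.
  apply/row_subP => i; apply/submxP; exists (row i (ad_mx y)).
  rewrite rowE /ad_mx mulmxA -[delta_mx 0 i]vec_mxK !mul_vec_lin /=.
  set Z := para_proj _; have lZ : lowers col 0 Z by apply: gmaskP.
  have sZ : sp_lie Z by apply: sp_lie_proj.
  congr (mxvec _); apply/esym/proj_id.
    rewrite /sp_lie /commutator linearB /= !sadjM sZ sy !(mulmxN, mulNmx) !opprK.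
    by rewrite opprB.
  by apply: lowersB; [apply: (@lowersM _ _ _ 0 1) | apply: (@lowersM _ _ _ 1 0)].
rewrite /rk (geq_leqif (mxrank_leqif_sup sub)); split=> [onto|/submxP[D DE]].
  apply/row_subP => i; rewrite rowE -[delta_mx 0 i]vec_mxK mul_vec_lin /=.
  have [|Z [sZ lZ] <-] := onto (nil_proj (vec_mx (delta_mx 0 i))).
    by split; [apply: sp_lie_proj | apply: gmaskP].
  apply/submxP; exists (mxvec Z); rewrite mulmxA !mul_vec_lin /=.
  by rewrite /para_proj proj_id.
move=> W [sW lW]; exists (para_proj (vec_mx (mxvec W *m D))).
  by split; [apply: sp_lie_proj | apply: gmaskP].
apply: (can_inj mxvecK); rewrite -/(commutator y (para_proj (vec_mx (mxvec W *m D)))).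
rewrite -[LHS]mul_vec_lin -[mxvec (para_proj _)]mul_vec_lin vec_mxK.
by rewrite -!mulmxA -DE mul_vec_lin /= /nil_proj proj_id.
Qed.

(** Letting A and B range over all matrices replaces the choice of rows and columns of a minor. *)
Lemma rank_geP (p q r : nat) (M : 'M[k]_(p, q)) :
  (r <= \rank M)%N <-> exists A B, \det (A *m M *m B : 'M_r) != 0.
Proof.
split=> [rM|[A [B]]]; last first.
  rewrite -unitfE -unitmxE => /mxrank_unit <-.
  exact: leq_trans (mxrankM_maxl _ _) (mxrankM_maxr _ _).
exists (pid_mx r *m invmx (col_ebase M)), (invmx (row_ebase M) *m pid_mx r).
rewrite -{2}(mulmx_ebase M) !mulmxA mulmxKV ?col_ebase_unit //.
rewrite mulmxK ?row_ebase_unit // !mul_pid_mx.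
rewrite (_ : minn _ _ = r) ?pid_mx_1 ?det1 ?oner_eq0 //.
by have := rank_leq_row M; have := rank_leq_col M; lia.
Qed.

Definition generic_mx (N : nat) : 'M[{mpoly k[N * N]}]_N := vec_mx (\row_i 'X_i).

Lemma eval_generic_mx (N : nat) (y : 'M[k]_N) :
  map_mx (meval (fun i => mxvec y 0 i)) (generic_mx N) = y.
Proof.
rewrite map_vec_mx -[RHS]mxvecK; congr (vec_mx _); apply/rowP => i.
by rewrite !mxE mevalXU.
Qed.

(** The equations are the functions y |-> det (A ad_y B) for all A and B. They are polynomial in y
    because the commutator with the generic matrix specializes to the one with y. *)
Lemma zclosed_not_onto : exists2 C : 'M[k]_(n + n) -> Prop, zclosed C &
  forall y, nil_lie y -> (ad_onto y <-> ~ C y).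
Proof.
pose G := generic_mx (n + n).
pose minor (AB : 'M[k]_(rk, (n + n) * (n + n)) * 'M[k]_((n + n) * (n + n), rk)) :
    {mpoly k[(n + n) * (n + n)]} :=
  \det (map_mx (@mpolyC _ k) AB.1 *m (map_mx (@mpolyC _ k) (lin_mx para_proj) *m
     lin_mx (commutator G)) *m map_mx (@mpolyC _ k) AB.2).
have minorE AB y : eval_mx (minor AB) y = \det (AB.1 *m ad_mx y *m AB.2).
  rewrite /eval_mx /minor.
  pose ev : {rmorphism {mpoly k[(n + n) * (n + n)]} -> k} :=
    meval (fun i => mxvec y 0 i).
  rewrite -[LHS]/(ev _).
  have evC (p q : nat) (A : 'M[k]_(p, q)) : map_mx ev (map_mx (@mpolyC _ k) A) = A.
    by apply/matrixP => i j; rewrite !mxE /ev /= mevalC.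
  rewrite -det_map_mx !map_mxM !evC (@map_lin_mx _ _ _ _ _ _ _ _ (commutator y)) //.
  by move=> A; rewrite /commutator map_mxB !map_mxM eval_generic_mx.
exists (fun y => forall f, (exists AB, f = minor AB) -> eval_mx f y = 0).
  by exists (fun f => exists AB, f = minor AB).
move=> y ny; rewrite ad_ontoP //; split=> [/rank_geP[A [B AB]] C | nC].
  by move: AB; rewrite -(minorE (A, B)) C ?eqxx //; exists (A, B).
apply: contraT => /negP rk_big; case: nC => f [[A B] ->]; rewrite minorE.
by apply/eqP; apply: contraT => AB; case: rk_big; apply/rank_geP; exists A, B.
Qed.

End Orbits.

(** * Polynomial functions restricted to a polynomial curve of matrices *)

Section PolyEval.

Variables (k : closedFieldType) (N : nat).
Implicit Types (f : {mpoly k[N * N]}) (A : 'M[{poly k}]_N).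

Definition poly_eval A f : {poly k} := mmap (@polyC k) (fun i => mxvec A 0 i) f.

Lemma poly_evalE A f t : (poly_eval A f).[t] = eval_mx f (mx_at t A).
Proof.
rewrite /poly_eval /eval_mx /meval !/(mmap _ _ _) -[LHS]/(horner_eval t _) rmorph_sum /=.
apply: eq_bigr => m _; rewrite rmorphM /= /horner_eval hornerC; congr (_ * _).
rewrite -[LHS]/(horner_eval t _) /mmap1 rmorph_prod /=; apply: eq_bigr => i _.
by rewrite rmorphXn /mx_at -map_mxvec mxE.
Qed.

(** The chain rule: it holds for constants and variables and is stable under sums and products. *)
Lemma poly_eval_deriv A f t :
  (poly_eval A f)^`().[t] =
  \sum_i eval_mx f^`M(i) (mx_at t A) * (mxvec A 0 i)^`().[t].
Proof.
pose chain f := (poly_eval A f)^`().[t] =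
  \sum_i eval_mx f^`M(i) (mx_at t A) * (mxvec A 0 i)^`().[t].
have chainC c : chain c%:MP.
  rewrite /chain /poly_eval mmapC derivC horner0 big1 // => i _.
  by rewrite mderivC /eval_mx raddf0 mul0r.
have chainM g h : chain g -> chain h -> chain (g * h).
  rewrite /chain => cg ch.
  rewrite /poly_eval rmorphM /= derivM hornerD !hornerM -!/(poly_eval _ _) cg ch.
  rewrite !poly_evalE mulr_suml mulr_sumr -big_split /=; apply: eq_bigr => i _.
  by rewrite mderivM /eval_mx mevalD !mevalM; ring.
have chainD g h : chain g -> chain h -> chain (g + h).
  rewrite /chain => cg ch.
  rewrite /poly_eval raddfD /= derivD hornerD -!/(poly_eval _ _) cg ch.
  rewrite -big_split /=; apply: eq_bigr => i _.
  by rewrite mderivD /eval_mx mevalD mulrDl.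
have chainX j : chain 'X_j.
  rewrite /chain /poly_eval mmapX mmap1U (bigD1 j) //= big1 => [|i ij].
    by rewrite mderivX mnm1E eqxx -[X in (X - _)%MM]add0m addmK mpolyX0 scale1r /eval_mx meval1 mul1r addr0.
  by rewrite mderivX mnm1E eq_sym (negPf ij) scale0r /eval_mx raddf0 mul0r.
elim/mpolyind: f => [|c m f _ _ cf]; first by rewrite -[0]/(0%:MP) ; apply: chainC.
apply: chainD => //; rewrite -mul_mpolyC; apply: (chainM _ _ (chainC c)).
rewrite mpolyXE_id; apply: (big_ind chain) => [|g h|i _].
- exact: (chainC 1).
- exact: (chainM g h).
- by elim: (m i) => [|j IHj]; [exact: (chainC 1) | rewrite exprS; apply: (chainM _ _ (chainX i))].
Qed.

End PolyEval.

(** * Openness and density of the orbit *)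

Section OpenDense.

Variables (n : nat) (col : 'I_(n + n) -> int).
Hypothesis col_rev : forall p, col (rev_ord p) = - col p.
Variable k : closedFieldType.
Hypothesis char_k : (2%:R : k) != 0.

Lemma orbitP (x y : 'M[k]_(n + n)) : nil_lie col x -> ad_onto col x ->
  (exists2 g, para_group col g & y = invmx g *m x *m g) <->
  nil_lie col y /\ ad_onto col y.
Proof.
move=> nx ox; split=> [[g pg yE]|[ny oy]].
  have [gg lg] := pg; have [ug ua] := mulmx1_unit gg.
  have gE : invmx g = sadj g by rewrite -[LHS]mulmx1 -gg mulKmx.
  rewrite gE in yE; split.
    rewrite yE; split; first exact: (sp_lie_conj _ nx.1).
    have la := lowers_sadj col_rev lg.
    by apply: (@lowersM _ _ _ 1 0) => //; apply: (@lowersM _ _ _ 0 1) => //; exact: nx.2.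
  by apply: (ad_onto_conj col_rev pg _ ox); rewrite yE !mulmxA gg mul1mx.
have [g pg xg] := single_orbit col_rev char_k nx ny ox oy.
have [ug _] := mulmx1_unit pg.1.
by exists g => //; rewrite -mulmxA xg mulKmx.
Qed.

Theorem orbit_open_dense (x : 'M[k]_(n + n)) : nil_lie col x -> ad_onto col x ->
  let orbit y := exists2 g, para_group col g & y = invmx g *m x *m g in
  zopen_in (nil_lie col (R := k)) orbit /\ zdense_in (nil_lie col (R := k)) orbit.
Proof.
move=> nx ox orbit; split.
  have [C zC CP] := zclosed_not_onto col_rev char_k.
  exists C => // y; split=> [/(orbitP _ nx ox)[ny /(CP y ny)] //|[ny /(CP y ny) oy]].
  exact/(orbitP _ nx ox).
split=> [y /(orbitP _ nx ox)[] //|C [S CS] sub z nz].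
apply/CS => f Sf; have [p p0 pP] := conj_generic col_rev char_k nx nz ox.
(* The factor p absorbs the finitely many parameters without a conjugating element; it can be
   cancelled in k[t]. *)
have : poly_eval (line x z) f * p = 0.
  apply: poly_eq0_horner => t; rewrite hornerM poly_evalE line_at.
  have [->|/pP[g pg xg]] := eqVneq p.[t] 0; first by rewrite mulr0.
  have [ug _] := mulmx1_unit pg.1.
  have /CS -> // : C (x + t *: (z - x)); last by rewrite mul0r.
  by apply: sub; exists g => //; rewrite -mulmxA xg mulKmx.
move/eqP; rewrite mulf_eq0 (negPf p0) orbF => /eqP f0.
have := poly_evalE (line x z) f 1.
by rewrite f0 horner0 line_at scale1r addrC subrK => <-.
Qed.

End OpenDense.

(** * Duality for the trace form *)

Section Duality.

Variables (n : nat) (col : 'I_(n + n) -> int).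
Hypothesis col_rev : forall p, col (rev_ord p) = - col p.
Variable k : closedFieldType.
Implicit Types x y g h Z W z : 'M[k]_(n + n).
Hypothesis char_k : (2%:R : k) != 0.

Lemma mxtrace_sadj z : \tr (sadj z) = \tr z.
Proof.
rewrite /mxtrace (reindex_inj rev_ord_inj) /=; apply: eq_bigr => i _.
by rewrite mxE rev_ordK lsign_sqr mul1r.
Qed.

Lemma mxtrace_skew W z : sp_lie W -> \tr (W *m (z - sadj z)) = \tr (W *m z) + \tr (W *m z).
Proof.
move=> sW; rewrite mulmxBr linearB /=; congr (_ + _).
by rewrite -mxtrace_sadj sadjM sadjK sW mulmxN linearN opprK mxtrace_mulC.
Qed.

Lemma skew_part_sp z : sp_lie (z - sadj z).
Proof. by rewrite /sp_lie linearB /= sadjK opprB. Qed.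

(** For col p <= col q the matrix E - E^* with E = E_{q,p} belongs to the parabolic Lie algebra, and
    its trace against y is twice [y p q]. *)
Lemma para_annihilator y : sp_lie y ->
  (forall Z, para_lie col Z -> \tr (Z *m y) = 0) -> lowers col 1 y.
Proof.
move=> sy trZ p q pq; apply: (two_eq0 char_k).
pose E : 'M[k]_(n + n) := delta_mx q p.
have lE : lowers col 0 E.
  move=> i j ij; rewrite mxE; case: eqP => //= iq; case: eqP => //= jp.
  by move: ij; rewrite iq jp; lia.
have := trZ (E - sadj E); rewrite mxtrace_mulC mxtrace_skew //.
have -> : \tr (y *m E) = y p q.
  rewrite /mxtrace (bigD1 p) //= big1 ?addr0 => [|i ip].
    rewrite mxE (bigD1 q) //= big1 ?addr0 => [|j jq]; first by rewrite mxE !eqxx mulr1.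
    by rewrite mxE (negPf jq) mulr0.
  by rewrite mxE big1 // => j _; rewrite mxE (negPf ip) andbF mulr0.
by apply; split; [exact: skew_part_sp | apply/lowersB/lowers_sadj].
Qed.

Lemma lowers1_mxtrace y : lowers col 1 y -> \tr y = 0.
Proof. by move=> ly; rewrite /mxtrace big1 // => i _; apply: ly; lia. Qed.

Lemma commutator_trace x Z z : \tr ((Z *m x - x *m Z) *m z) = \tr (Z *m (x *m z - z *m x)).
Proof.
rewrite mulmxBl mulmxBr !linearB /= !mulmxA; congr (_ - _).
by rewrite -[in LHS]mulmxA [LHS]mxtrace_mulC.
Qed.

(** A functional that kills [p, x] comes from a column of the cokernel and has the form W |-> tr (W
    c). By invariance of the trace, z = c - c^* has [z, x] orthogonal to p, so in u. The hypothesis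
    then puts z in p, and tr (W z) = 0 for W in u because W z lowers every column. *)
Lemma ad_onto_dual x : nil_lie col x ->
  (forall z, sp_lie z -> lowers col 1 (z *m x - x *m z) -> lowers col 0 z) ->
  ad_onto col x.
Proof.
move=> nx star; have [sx lx] := nx.
apply/(ad_ontoP col_rev char_k nx)/mxrankS; rewrite submxE.
set K := cokermx _; have AK : ad_mx col x *m K = 0 by apply: mulmx_coker.
apply/eqP/matrixP => i j; rewrite [RHS]mxE.
pose c := (vec_mx (matrix.col j K)^T)^T.
have trE W : (mxvec W *m K) 0 j = \tr (W *m c).
  transitivity (\sum_a \sum_b W a b * c b a).
    rewrite mxE (reindex _ (curry_mxvec_bij _ _)) /= pair_bigA.
    by apply: eq_bigr => [[a b]] /= _; rewrite mxvecE !mxE.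
  by rewrite /mxtrace; apply: eq_bigr => a _; rewrite mxE.
have annZ Z : para_lie col Z -> \tr ((Z *m x - x *m Z) *m c) = 0.
  move=> [sZ lZ]; rewrite -trE -/(commutator x Z).
  have -> : mxvec (commutator x Z) = mxvec Z *m ad_mx col x.
    by rewrite /ad_mx mulmxA !mul_vec_lin /= /para_proj proj_id.
  by rewrite -mulmxA AK mulmx0 mxE.
have sz := skew_part_sp c; set z := c - _ in sz.
have skC Z : sp_lie Z -> sp_lie (Z *m x - x *m Z).
  move=> sZ; rewrite /sp_lie linearB /= !sadjM sZ sx !(mulmxN, mulNmx) !opprK.
  by rewrite opprB.
have lz : lowers col 0 z.
  apply: star => //; apply: para_annihilator; first exact: skC.
  move=> Z pZ; rewrite -opprB mulmxN linearN /= -commutator_trace mxtrace_skew.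
    by rewrite annZ // addr0 oppr0.
  exact: skC pZ.1.
have -> : (lin_mx (@nil_proj n col k) *m K) i j =
    (mxvec (nil_proj col (vec_mx (delta_mx 0 i))) *m K) 0 j.
  by rewrite -mul_vec_lin vec_mxK -mulmxA -rowE [RHS]mxE.
set W := nil_proj _ _; have sW : sp_lie W by apply: sp_lie_proj.
rewrite trE; apply: (two_eq0 char_k); rewrite -mxtrace_skew //; apply: lowers1_mxtrace.
by apply: (@lowersM _ _ _ 1 0) lz; apply: gmaskP.
Qed.

End Duality.

(** * The unipotent radical *)

Section Radical.

Variables (n : nat) (col : 'I_(n + n) -> int).
Hypothesis col_rev : forall p, col (rev_ord p) = - col p.
Variable k : closedFieldType.
Implicit Types x y g h Z W z : 'M[k]_(n + n).
Hypothesis char_k : (2%:R : k) != 0.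

Local Notation para_group := (@para_group n col k).

Definition nil_group g : Prop := para_group g /\ lowers col 1 (g - 1%:M).

Lemma para_group_inv g : para_group g -> invmx g = sadj g.
Proof. by move=> [gg _]; have [ug _] := mulmx1_unit gg; rewrite -[LHS]mulmx1 -gg mulKmx. Qed.

Lemma para_group1 : para_group 1%:M.
Proof. by split; [rewrite sadj1 mulmx1 | exact: lowers1]. Qed.

Lemma nil_group_normal g h : para_group g -> nil_group h -> nil_group (invmx g *m h *m g).
Proof.
move=> pg [ph lh]; rewrite para_group_inv //.
have [sg lg] := pg; have pa := para_group_sadj col_rev pg.
split; first by do 2?apply: para_groupM.
have -> : sadj g *m h *m g - 1%:M = sadj g *m (h - 1%:M) *m g.
  by rewrite mulmxBr mulmxBl mulmx1 (mulmx1C sg).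
by apply: (@lowersM _ _ _ 1 0) => //; apply: (@lowersM _ _ _ 0 1) => //; exact: pa.2.
Qed.

Lemma nil_group_mxgroup : is_mxgroup nil_group.
Proof.
split=> [g [[gg _] _]||g h [pg lg] [ph lh]|g [pg lg]].
- by have [] := mulmx1_unit gg.
- by split; [exact: para_group1 | rewrite subrr; exact: lowers0].
- split; first exact: para_groupM.
  have -> : g *m h - 1%:M = g *m (h - 1%:M) + (g - 1%:M).
    by rewrite mulmxBr mulmx1 addrA subrK.
  by apply: lowersD => //; apply: (@lowersM _ _ _ 0 1) => //; exact: pg.2.
- rewrite para_group_inv //; split; first exact: para_group_sadj.
  by rewrite -[1%:M]sadj1 -linearB /=; apply: lowers_sadj.
Qed.

Lemma lowers_exp m (A : 'M[k]_(n + n)) : lowers col 1 A -> lowers col m%:Z (A ^+ m).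
Proof.
move=> lA; elim: m => [|m IHm]; first exact: lowers1.
by rewrite exprS -addn1 addnC; apply: (@lowersM _ _ _ 1 m%:Z).
Qed.

Lemma lowers_nilpotent (A : 'M[k]_(n + n)) : lowers col 1 A -> exists m, A ^+ m = 0.
Proof.
move=> lA; pose b := \max_p absz (col p); exists (b + b).+1.
apply/matrixP => p q; rewrite [RHS]mxE (@lowers_exp _ _ lA p q) //.
have := @leq_bigmax _ (fun p => absz (col p)) p.
by have := @leq_bigmax _ (fun p => absz (col p)) q; rewrite -/b /=; lia.
Qed.

(* The cocharacter acting on the coordinate p by [t ^ col p] contracts U to 1 as
   t tends to 0. *)
Definition contract (t : k) (A : 'M[k]_(n + n)) : 'M[k]_(n + n) :=
  \matrix_(p, q) (A p q * t ^+ absz (col p - col q)).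

Lemma contractM t A B : lowers col 0 A -> lowers col 0 B ->
  contract t (A *m B) = contract t A *m contract t B.
Proof.
move=> lA lB; apply/matrixP => p q; rewrite !mxE mulr_suml; apply: eq_bigr => r _.
rewrite !mxE.
have [/lA->|rp] := ltP (col p) (col r + 0); first by rewrite !mul0r.
have [/lB->|qr] := ltP (col r) (col q + 0); first by rewrite !(mul0r, mulr0).
have -> : absz (col p - col q) = (absz (col p - col r) + absz (col r - col q))%N by lia.
by rewrite exprD mulrACA mulrA.
Qed.

Lemma contract_sadj t A : contract t (sadj A) = sadj (contract t A).
Proof.
apply/matrixP => p q; rewrite !mxE !col_rev mulrA.
by have -> : absz (- col q - - col p) = absz (col p - col q) by lia.
Qed.

Lemma contract1 t : contract t 1%:M = 1%:M.
Proof.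
apply/matrixP => p q; rewrite !mxE; case: eqP => [->|_]; last by rewrite mul0r.
by rewrite subrr expr0 mulr1.
Qed.

Lemma nil_group_contract t g : nil_group g -> nil_group (contract t g).
Proof.
move=> [[gg lg] l1]; split; last first.
  move=> p q pq; have := l1 p q pq; rewrite !mxE => /eqP; rewrite subr_eq0 => /eqP ->.
  by case: eqP => [->|_]; rewrite ?subrr ?expr0 ?mulr1 ?subrr // mul0r subr0.
split; last by move=> p q pq; rewrite mxE lg ?mul0r.
by rewrite -contract_sadj -contractM ?gg ?contract1 //; apply: lowers_sadj.
Qed.

Lemma contract_0 g : nil_group g -> contract 0 g = 1%:M.
Proof.
move=> [[gg lg] l1]; apply/matrixP => p q; rewrite !mxE expr0n absz_eq0 subr_eq0.
have [pq|pq] := ltP (col p) (col q + 1).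
  have := l1 p q pq; rewrite !mxE => /eqP; rewrite subr_eq0 => /eqP ->.
  by case: eqP => [->|_]; rewrite ?eqxx ?mulr1 // mul0r.
rewrite (_ : (col p == col q) = false) ?mulr0; last by lia.
by case: eqP pq => // ->; lia.
Qed.

Lemma contract_1 g : contract 1 g = g.
Proof. by apply/matrixP => p q; rewrite mxE expr1n mulr1. Qed.

(** On the curve t |-> [contract t g] from 1 to g, polynomial equations become equations in the
    domain k[t]; so two disjoint closed sets that cover the group cannot both contain points of this
    curve. *)
Lemma zconnected_nil_group : zconnected nil_group.
Proof.
suff half (C D : 'M[k]_(n + n) -> Prop) : zclosed C -> zclosed D ->
    (forall x, nil_group x -> C x \/ D x) ->
    (forall x, nil_group x -> ~ (C x /\ D x)) -> C 1%:M -> forall x, nil_group x -> C x.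
  move=> C D zC zD CD nCD.
  have n1 : nil_group 1%:M by have [] := nil_group_mxgroup.
  have [C1|D1] := CD _ n1; [left; exact: half zC zD _ _ C1|right].
  by apply: half zD zC _ _ D1 => x nx; [have [] := CD x nx; tauto | have := nCD x nx; tauto].
move=> [S CS] [T DT] CD nCD C1 g ng; apply/CS => f Sf.
pose A : 'M[{poly k}]_(n + n) := \matrix_(p, q) ((g p q)%:P * 'X^(absz (col p - col q))).
have At t : mx_at t A = contract t g.
  by apply/matrixP => p q; rewrite !mxE /horner_eval !hornerE.
suff F0 : poly_eval A f = 0.
  by have := poly_evalE A f 1; rewrite F0 horner0 At contract_1 => <-.
apply/eqP; apply: contraT => F0; case: (nCD (contract 0 g)).
  exact: nil_group_contract.
rewrite {1}contract_0 //; split=> //; apply/DT => h Th.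
have : poly_eval A h * poly_eval A f = 0.
  apply: poly_eq0_horner => t; rewrite hornerM !poly_evalE At.
  have [/CS/(_ f Sf) ->|/DT/(_ h Th) ->] := CD _ (nil_group_contract t ng).
    by rewrite mulr0.
  by rewrite mul0r.
move/eqP; rewrite mulf_eq0 (negPf F0) orbF => /eqP h0.
by have := poly_evalE A h 0; rewrite h0 horner0 At => <-.
Qed.

Lemma zclosed_lowers_sub1 :
  zclosed (fun g : 'M[k]_(n + n) => lowers col 1 (g - 1%:M)).
Proof.
exists (fun f => exists2 pq, col pq.1 < col pq.2 + 1 &
   f = 'X_(mxvec_index pq.1 pq.2) - ((pq.1 == pq.2)%:R)%:MP).
move=> g; split=> [lg f [[p q] /= pq ->]|gS p q pq].
  rewrite /eval_mx mevalB mevalXU mevalC mxvecE.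
  by have := lg p q pq; rewrite !mxE.
have := gS _ (ex_intro2 _ _ (p, q) pq erefl).
by rewrite /eval_mx mevalB mevalXU mevalC mxvecE !mxE.
Qed.

Lemma nil_group_radical g : nil_group g -> unipotent_radical para_group g.
Proof.
exists nil_group => //; split.
- exact: nil_group_mxgroup.
- by exists (fun g => lowers col 1 (g - 1%:M)); [exact: zclosed_lowers_sub1 |].
- exact: zconnected_nil_group.
- by split=> [h []|]; [ | exact: nil_group_normal].
- by move=> h [_ /lowers_nilpotent].
Qed.

End Radical.

(** * The tangent space of the unipotent radical *)

Section LieAlgebra.

Variables (n : nat) (col : 'I_(n + n) -> int).
Hypothesis col_rev : forall p, col (rev_ord p) = - col p.
Variable k : closedFieldType.
Implicit Types x y g h Z W z X : 'M[k]_(n + n).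
Hypothesis char_k : (2%:R : k) != 0.

Local Notation para_group := (@para_group n col k).
Local Notation nil_group := (@nil_group n col k).

(** For p <> q this is a scalar multiple of a root vector of sp(V). *)
Definition root_elt (p q : 'I_(n + n)) : 'M[k]_(n + n) :=
  delta_mx p q - sadj (delta_mx p q).

Lemma sadj_delta p q : sadj (delta_mx p q : 'M[k]_(n + n)) =
  (lsign k p * lsign k q) *: delta_mx (rev_ord q) (rev_ord p).
Proof.
apply/matrixP => i j; rewrite !mxE !rev_ord_eq.
case: (i =P rev_ord q) => [->|_]; last by rewrite andbF !mulr0.
case: (j =P rev_ord p) => [->|_]; last by rewrite !mulr0.
by rewrite !lsign_rev mulrNN [lsign k q * _]mulrC.
Qed.

Lemma root_elt_sqr p q : p != q -> root_elt p q *m root_elt p q = 0.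
Proof.
move=> pq; have rn (i : 'I_(n + n)) : i != rev_ord i by rewrite eq_sym rev_ord_neq.
rewrite /root_elt sadj_delta mulmxBl !mulmxBr -!scalemxAl -!scalemxAr.
rewrite !mul_delta_mx_0 ?scaler0 ?subr0 ?sub0r ?oppr0 ?(inj_eq rev_ord_inj) //.
- by rewrite eq_sym.
- by rewrite eq_sym.
Qed.

Lemma root_elt_sp p q : sp_lie (root_elt p q).
Proof. exact: skew_part_sp. Qed.

Lemma root_elt_lowers e p q : col q + e <= col p -> lowers col e (root_elt p q).
Proof.
have ld : col q + e <= col p -> lowers col e (delta_mx p q : 'M[k]_(n + n)).
  move=> pq i j ij; rewrite mxE; case: eqP => //= ip; case: eqP => //= jq.
  by move: ij; rewrite ip jq; lia.
by move=> pq; apply: lowersB; [apply: ld | apply/lowers_sadj/ld].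
Qed.

(** As F squares to 0, 1 + F is its exponential, in every characteristic. *)
Lemma para_group_1D F : sp_lie F -> lowers col 0 F -> F *m F = 0 ->
  para_group (1%:M + F).
Proof.
move=> sF lF FF; split; last by apply: lowersD => //; apply: lowers1.
rewrite linearD /= sadj1 sF mulmxDl !mul1mx mulmxBr mulmx1 FF subr0.
by rewrite subrK.
Qed.

Lemma nil_group_1D F : nil_lie col F -> F *m F = 0 -> nil_group (1%:M + F).
Proof.
move=> [sF lF] FF; split; last by rewrite addrC addKr.
by apply: para_group_1D => //; apply: lowersW lF.
Qed.

Definition differential1 (f : {mpoly k[(n + n) * (n + n)]}) X : k :=
  \sum_i eval_mx f^`M(i) 1%:M * mxvec X 0 i.

Lemma differential1_is_linear f : linear (differential1 f : 'M[k]_(n + n) -> k^o).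
Proof.
move=> a X Y; rewrite /differential1 scaler_sumr -big_split /=; apply: eq_bigr => i _.
by rewrite linearP !mxE mulrDr mulrCA.
Qed.

HB.instance Definition _ f :=
  GRing.isLinear.Build k 'M[k]_(n + n) k^o _ (differential1 f)
    (differential1_is_linear f).

Definition line1 X : 'M[{poly k}]_(n + n) := 1%:M + 'X *: cmx X.

Lemma line1_at t X : mx_at t (line1 X) = 1%:M + t *: X.
Proof. by rewrite mx_atD mx_at1 mx_atZ mx_at_cmx hornerX. Qed.

Lemma differential1E f X : differential1 f X = (poly_eval (line1 X) f)^`().[0].
Proof.
rewrite poly_eval_deriv /differential1; apply: eq_bigr => i _.
rewrite line1_at scale0r addr0; congr (_ * _).
have -> : line1 X = map_mx polyC 1%:M + 'X *: map_mx polyC X.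
  by rewrite map_mx1.
rewrite linearD linearZ /= -!map_mxvec !mxE derivD derivC derivM derivX derivC.
by rewrite mul1r mulr0 addr0 add0r hornerC.
Qed.

Lemma nil_lie_tangent X : nil_lie col X ->
  lie_algebra (unipotent_radical para_group) X.
Proof.
move=> [sX lX] f f0; rewrite -/(differential1 f X).
have df p q : col q < col p -> differential1 f (root_elt p q) = 0.
  move=> pq; rewrite differential1E; suff -> : poly_eval (line1 (root_elt p q)) f = 0.
    by rewrite deriv0 horner0.
  apply: poly_eq0_horner => t; rewrite poly_evalE line1_at; apply: f0.
  apply: nil_group_radical => //; apply: nil_group_1D.
    split; first by apply/sp_lieZ/root_elt_sp.
    by apply/lowersZ/root_elt_lowers; lia.
  rewrite -scalemxAl -scalemxAr root_elt_sqr ?scaler0 //.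
  by apply: contraTneq pq => ->; rewrite ltxx.
(* Each entry of X is met twice, directly and as the mirror image given by X = - X^*. *)
have X2 : X + X = \sum_p \sum_q X p q *: root_elt p q.
  rewrite {1}[X in X + _]matrix_sum_delta -{2}[X]opprK -sX.
  rewrite {1}[X in sadj X]matrix_sum_delta linear_sum -sumrB /=.
  apply: eq_bigr => p _; rewrite linear_sum -sumrB; apply: eq_bigr => q _ /=.
  by rewrite linearZ scalerBr.
apply: (two_eq0 char_k); rewrite -linearD X2 linear_sum big1 // => p _.
rewrite linear_sum big1 // => q _; rewrite linearZ /=.
have [pq|pq] := ltP (col q) (col p); first by rewrite df // scaler0.
by rewrite lX ?scale0r //; lia.
Qed.

(** The entries of g g^* - 1, written with the generic matrix, and of g - 1 where col p <= col q are
    polynomials that vanish on the group. Along 1 + t X their linear terms are the entries of X +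
    X^* and of X. *)
Lemma tangent_nil_lie X :
  (forall f, (forall g, nil_group g -> eval_mx f g = 0) -> differential1 f X = 0) ->
  nil_lie col X.
Proof.
move=> dX; split.
  pose G := generic_mx k (n + n).
  apply/eqP; rewrite -addr_eq0; apply/eqP/matrixP => p q.
  have evE (R : comNzRingType) (ev : {rmorphism {mpoly k[(n + n) * (n + n)]} -> R}) :
      ev ((G *m sadj G - 1%:M) p q) =
      (map_mx ev G *m sadj (map_mx ev G) - 1%:M) p q.
    by rewrite -map_sadj -map_mxM -(map_mx1 ev) -map_mxB [RHS]mxE.
  have vanish g : nil_group g -> eval_mx ((G *m sadj G - 1%:M) p q) g = 0.
    move=> [[gg _] _].
    pose ev : {rmorphism {mpoly k[(n + n) * (n + n)]} -> k} := meval (fun i => mxvec g 0 i).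
    rewrite -[LHS]/(ev _) evE -[map_mx _ G]/(map_mx (meval (fun i => mxvec g 0 i)) G).
    by rewrite eval_generic_mx gg subrr mxE.
  have := dX _ vanish; rewrite differential1E.
  have -> : poly_eval (line1 X) ((G *m sadj G - 1%:M) p q) =
      (line1 X *m sadj (line1 X) - 1%:M) p q.
    have evG : map_mx (poly_eval (line1 X)) G = line1 X.
      rewrite map_vec_mx -[RHS]mxvecK; congr (vec_mx _); apply/rowP => i.
      by rewrite !mxE /poly_eval mmapX mmap1U.
    rewrite -[LHS]/((poly_eval (line1 X) : {rmorphism _ -> _}) _) evE.
    by rewrite -[map_mx _ G]/(map_mx (poly_eval (line1 X)) G) evG.
  have -> : line1 X *m sadj (line1 X) - 1%:M =
      'X *: cmx (sadj X + X) + 'X *: ('X *: (cmx X *m sadj (cmx X))).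
    have -> : cmx (sadj X + X) = sadj (cmx X) + cmx X.
      by rewrite -map_sadj; apply: map_mxD.
    rewrite /line1 linearD /= sadj1 linearZ /=.
    rewrite mulmxDl mul1mx mulmxDr mulmx1 -!scalemxAr -!scalemxAl.
    move: (cmx X) (sadj _) (cmx X *m _) => a b c.
    by apply/matrixP => i j; rewrite !mxE; ring.
  move: (cmx X *m _) => D.
  by rewrite !mxE !(derivD, derivM, derivX, derivC) !hornerE /= !addr0.
move=> p q pq; have := dX ('X_(mxvec_index p q) - ((p == q)%:R)%:MP).
rewrite differential1E.
have -> : poly_eval (line1 X) ('X_(mxvec_index p q) - ((p == q)%:R)%:MP) =
    'X * (X p q)%:P.
  rewrite /poly_eval mmapB mmapX mmap1U mmapC mxvecE !mxE.
  by rewrite addrC; case: (p == q); rewrite /= ?polyC1 ?polyC0 addrK.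
rewrite derivM derivX derivC !hornerE => -> // g [_ /(_ p q pq)].
by rewrite !mxE /eval_mx mevalB mevalXU mevalC mxvecE.
Qed.

(** The Levi component on column e, extended by zero so that all blocks have the same size. *)
Definition block (e : int) (A : 'M[k]_(n + n)) : 'M[k]_(n + n) :=
  \matrix_(p, q) (if (col p == e) && (col q == e) then A p q else 0).

Lemma blockM e A B : lowers col 0 A -> lowers col 0 B ->
  block e (A *m B) = block e A *m block e B.
Proof.
move=> lA lB; apply/matrixP => p q; rewrite !mxE.
have [/andP[/eqP pe /eqP qe]|pq] := ifP; last first.
  rewrite big1 // => r _; rewrite !mxE.
  by case: (col p == e) pq; case: (col q == e); rewrite /= ?andbF ?mulr0 ?mul0r.
apply: eq_bigr => r _; rewrite !mxE pe qe eqxx andbT /=.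
have [re|re|re] := ltgtP (col r) e; rewrite /= ?mul0r //.
  by rewrite lB ?mulr0 //; lia.
by rewrite lA ?mul0r //; lia.
Qed.

Lemma block_is_linear e : linear (block e).
Proof.
move=> a A B; apply/matrixP => p q; rewrite !mxE.
by case: ifP => _; rewrite ?mulr0 ?addr0.
Qed.

HB.instance Definition _ e := GRing.isLinear.Build _ _ _ _ (block e) (block_is_linear e).

Lemma blockX e m A : lowers col 0 A -> block e (A ^+ m.+1) = block e A ^+ m.+1.
Proof.
move=> lA; have lX j : lowers col 0 (A ^+ j).
  elim: j => [|j IHj]; first exact: lowers1.
  by rewrite exprS; apply: lowers_mul0.
elim: m => [|m IHm]; first by rewrite !expr1.
by rewrite exprS [RHS]exprS -IHm; apply: blockM.
Qed.

(** * A normal unipotent subgroup has trivial diagonal blocks *)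

Section NormalUnipotent.

Variable H : 'M[k]_(n + n) -> Prop.
Hypotheses (groupH : is_mxgroup H) (normalH : normal_in para_group H)
  (unipH : forall h, H h -> unipotent h).

Let lowers_sub1 h : H h -> lowers col 0 (h - 1%:M).
Proof. by move=> /normalH.1[_ lh]; apply: lowersB (@lowers1 _ _ _). Qed.

Lemma block_nilpotent h e : H h -> exists m, block e (h - 1%:M) ^+ m.+1 = 0.
Proof.
move=> Hh; have [m hm] := unipH Hh; exists m.
by rewrite -blockX ?exprS ?hm ?mulr0 ?linear0 //; apply: lowers_sub1.
Qed.

Lemma block_trace h e : H h -> \tr (block e (h - 1%:M)) = 0.
Proof. by move=> /(block_nilpotent e)[m /mxtrace_nilpotent]. Qed.

(** H contains h, its conjugate by g and their product. Minus 1, each has nilpotent, hence traceless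
    blocks; with h = 1 + N this leaves the trace of N times its conjugate. *)
Lemma block_conj_trace h g e : H h -> para_group g ->
  \tr (block e (h - 1%:M) *m block e (sadj g) *m block e (h - 1%:M) *m block e g) = 0.
Proof.
move=> Hh pg; have pa := para_group_sadj col_rev pg; set N := h - 1%:M.
have lN : lowers col 0 N by apply: lowers_sub1.
have Hg : H (sadj g *m h *m g) by rewrite -(para_group_inv pg); apply: normalH.2.
have NgE : sadj g *m h *m g - 1%:M = sadj g *m N *m g.
  by rewrite mulmxBr mulmxBl mulmx1 (mulmx1C pg.1).
have [_ _ HM _] := groupH.
have := block_trace e (HM _ _ Hh Hg).
have -> : h *m (sadj g *m h *m g) - 1%:M =
    N + sadj g *m N *m g + N *m (sadj g *m N *m g).
  rewrite -NgE /N; move: (sadj g *m h *m g) => hg.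
  rewrite mulmxBl mul1mx mulmxBr mulmx1; move: (h *m hg) => a.
  by apply/matrixP => i j; rewrite !mxE; ring.
have trN : \tr (block e N) = 0 by apply: block_trace.
have trNg : \tr (block e (sadj g *m N *m g)) = 0 by rewrite -NgE; apply: block_trace.
have -> A B : block e (N + A + B) = block e N + block e A + block e B by rewrite !linearD.
rewrite !mxtraceD trN trNg !add0r.
have lg := pg.2; have la := pa.2.
have l1 : lowers col 0 (sadj g *m N) by apply: lowers_mul0.
by rewrite (blockM e lN (lowers_mul0 l1 lg)) (blockM e l1 lg) (blockM e la lN) !mulmxA.
Qed.

(* Conjugating by 1 + F with F^2 = 0 isolates the quadratic term in F. *)
Lemma block_quadratic h F e : H h -> sp_lie F -> lowers col 0 F -> F *m F = 0 ->
  \tr (block e (h - 1%:M) *m block e F *m block e (h - 1%:M) *m block e F) = 0.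
Proof.
move=> Hh sF lF FF; set M := block e _.
have M1 A : block e A *m block e 1%:M = block e A.
  apply/matrixP => p q; rewrite mxE (bigD1 q) //= big1 ?addr0 => [|r rq].
    rewrite !mxE eqxx; case: (col q == e); rewrite ?andbT ?andbF ?mulr0 //=.
    by rewrite mulr1.
  by rewrite !mxE (negPf rq); case: ifP; rewrite ?mulr0 //; case: ifP; rewrite mulr0.
have MM : \tr (M *m M) = 0.
  by have := block_conj_trace e Hh (para_group1 _ _); rewrite sadj1 -/M M1 -mulmxA M1.
have := block_conj_trace e Hh (para_group_1D sF lF FF).
have -> : block e (sadj (1%:M + F)) = block e 1%:M - block e F.
  by rewrite [sadj _]linearD /= sadj1 sF linearB.
have -> : block e (1%:M + F) = block e 1%:M + block e F by rewrite linearD.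
rewrite -/M; move: (block e F) => f.
have -> : M *m (block e 1%:M - f) *m M *m (block e 1%:M + f) =
    (M *m M - M *m f *m M) + (M *m M *m f - M *m f *m M *m f).
  by rewrite mulmxBr M1 mulmxBl mulmxDr !mulmxBl -!mulmxA !M1.
rewrite mxtraceD !linearB /= MM [\tr (M *m M *m f)]mxtrace_mulC mulmxA.
rewrite [\tr (f *m M *m M)]mxtrace_mulC mulmxA sub0r addrA addNr sub0r.
by move/eqP; rewrite oppr_eq0 => /eqP.
Qed.

(** On an F of rank one the quadratic identity is the square of a single matrix coefficient, which
    therefore vanishes. *)
Lemma rank1_trace (M : 'M[k]_(n + n)) (a : 'cV_(n + n)) (b : 'rV_(n + n)) :
  \tr (M *m (a *m b) *m M *m (a *m b)) = (b *m M *m a) 0 0 ^+ 2.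
Proof.
rewrite !mulmxA mxtrace_mulC !mulmxA -(mulmxA (b *m M *m a)) -(mulmxA (b *m M *m a)).
by rewrite /mxtrace big_ord1 mxE big_ord1 expr2.
Qed.

(** For e <> 0 the mirror half of [root_elt p q] lives in column - e, so its block at e is an
    elementary matrix, of rank one. *)
Lemma block_offdiag h e p q : H h -> e != 0 -> p != q ->
  block e (h - 1%:M) q p = 0.
Proof.
move=> Hh e0 pq; set M := block e _.
have [/andP[/eqP qe /eqP pe]|out] := boolP ((col q == e) && (col p == e)); last first.
  by rewrite mxE (negPf out).
have FE : block e (root_elt p q) = delta_mx p 0 *m delta_mx (0 : 'I_1) q.
  rewrite mul_delta_mx /root_elt sadj_delta; apply/matrixP => i j; rewrite !mxE.
  case: ifP => [/andP[/eqP ie /eqP je]|ij].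
    rewrite (_ : (i == rev_ord q) = false) ?mulr0 ?subr0 //.
    apply/negP => /eqP iq; move: ie e0; rewrite iq col_rev qe; lia.
  by case: (i =P p) ij => //= ->; case: (j =P q) => //= ->; rewrite pe qe eqxx.
have lF : lowers col 0 (root_elt p q) by apply: root_elt_lowers; rewrite pe qe addr0.
have := block_quadratic e Hh (root_elt_sp p q) lF (root_elt_sqr pq).
rewrite FE rank1_trace -rowE -colE => /eqP.
by rewrite expf_eq0 /= !mxE => /eqP.
Qed.

(** A block without off-diagonal entries has the basis vectors as eigenvectors, and the eigenvalues
    of a nilpotent matrix are 0. *)
Lemma block_neq0_eq0 h e : H h -> e != 0 -> block e (h - 1%:M) = 0.
Proof.
move=> Hh e0; have [m hm] := block_nilpotent e Hh; move: hm.
set M := block e _ => hm; apply/matrixP => q p; rewrite [RHS]mxE.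
have [->|pq] := eqVneq p q; last exact: block_offdiag.
have vM : delta_mx (0 : 'I_1) q *m M = M q q *: delta_mx 0 q.
  apply/rowP => j; rewrite -rowE [LHS]mxE [RHS]mxE [delta_mx _ _ _ _]mxE eqxx /=.
  have [->|jq] := eqVneq j q; first by rewrite mulr1.
  by rewrite /M block_offdiag // mulr0.
have := eigenvector_exp m.+1 vM; rewrite hm mulmx0 => /rowP/(_ q)/eqP.
by rewrite !mxE !eqxx mulr1 eq_sym expf_eq0 => /eqP.
Qed.

Section LongRoot.

Variable v : 'rV[k]_(n + n).

(** The map w |-> (w, v) v, which added to the identity gives a symplectic transvection. The middle
    column is paired with itself, and there these maps provide the elements of rank one. *)
Definition long_root_elt : 'M[k]_(n + n) :=
  (\col_p (lsign k p * v 0 (rev_ord p))) *m v.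

Lemma long_root_eltE p q : long_root_elt p q = lsign k p * v 0 (rev_ord p) * v 0 q.
Proof. by rewrite mxE big_ord1 !mxE. Qed.

Lemma long_root_elt_sp : sp_lie long_root_elt.
Proof.
apply/sadj_skewP => p q; rewrite !long_root_eltE lsign_rev rev_ordK.
transitivity (- (lsign k p * lsign k p) * (lsign k q * v 0 q * v 0 (rev_ord p))).
  by rewrite lsign_sqr; ring.
by ring.
Qed.

Lemma long_root_elt_sqr : long_root_elt *m long_root_elt = 0.
Proof.
have -> : long_root_elt *m long_root_elt =
   (\col_p (lsign k p * v 0 (rev_ord p))) *m
   (v *m \col_p (lsign k p * v 0 (rev_ord p))) *m v by rewrite !mulmxA.
suff -> : v *m (\col_p (lsign k p * v 0 (rev_ord p))) = 0.
  by rewrite mulmx0 mul0mx.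
apply/matrixP => i j; rewrite [i]ord1 [j]ord1 [RHS]mxE; apply: (two_eq0 char_k).
rewrite mxE {1}(reindex_inj rev_ord_inj) -big_split big1 //= => p _.
by rewrite !mxE lsign_rev rev_ordK; ring.
Qed.

Hypothesis v_col0 : forall p, col p != 0 -> v 0 p = 0.

Lemma long_root_elt_col0 p q : (col p == 0) && (col q == 0) = false ->
  long_root_elt p q = 0.
Proof.
rewrite long_root_eltE => /negbT; rewrite negb_and => /orP[p0|q0].
  by rewrite v_col0 ?mulr0 ?mul0r // col_rev oppr_eq0.
by rewrite [v 0 q]v_col0 ?mulr0.
Qed.

Lemma long_root_elt_lowers : lowers col 0 long_root_elt.
Proof.
move=> p q pq; apply: long_root_elt_col0; apply/negP => /andP[/eqP p0 /eqP q0].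
by move: pq; rewrite p0 q0.
Qed.

Lemma block_long_root_elt : block 0 long_root_elt = long_root_elt.
Proof.
by apply/matrixP => p q; rewrite mxE; case: ifP => // /long_root_elt_col0.
Qed.

End LongRoot.

(** Transvections show that the quadratic form with matrix K vanishes on the middle column. By
    polarization K is alternating there, which says that M is self-adjoint. *)
Lemma block0_sadj h : H h -> sadj (block 0 (h - 1%:M)) = block 0 (h - 1%:M).
Proof.
move=> Hh; set M := block 0 _.
pose K p q := M p (rev_ord q) * lsign k (rev_ord q).
have quad (v : 'rV_(n + n)) : (forall p, col p != 0 -> v 0 p = 0) ->
    \sum_q \sum_p v 0 p * K p q * v 0 q = 0.
  move=> v0; have := block_quadratic 0 Hh (long_root_elt_sp v)
    (long_root_elt_lowers v0) (long_root_elt_sqr v).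
  rewrite block_long_root_elt // rank1_trace => /eqP; rewrite expf_eq0 /= => /eqP.
  rewrite mxE (reindex_inj rev_ord_inj) /= => E; rewrite -[RHS]E.
  apply: eq_bigr => q _; rewrite !mxE mulr_suml; apply: eq_bigr => p _.
  by rewrite rev_ordK /K; ring.
have ind a b : \sum_q \sum_p (p == a)%:R * K p q * (q == b)%:R = K a b.
  rewrite (bigD1 b) //= [X in _ + X]big1 ?addr0 => [|q qb]; last first.
    by rewrite big1 // => p _; rewrite (negPf qb) mulr0.
  rewrite (bigD1 a) //= big1 ?addr0 => [|p pa]; last by rewrite (negPf pa) !mul0r.
  by rewrite !eqxx mul1r mulr1.
have K2 a b : col a = 0 -> col b = 0 -> K a a + K a b + (K b a + K b b) = 0.
  move=> a0 b0; rewrite -!ind -!big_split /=.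
  rewrite -[RHS](quad (\row_p ((p == a)%:R + (p == b)%:R))); last first.
    move=> p p0; rewrite mxE; case: (p =P a) p0 => [->|_]; first by rewrite a0 eqxx.
    by case: (p =P b) => [->|_]; [rewrite b0 eqxx | rewrite addr0].
  apply: eq_bigr => q _; rewrite -!big_split /=; apply: eq_bigr => p _.
  by rewrite !mxE; ring.
have K1 a : col a = 0 -> K a a = 0.
  move=> a0; apply: (two_eq0 char_k); apply: (two_eq0 char_k).
  by rewrite -[RHS](K2 a a a0 a0).
apply/matrixP => p r; rewrite mxE.
have [/andP[/eqP p0 /eqP r0]|pr] := boolP ((col p == 0) && (col r == 0)); last first.
  have out a b : ~~ ((col a == 0) && (col b == 0)) -> M a b = 0.
    by move=> ab; rewrite mxE (negPf ab).
  by rewrite (out p r) // out ?mulr0 // !col_rev !oppr_eq0 andbC.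
have r0' : col (rev_ord r) = 0 by rewrite col_rev r0 oppr0.
have := K2 _ _ p0 r0'; rewrite !K1 // add0r addr0 /K rev_ordK => E.
have {}E : M p r * lsign k r = lsign k p * M (rev_ord r) (rev_ord p).
  apply/eqP; rewrite -subr_eq0 -E; apply/eqP.
  by rewrite lsign_rev; ring.
by rewrite mulrAC -E -mulrA lsign_sqr mulr1.
Qed.

(** Isometry of h = 1 + N reads N + N^* + N N^* = 0, so the self-adjoint block M satisfies M^2 = -2
    M. Nilpotency then leaves only M = 0, as 2 is invertible. *)
Lemma block0_eq0 h : H h -> block 0 (h - 1%:M) = 0.
Proof.
move=> Hh; have [hh lh] := normalH.1 _ Hh; have aM := block0_sadj Hh.
have [m hm] := block_nilpotent 0 Hh; move: aM hm; set N := h - 1%:M; set M := block 0 N.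
move=> aM hm; have lN : lowers col 0 N by apply: lowers_sub1.
have NN : N + sadj N + N *m sadj N = 0.
  have -> : sadj N = sadj h - 1%:M by rewrite linearB /= sadj1.
  rewrite /N mulmxBr mulmxBl hh mulmx1 mul1mx.
  by apply/matrixP => i j; rewrite !mxE; ring.
have bN : block 0 (sadj N) = M.
  rewrite -aM; apply/matrixP => p q; rewrite !mxE !col_rev !oppr_eq0 andbC.
  by case: ifP => _; rewrite ?mulr0.
have MM : M *m M = (- 2%:R) *: M.
  have := congr1 (block 0) NN; rewrite linear0.
  have -> : block 0 (N + sadj N + N *m sadj N) = block 0 N + block 0 (sadj N) + block 0 (N *m sadj N).
    by rewrite !linearD.
  rewrite blockM ?bN -/M //; last exact: lowers_sadj.
  move/eqP; rewrite addrC addr_eq0 => /eqP ->.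
  by rewrite scaleNr scaler_nat mulr2n.
have MX j : M ^+ j.+1 = (- 2%:R) ^+ j *: M.
  elim: j => [|j IHj]; first by rewrite scale1r.
  by rewrite exprS IHj -[M * _]scalemxAr MM scalerA exprSr.
apply/eqP; have /eqP := hm; rewrite MX scaler_eq0 => /orP[|//].
by rewrite expf_eq0 oppr_eq0 (negPf char_k) andbF.
Qed.

Lemma normal_unipotent_sub h : H h -> nil_group h.
Proof.
move=> Hh; split; first exact: normalH.1.
move=> p q pq; have [lt_pq|ge_pq] := ltP (col p) (col q).
  by apply: (lowers_sub1 Hh); rewrite addr0.
have qp : col q = col p by lia.
have : block (col p) (h - 1%:M) = 0.
  by have [->|/(block_neq0_eq0 Hh)//] := eqVneq (col p) 0; apply: block0_eq0.
by move/matrixP/(_ p q); rewrite [LHS]mxE qp eqxx [RHS]mxE.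
Qed.

End NormalUnipotent.

Lemma unipotent_radicalP g : unipotent_radical para_group g <-> nil_group g.
Proof.
split=> [[H [gH _ _ nH uH] Hg]|]; last exact: nil_group_radical.
exact: (normal_unipotent_sub gH nH uH Hg).
Qed.

Lemma lie_radicalP X : lie_algebra (unipotent_radical para_group) X <-> nil_lie col X.
Proof.
split=> [tX|]; last exact: nil_lie_tangent.
by apply: tangent_nil_lie => f f0; apply: tX => g /unipotent_radicalP/f0.
Qed.

End LieAlgebra.

(** * Parabolic subgroups and the Chevalley basis *)

Section SymplecticGroup.

Variables (k : closedFieldType) (n : nat).
Implicit Types g : 'M[k]_(n + n).

Lemma gramE (p q : 'I_(n + n)) : gram k n p q = (q == rev_ord p)%:R * lsign k p.
Proof.
rewrite mxE addrC addr_eq0 -label_rev (inj_eq (@label_inj n)) label_gt0 /lsign.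
by case: eqP => _; rewrite ?mul0r ?mul1r.
Qed.

Lemma sadj_gram g : sadj g *m gram k n = gram k n *m g^T.
Proof.
apply/matrixP => p q; rewrite !mxE (bigD1 (rev_ord q)) //= big1 ?addr0 => [|r rq].
  rewrite (bigD1 (rev_ord p)) //= big1 ?addr0 => [|r rp].
    rewrite !gramE !mxE !rev_ordK !eqxx !mul1r.
    transitivity (lsign k (rev_ord q) * lsign k (rev_ord q) * (lsign k p * g q (rev_ord p))).
      by ring.
    by rewrite lsign_sqr mul1r.
  by rewrite gramE (negPf rp) !mul0r.
by rewrite gramE -rev_ord_eq eq_sym (negPf rq) mul0r mulr0.
Qed.

Lemma gram_unit : gram k n \in unitmx.
Proof.
have : gram k n *m - gram k n = 1%:M; last by case/mulmx1_unit.
apply/matrixP => p q; rewrite mulmxN !mxE (bigD1 (rev_ord p)) //= big1 ?addr0 => [|r rp].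
  rewrite !gramE rev_ordK eqxx lsign_rev mul1r [q == p]eq_sym.
  by case: eqP => _; rewrite ?mul1r ?mul0r ?mulr0 ?oppr0 // mulrN opprK lsign_sqr.
by rewrite gramE (negPf rp) !mul0r.
Qed.

Lemma sformE (u w : 'rV_(n + n)) g : sform (u *m g) (w *m g) =
  (u *m (g *m gram k n *m g^T) *m w^T) 0 0.
Proof. by rewrite /sform trmx_mul !mulmxA. Qed.

Lemma SpP g : Sp g <-> g *m sadj g = 1%:M.
Proof.
have key : g *m gram k n *m g^T = g *m sadj g *m gram k n.
  by rewrite -!mulmxA sadj_gram.
split=> [[ug isom]|gg]; last first.
  have [ug _] := mulmx1_unit gg; split=> // u w.
  by rewrite sformE key gg mul1mx.
suff E : g *m sadj g *m gram k n = gram k n.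
  by rewrite -[LHS](mulmxK gram_unit) E mulmxV // gram_unit.
rewrite -key; apply/matrixP => p q.
have ent (A : 'M[k]_(n + n)) :
    ((delta_mx 0 p : 'rV_(n + n)) *m A *m (delta_mx 0 q : 'rV_(n + n))^T) 0 0 = A p q.
  by rewrite trmx_delta -rowE -colE !mxE.
by have := isom (delta_mx 0 p) (delta_mx 0 q); rewrite sformE /sform !ent.
Qed.

Lemma bvec_label (p : 'I_(n + n)) : bvec k n (label p) = delta_mx 0 p.
Proof.
by apply/rowP => q; rewrite !mxE eqxx (inj_eq (@label_inj n)).
Qed.

(** * The stabilizer of the flag in terms of columns *)

Section Flag.

Variable d : int -> nat.
Let inflag i (p : 'I_(n + n)) : bool := label p <= - (cpart d i)%:Z - 1.

Lemma flagP (v : 'rV[k]_(n + n)) i :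
  (v <= flag k n d i)%MS <-> forall p, ~~ inflag i p -> v 0 p = 0.
Proof.
split=> [/sub_sumsmxP[u ->] p np | v0].
  rewrite summxE big1 // => q fq; set w := u q *m _.
  have /submxP[D ->] : (w <= bvec k n (label q))%MS.
    by apply: submx_trans (submxMl _ _) _; rewrite genmxE.
  rewrite bvec_label mxE big_ord1 !mxE eqxx /=; case: eqP => [pq|_]; last by rewrite mulr0.
  by rewrite /inflag pq fq in np.
rewrite [v]row_sum_delta; apply: summx_sub => p _.
have [fp|np] := boolP (inflag i p); last by rewrite (v0 p np) scale0r sub0mx.
by apply: scalemx_sub; apply: (sumsmx_sup p) => //; rewrite genmxE bvec_label.
Qed.

Lemma flag_stable g i : (forall p q, inflag i p -> ~~ inflag i q -> g p q = 0) ->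
  (flag k n d i *m g <= flag k n d i)%MS.
Proof.
move=> g0; rewrite /flag sumsmxMr; apply/sumsmx_subP => p fp.
rewrite (eqmxMr _ (genmxE _)) bvec_label -rowE; apply/flagP => q nq.
by rewrite mxE g0.
Qed.

Lemma flag_entries g i : (flag k n d i *m g <= flag k n d i)%MS ->
  forall p q, inflag i p -> ~~ inflag i q -> g p q = 0.
Proof.
move=> gi p q fp fq; have /flagP/(_ q fq) : (row p g <= flag k n d i)%MS.
  apply: submx_trans gi; rewrite rowE; apply: submxMr; apply/flagP => r fr.
  by rewrite mxE; case: (r =P p) fr => [->|_]; rewrite ?fp ?andbF.
by rewrite mxE.
Qed.

Variables (s : nat) (col : 'I_(n + n) -> int).
Hypothesis col_rev : forall p, col (rev_ord p) = - col p.
Hypothesis col_bound : forall p, `|col p| <= s%:Z.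
Hypothesis col_flag : forall i p, (1 <= i <= s.+1)%N -> inflag i p = (col p <= - i%:Z).

(** Stability of the flag controls the entries of g that start in a negative column. The remaining
    ones are, up to sign, such entries of g^*, which is the inverse of g and stabilizes the flag as
    well. *)
Lemma parabolicP g : parabolic s d g <-> para_group col g.
Proof.
split=> [[/SpP gg stab]|pg]; last first.
  have [gg lg] := pg; have [g'g lg'] := para_group_sadj col_rev pg.
  split=> [|i si]; first exact/SpP.
  have sub h : lowers col 0 h -> (flag k n d i *m h <= flag k n d i)%MS.
    move=> lh; apply: flag_stable => p q; rewrite !col_flag // -ltNge => pi qi.
    by apply: lh; lia.
  apply/andP; split; first exact: sub.
  by rewrite -{1}[flag k n d i]mulmx1 -(mulmx1C gg) mulmxA submxMr // sub.
split=> // p q; rewrite addr0 => pq.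
have neg h : (forall i, (1 <= i <= s.+1)%N -> (flag k n d i *m h <= flag k n d i)%MS) ->
    forall p q, col p < col q -> col p < 0 -> h p q = 0.
  move=> {p q pq}stabh p q pq p0; pose i := absz (col p).
  have si : (1 <= i <= s.+1)%N by have := col_bound p; rewrite /i; lia.
  by apply: (flag_entries (stabh i si)); rewrite col_flag // /i; lia.
have [p0|p0] := ltP (col p) 0; first by apply: neg => // i /stab/andP[].
have : sadj g (rev_ord q) (rev_ord p) = 0.
  apply: neg; rewrite ?col_rev; try lia.
  move=> i /stab/andP[_ gi]; have /(submxMr (sadj g)) := gi.
  by rewrite -mulmxA gg mulmx1.
move/eqP; rewrite mxE !rev_ordK mulf_eq0 mulf_eq0 !lsign_rev !oppr_eq0.
by rewrite !(negPf (lsign_neq0 _ _)) => /eqP.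
Qed.

End Flag.

(** Equivalent predicates need not be equal, so properties of the subgroup are transferred along the
    equivalence. *)
Lemma unipotent_radical_iff (P Q : 'M[k]_(n + n) -> Prop) :
  (forall g, P g <-> Q g) -> forall g, unipotent_radical P g -> unipotent_radical Q g.
Proof.
move=> PQ g [H [gH [C zC HC] cH [subH nH] uH] Hg]; exists H => //; split=> //.
  by exists C => // h; split=> [/HC[/PQ Qh Ch]|[/PQ Ph Ch]] //; apply/HC.
by split=> [h /subH/PQ//|h h' /PQ]; apply: nH.
Qed.

Lemma richardson_iff (P Q : 'M[k]_(n + n) -> Prop) (U : 'M[k]_(n + n) -> Prop) x :
  (forall g, P g <-> Q g) -> (forall X, lie_algebra (unipotent_radical Q) X <-> U X) ->
  U x -> zopen_in U (adjoint_orbit Q x) -> zdense_in U (adjoint_orbit Q x) ->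
  richardson_element P x.
Proof.
move=> PQ LU Ux [C zC openC] [sub dense].
have LP X : lie_algebra (unipotent_radical P) X <-> U X.
  split=> [L|/LU L f f0].
    apply/LU => f f0; apply: L => g Rg; apply: f0; exact: unipotent_radical_iff Rg.
  apply: L => g Rg; apply: f0; apply: unipotent_radical_iff Rg => h.
  by split=> /PQ.
have orb y : adjoint_orbit P x y <-> adjoint_orbit Q x y.
  by split=> -[g /PQ Pg yE]; exists g.
split; first exact/LP.
  exists C => // y; split=> [/orb/openC[/LP Ly nC]|[/LP Uy nC]] //.
  by apply/orb/openC.
split=> [y /orb/sub/LP//|D zD orbD y /LP]; by apply: dense => // z /orb/orbD.
Qed.

End SymplecticGroup.

(** * Signs of the Chevalley basis *)

Section Chevalley.

Variables (k : closedFieldType) (n : nat).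
Implicit Types p q : 'I_(n + n).

Lemma emxE a b p q : emx k n a b p q = ((label p == a) && (label q == b))%:R.
Proof. by rewrite mxE. Qed.

Lemma label_neq0 p : label p != 0.
Proof. by rewrite /label; case: ltnP => ?; lia. Qed.

Lemma label_bound p : `|label p| <= n%:Z.
Proof. by have hp := ltn_ord p; rewrite /label; case: ltnP => ?; lia. Qed.

Lemma mem_posint (a : int) :
  reflect (0 < a <= n%:Z) (a \in [seq i%:Z | i <- iota 1 n]).
Proof.
apply: (iffP mapP) => [[i + ->]|an]; first by rewrite mem_iota; lia.
by exists (absz a); rewrite ?mem_iota; lia.
Qed.

Lemma eps_unique p q c :
  (forall b, b \in chevalley_basis k n -> b p q != 0 -> b p q = c) ->
  (exists2 b, b \in chevalley_basis k n & b p q != 0) -> eps k p q = c.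
Proof.
move=> uniq_c [b bB bpq]; rewrite /eps.
have : b \in [seq b : 'M[k]_(n + n) <- chevalley_basis k n | b p q != 0].
  by rewrite mem_filter bpq.
case E : [seq b <- _ | _] => [//|b' t] _ /=.
have : b' \in [seq b : 'M[k]_(n + n) <- chevalley_basis k n | b p q != 0].
  by rewrite E mem_head.
by rewrite mem_filter => /andP[b'pq b'B]; apply: uniq_c.
Qed.

Lemma chevalley_basisP (b : 'M[k]_(n + n)) : b \in chevalley_basis k n <->
  exists i j : int, [/\ 0 < i <= n%:Z, 0 < j <= n%:Z &
    [\/ b = emx k n i j - emx k n (- j) (- i),
        i < j /\ b = emx k n i (- j) + emx k n j (- i),
        i < j /\ b = emx k n (- i) j + emx k n (- j) i
      | i = j /\ (b = emx k n i (- i) \/ b = emx k n (- i) i)]].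
Proof.
rewrite /chevalley_basis !mem_cat.
set I := [seq i%:Z | i <- iota 1 n]; split.
  case/or4P => [/mapP[t /allpairsP[[i j] /= [/mem_posint ii /mem_posint jj ->]] ->]|
    /mapP[t + ->]|/mapP[t + ->]|/orP[]/mapP[i /mem_posint ii ->]].
  - by exists i, j; split=> //; constructor 1.
  - rewrite mem_filter => /andP[ij /allpairsP[[i j] /= [/mem_posint ii /mem_posint jj E]]].
    by rewrite E in ij *; exists i, j; split=> //; constructor 2.
  - rewrite mem_filter => /andP[ij /allpairsP[[i j] /= [/mem_posint ii /mem_posint jj E]]].
    by rewrite E in ij *; exists i, j; split=> //; constructor 3.
  - by exists i, i; split=> //; constructor 4; split=> //; left.
  - by exists i, i; split=> //; constructor 4; split=> //; right.
move=> [i [j [/mem_posint ii /mem_posint jj]]].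
have ij_in : (i, j) \in [seq (i, j) | i <- I, j <- I] by apply/allpairsP; exists (i, j).
case=> [->|[ij ->]|[ij ->]|[ij [->|->]]].
- by apply/orP; left; apply/mapP; exists (i, j).
- apply/orP; right; apply/orP; left; apply/mapP; exists (i, j) => //.
  by rewrite mem_filter ij.
- apply/orP; right; apply/orP; right; apply/orP; left; apply/mapP; exists (i, j) => //.
  by rewrite mem_filter ij.
- by do 3 (apply/orP; right); apply/orP; left; apply/mapP; exists i.
- by do 4 (apply/orP; right); apply/mapP; exists i.
Qed.

(** The members e_{-i,j} + e_{-j,i} and e_{-k,k} break the rule that the coefficient has the sign of
    the source label, but they raise labels. *)
Lemma epsE p q : label q < label p -> eps k p q = if label p < 0 then -1 else 1.
Proof.
have [np nq] := (label_neq0 p, label_neq0 q).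
have [bp bq] := (label_bound p, label_bound q).
have addE (A B : 'M[k]_(n + n)) : (A + B) p q = A p q + B p q by rewrite mxE.
have subE (A B : 'M[k]_(n + n)) : (A - B) p q = A p q - B p q by rewrite !mxE.
move=> qp; apply: eps_unique => [b /chevalley_basisP|].
  move=> [i [j [ii jj H]]]; move: H.
  case=> [->|[ij ->]|[ij ->]|[ij [->|->]]]; rewrite ?subE ?addE !emxE.
  - have [/andP[/eqP -> /eqP ->]|_] := boolP ((label p == i) && _).
      rewrite (_ : (i == - j) = false) /=; last by lia.
      by rewrite subr0 ltNge ltW //; lia.
    have [/andP[/eqP pE /eqP qE]|_] := boolP ((label p == - j) && _).
      by rewrite pE sub0r oppr_lt0 (_ : 0 < j) //; lia.
    by rewrite subr0 eqxx.
  - have [/andP[/eqP pE _]|_] := boolP ((label p == i) && _).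
      have [ne i0] : (i == j) = false /\ (i < 0) = false by lia.
      by rewrite pE ne i0 addr0.
    have [/andP[/eqP pE _]|_] := boolP ((label p == j) && _).
      by rewrite pE add0r (_ : (j < 0) = false) //; lia.
    by rewrite addr0 eqxx.
  - have [/andP[/eqP pE /eqP qE]|_] := boolP ((label p == - i) && _).
      by move: qp; rewrite pE qE; lia.
    have [/andP[/eqP pE /eqP qE]|_] := boolP ((label p == - j) && _).
      by move: qp; rewrite pE qE; lia.
    by rewrite addr0 eqxx.
  - have [/andP[/eqP pE _]|_] := boolP ((label p == i) && _); last by rewrite eqxx.
    by rewrite pE (_ : (i < 0) = false) //; lia.
  - have [/andP[/eqP pE /eqP qE]|_] := boolP ((label p == - i) && _); last by rewrite eqxx.
    by move: qp; rewrite pE qE; lia.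
have [p0|p0] := ltP 0 (label p).
  have [q0|q0] := ltP 0 (label q).
    exists (emx k n (label p) (label q) - emx k n (- label q) (- label p)).
      by apply/chevalley_basisP; exists (label p), (label q); split; [lia|lia|constructor 1].
    rewrite subE !emxE !eqxx.
    by rewrite (_ : (label p == - label q) = false) ?subr0 ?oner_eq0 //; lia.
  have [E|ne] := eqVneq (label p) (- label q).
    exists (emx k n (label p) (- label p)).
      apply/chevalley_basisP; exists (label p), (label p); split; [lia|lia|].
      by constructor 4; split=> //; left.
    by rewrite emxE E opprK !eqxx oner_eq0.
  have [lt|gt] := ltP (label p) (- label q).
    exists (emx k n (label p) (- - label q) + emx k n (- label q) (- label p)).
      by apply/chevalley_basisP; exists (label p), (- label q); split; [lia|lia|constructor 2].
    by rewrite addE !emxE opprK !eqxx (negPf ne) addr0 oner_eq0.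
  exists (emx k n (- label q) (- label p) + emx k n (label p) (- - label q)).
    apply/chevalley_basisP; exists (- label q), (label p); split; [lia|lia|constructor 2].
    by split=> //; lia.
  by rewrite addE !emxE opprK !eqxx (negPf ne) add0r oner_eq0.
exists (emx k n (- label q) (- label p) - emx k n (- - label p) (- - label q)).
  by apply/chevalley_basisP; exists (- label q), (- label p); split; [lia|lia|constructor 1].
rewrite subE !emxE !opprK !eqxx.
by rewrite (_ : (label p == - label q) = false) ?sub0r ?oppr_eq0 ?oner_eq0 //; lia.
Qed.

End Chevalley.

(** * Matrices that commute with the arrows up to the nilradical *)

Section Chains.

Variables (n : nat) (col ch : 'I_(n + n) -> int).
Implicit Types p q r : 'I_(n + n).

(** Here [ch p] names the row of p. The two rows of a block through the middle column have opposite
    names, the upper one being positive. *)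
Definition next_in_row p q : bool :=
  [&& ch q == ch p, col q < col p
    & [forall r, ~~ ((ch r == ch p) && (col q < col r < col p))]].

Definition meets (c : int) (e : int) : bool := [exists r, (ch r == c) && (col r == e)].

Lemma meets_colP c e : reflect (exists2 r, ch r = c & col r = e) (meets c e).
Proof.
by apply: (iffP existsP) => [[r /andP[/eqP ? /eqP ?]]|[r <- <-]]; exists r; rewrite ?eqxx.
Qed.

Lemma next_in_rowP p q : next_in_row p q ->
  [/\ ch q = ch p, col q < col p &
     forall r, ch r = ch p -> col r < col p -> col r <= col q].
Proof.
case/and3P => /eqP cq qp /forallP H; split=> // r cr rp.
by have := H r; rewrite cr eqxx rp andbT /= -leNgt.
Qed.

Lemma next_exists p r : ch r = ch p -> col r < col p ->
  exists2 q, next_in_row p q & col r <= col q.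
Proof.
move=> cr rp.
pose P q := (ch q == ch p) && (col q < col p).
have Pr : P r by rewrite /P cr eqxx.
case: (@Order.TotalTheory.arg_maxP _ int _ r P col Pr) => q /andP[cq qp] maxq.
exists q; last exact: maxq.
rewrite /next_in_row cq qp /=; apply/forallP => t; apply/negP => /and3P[ct qt tp].
by have := maxq t; rewrite /P ct tp => /(_ isT) /=; lia.
Qed.

Lemma prev_exists p r : ch r = ch p -> col p < col r ->
  exists2 q, next_in_row q p & col q <= col r.
Proof.
move=> cr rp.
pose P q := (ch q == ch p) && (col p < col q).
have Pr : P r by rewrite /P cr eqxx.
case: (@Order.TotalTheory.arg_minP _ int _ r P col Pr) => q /andP[/eqP cq qp] minq.
exists q; last exact: minq.
rewrite /next_in_row cq eqxx qp /=; apply/forallP => t; apply/negP => /and3P[ct pt tq].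
by have := minq t; rewrite /P ct pt => /(_ isT) /=; lia.
Qed.

Hypothesis col_ch_inj : forall p q, col p = col q -> ch p = ch q -> p = q.

Lemma next_uniq p q q' : next_in_row p q -> next_in_row p q' -> q = q'.
Proof.
move=> /next_in_rowP[cq qp mq] /next_in_rowP[cq' qp' mq']; apply: col_ch_inj; last by rewrite cq.
by apply/eqP; rewrite eq_le mq' // mq.
Qed.

Lemma prev_uniq p p' q : next_in_row p q -> next_in_row p' q -> p = p'.
Proof.
move=> /next_in_rowP[cq qp mq] /next_in_rowP[cq' qp' mq']; apply: col_ch_inj; last by rewrite -cq.
apply/eqP; rewrite eq_le !leNgt; apply/andP; split; apply/negP => lt.
  by have := mq p' _ lt; rewrite -cq' => /(_ cq); lia.
by have := mq' p _ lt; rewrite -cq => /(_ cq'); lia.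
Qed.

Hypothesis col_rev : forall p, col (rev_ord p) = - col p.

Variable extra : 'I_(n + n) -> 'I_(n + n) -> bool.

Hypothesis rev_chain : forall p, meets (ch p) 0 -> ch (rev_ord p) = - ch p.
Hypothesis extraP : forall p q, extra p q ->
  [/\ q = rev_ord p, 0 < ch p, meets (ch p) 0 & exists2 r, next_in_row p r & col r = 0].
Hypothesis extra_or_almost_nested : forall p r, 0 < ch p -> next_in_row p r -> col r = 0 ->
  extra p (rev_ord p) \/
  forall q q', ch q = ch p -> ch q' = ch p -> 0 < col q -> 0 < col q' ->
    ~~ meets (- ch p) (col q) -> ~~ meets (- ch p) (col q') -> q = q'.
Hypothesis upper_half : forall p, ch p < 0 -> meets (ch p) 0 -> 0 <= col p ->
  meets (- ch p) (col p).
Hypothesis nested_ends : forall p q, col p < col q ->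
  [\/ forall r, ch r = ch p -> col r <= col p -> meets (ch q) (col r),
      forall r, ch r = ch q -> col q <= col r -> meets (ch p) (col r)
    | [/\ ch p < 0, ch q = - ch p & meets (ch p) 0]].

Variable k : fieldType.
Hypothesis char_k : (2%:R : k) != 0.
Variables X Z : 'M[k]_(n + n).
Hypothesis X_arrows : forall p q, (X p q != 0) = next_in_row p q || extra p q.
Hypotheses (sX : sp_lie X) (sZ : sp_lie Z).
Hypothesis lowers_comm : lowers col 1 (Z *m X - X *m Z).

(** The additional arrows contribute nothing to the commutator equation at (p, q). *)
Definition clean p q : Prop :=
  (forall r, extra r q -> Z p r = 0) /\ (forall r, extra p r -> Z r q = 0).

Lemma comm_eq p q : col p <= col q ->
  \sum_r Z p r * X r q = \sum_r X p r * Z r q.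
Proof.
move=> pq; have := lowers_comm (p := p) (q := q); rewrite !mxE => H.
by apply/eqP; rewrite -subr_eq0 H //; lia.
Qed.

Lemma X_eq0 p q : ~~ next_in_row p q -> ~~ extra p q -> X p q = 0.
Proof. by move=> np ne; apply/eqP/negPn; rewrite X_arrows negb_or np ne. Qed.

Lemma X_neq0 p q : next_in_row p q -> X p q != 0.
Proof. by rewrite X_arrows => ->. Qed.

Lemma sum_to p q : (forall r, extra r q -> Z p r = 0) ->
  (forall r, next_in_row r q -> Z p r = 0) -> \sum_r Z p r * X r q = 0.
Proof.
move=> eq nq; rewrite big1 // => r _.
have [/nq->|nrq] := boolP (next_in_row r q); first by rewrite mul0r.
have [/eq->|erq] := boolP (extra r q); first by rewrite mul0r.
by rewrite X_eq0 ?mulr0.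
Qed.

Lemma sum_from p q : (forall r, extra p r -> Z r q = 0) ->
  (forall r, next_in_row p r -> Z r q = 0) -> \sum_r X p r * Z r q = 0.
Proof.
move=> ep np; rewrite big1 // => r _.
have [/np->|npr] := boolP (next_in_row p r); first by rewrite mulr0.
have [/ep->|epr] := boolP (extra p r); first by rewrite mulr0.
by rewrite X_eq0 ?mul0r.
Qed.

(** The equation at (p, q) reads [Z p q' * X q' q = X p p' * Z p' q], with p' the left neighbour of
    p. It carries vanishing from (p', q) to (p, q'), and gives it outright if p is leftmost in its
    row. *)
Lemma step_down p q' q : next_in_row q' q -> col p <= col q -> clean p q ->
  (forall p', next_in_row p p' -> Z p' q = 0) -> Z p q' = 0.
Proof.
move=> nq pq [c1 c2] Hp; have := comm_eq pq; rewrite (sum_from c2 Hp).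
rewrite (bigD1 q') //= big1 ?addr0 => [|r rq'].
  by move/eqP; rewrite mulf_eq0 (negPf (X_neq0 nq)) orbF => /eqP.
have [/c1->|erq] := boolP (extra r q); first by rewrite mul0r.
rewrite X_eq0 ?mulr0 //; apply: contra rq' => nr.
by rewrite (prev_uniq nr nq).
Qed.

Lemma step_up p p' q : next_in_row p p' -> col p <= col q -> clean p q ->
  (forall q', next_in_row q' q -> Z p q' = 0) -> Z p' q = 0.
Proof.
move=> np pq [c1 c2] Hq; have := comm_eq pq; rewrite (sum_to c1 Hq).
rewrite (bigD1 p') //= big1 ?addr0 => [|r rp'].
  by move/esym/eqP; rewrite mulf_eq0 (negPf (X_neq0 np)) => /eqP.
have [/c2->|epr] := boolP (extra p r); first by rewrite mulr0.
rewrite X_eq0 ?mul0r //; apply: contra rp' => nr.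
by rewrite (next_uniq nr np).
Qed.

Lemma col_lt_ind (P : 'I_(n + n) -> Prop) :
  (forall p, (forall r, col r < col p -> P r) -> P p) -> forall p, P p.
Proof.
move=> H; pose b := \max_r absz (col r).
have bP p : (absz (col p) <= b)%N by apply: (@leq_bigmax _ (fun r => absz (col r))).
suff H' m p : col p + b%:Z < m%:Z -> P p.
  by move=> p; apply: (H' (b + b).+1); have := bP p; lia.
elim: m p => [|m IHm] p pm; first by have := bP p; lia.
by apply: H => r rp; apply: IHm; lia.
Qed.

Lemma col_gt_ind (P : 'I_(n + n) -> Prop) :
  (forall p, (forall r, col p < col r -> P r) -> P p) -> forall p, P p.
Proof.
move=> H p; rewrite -[p]rev_ordK; apply: (col_lt_ind (P := fun r => P (rev_ord r))).
move=> {}p IH; apply: H => r pr; rewrite -[r]rev_ordK.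
by apply: IH; move: pr; rewrite !col_rev; lia.
Qed.

(** Both vertices move left along their rows. As the row of q meets all columns of the row of p from
    p leftwards, the next vertex after q is never to the left of p, and the row of p is the first to
    end. *)
Lemma descend p q : col p < col q ->
  (forall r, ch r = ch p -> col r <= col p -> meets (ch q) (col r)) ->
  (forall r t, ch r = ch p -> ch t = ch q -> col r <= col p -> col r <= col t ->
     clean r t) ->
  Z p q = 0.
Proof.
elim/col_lt_ind: p q => p IH q pq sub cl.
have /meets_colP[r cr rp] := sub p erefl (lexx _).
have [q' nq rq'] := next_exists cr (eq_ind_r (fun c => c < col q) pq rp).
have [cq' _ _] := next_in_rowP nq.
apply: (step_down nq); [lia | by apply: cl => //; lia | move=> p' np].
have [cp' p'p _] := next_in_rowP np.
apply: IH => //; first by lia.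
  by move=> t ct tp'; rewrite cq'; apply: sub; [rewrite ct cp' | lia].
by move=> t u ct cu tp' tu; apply: cl => //; [rewrite ct | rewrite cu | lia].
Qed.

(** Cleanliness is asked only for vertices strictly to the right of p, so that p itself may be the
    source of an additional arrow, as in [far_eq0]. *)
Lemma ascend p q : col p < col q ->
  (forall r, ch r = ch q -> col q <= col r -> meets (ch p) (col r)) ->
  (forall r t, ch r = ch p -> ch t = ch q -> col p < col r -> col r <= col t ->
     clean r t) ->
  Z p q = 0.
Proof.
elim/col_gt_ind: p q => p IH q pq sub cl.
have /meets_colP[r cr rq] := sub q erefl (lexx _).
have [p' np p'r] := prev_exists cr (eq_ind_r (fun c => col p < c) pq rq).
have [cp' p'p _] := next_in_rowP np.
apply: (step_up np); [lia | by apply: cl => //; lia | move=> q' nq].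
have [cq' q'q _] := next_in_rowP nq.
apply: IH => //; first by lia.
  by move=> t ct tq'; rewrite -cp'; apply: sub; [rewrite cq' ct | lia].
by move=> t u ct cu tp' tu; apply: cl => //; [rewrite cp' ct | rewrite cu | lia].
Qed.

Lemma next_rev p q : meets (ch p) 0 -> next_in_row p q -> next_in_row (rev_ord q) (rev_ord p).
Proof.
move=> mp /next_in_rowP[cq qp mq].
have rp := rev_chain mp; have rq : ch (rev_ord q) = - ch p by rewrite rev_chain ?cq.
rewrite /next_in_row rp rq eqxx !col_rev ltrN2 qp /=; apply/forallP => r; apply/negP.
case/and3P => /eqP cr pr rq'; have mr : meets (- ch p) 0.
  by have /meets_colP[t ct t0] := mp; apply/meets_colP; exists (rev_ord t);
    rewrite ?rev_chain ?ct ?col_rev ?t0.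
have := mq (rev_ord r); rewrite rev_chain ?cr // opprK col_rev => /(_ erefl).
by lia.
Qed.

Lemma meets_opp c : meets c 0 -> meets (- c) 0.
Proof.
move=> mc; have /meets_colP[t ct t0] := mc; apply/meets_colP; exists (rev_ord t).
  by rewrite rev_chain ct.
by rewrite col_rev t0 oppr0.
Qed.

Lemma lower_half q : 0 < ch q -> meets (ch q) 0 -> col q <= 0 -> meets (- ch q) (col q).
Proof.
move=> cq mq q0; have crq := rev_chain mq.
have := @upper_half (rev_ord q); rewrite crq col_rev opprK oppr_lt0 oppr_ge0.
move=> /(_ cq (meets_opp mq) q0) /meets_colP[r cr rq]; apply/meets_colP; exists (rev_ord r).
  by rewrite rev_chain cr.
by rewrite col_rev rq opprK.
Qed.

Lemma extra_target r q : extra r q -> ch q = - ch r.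
Proof. by case/extraP => -> _ /rev_chain. Qed.

Lemma clean_target p q : 0 <= ch q -> (forall r, extra p r -> Z r q = 0) -> clean p q.
Proof.
move=> cq H; split=> // r er; have := extra_target er.
by case: (extraP er) => _ cr _ _ crq; lia.
Qed.

Lemma clean_opp p q : ch p < 0 -> 0 < ch q -> clean p q.
Proof.
by move=> cp cq; apply: clean_target => [|r /extraP[_ cp' _ _]]; lia.
Qed.

Lemma col0_rev w : ch w < 0 -> col w = 0 -> forall q, ch q = - ch w -> col q = 0 ->
  q = rev_ord w.
Proof.
move=> cw w0 q cq q0; apply: col_ch_inj; first by rewrite col_rev w0 q0 oppr0.
by rewrite rev_chain //; apply/meets_colP; exists w.
Qed.

(* The commutator equation at (w, w-bar) relates two entries of Z that the
   symplectic symmetry makes equal, with the opposite sign. *)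
Lemma middle_eq0 w w' : ch w < 0 -> col w = 0 -> next_in_row w w' -> Z w' (rev_ord w) = 0.
Proof.
move=> cw w0 nw; have mw : meets (ch w) 0 by apply/meets_colP; exists w.
have [cw' w'w _] := next_in_rowP nw; have nr := next_rev mw nw.
have cr : ch (rev_ord w) = - ch w by apply: rev_chain.
have [c1 c2] : clean w (rev_ord w) by apply: clean_opp; lia.
have := @comm_eq w (rev_ord w); rewrite col_rev w0 oppr0 lexx => /(_ isT).
rewrite (bigD1 (rev_ord w')) //= big1 => [|r rr]; last first.
  have [/c1->|er] := boolP (extra r (rev_ord w)); first by rewrite mul0r.
  by rewrite X_eq0 ?mulr0 //; apply: contra rr => nr'; rewrite (prev_uniq nr' nr).
rewrite (bigD1 w') //= big1 => [|r rr]; last first.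
  have [/c2->|er] := boolP (extra w r); first by rewrite mulr0.
  by rewrite X_eq0 ?mul0r //; apply: contra rr => nr'; rewrite (next_uniq nr' nw).
rewrite !addr0 => E.
have := (sadj_skewP _).1 sZ w (rev_ord w'); rewrite rev_ordK => ZE.
have := (sadj_skewP _).1 sX w w'; rewrite -/(X _ _) => XE.
rewrite lsign_rev in ZE; rewrite XE ZE in E *.
have zero : X w w' * - (lsign k w * - lsign k w' * Z w (rev_ord w')) = 0.
  by apply: (two_eq0 char_k); rewrite -{1}E; ring.
by move/eqP: zero; rewrite mulf_eq0 (negPf (X_neq0 nw)) => /eqP.
Qed.

(** The additional arrow from u to w' makes [Z w' q] appear in the equation at (u, q). The other
    terms contain [Z v q], with v the middle vertex, or entries [Z u r]; these pairs lie in the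
    upper row, where descending and ascending give 0. *)
Lemma far_eq0 w w' q : ch w < 0 -> col w = 0 -> next_in_row w w' -> ch q = - ch w ->
  extra (rev_ord w') w' -> 0 < col q -> Z w' q = 0.
Proof.
move=> cw w0 nw cq ex q0; have mw : meets (ch w) 0 by apply/meets_colP; exists w.
have [cw' w'w _] := next_in_rowP nw; have nr := next_rev mw nw.
set u := rev_ord w' in ex nr; set v := rev_ord w in nr.
have cu : ch u = - ch w by rewrite /u rev_chain cw'.
have v0 : col v = 0 by rewrite /v col_rev w0 oppr0.
have [cv vu mu] := next_in_rowP nr.
have ex_u p r : ch p = - ch w -> extra p r -> p = u.
  move=> cp er; have [_ _ _ [t nt t0]] := extraP er.
  have tv : t = v.
    by apply: col_ch_inj; rewrite ?t0 ?v0 //; case: (next_in_rowP nt) => -> _ _; rewrite cv cu cp.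
  by apply: prev_uniq nr; rewrite -tv.
have uq : col u <= col q.
  by rewrite leNgt; apply/negP => /(mu q); rewrite cq cu v0 => /(_ erefl); lia.
have u0 : 0 < col u by rewrite -v0.
have clean_u r t : ch r = - ch w -> ch t = - ch w -> r != u -> clean r t.
  move=> cr ct ru; apply: clean_target => [|r' /(ex_u _ _ cr) rE]; first by lia.
  by rewrite rE eqxx in ru.
have c1 r : extra r q -> Z u r = 0.
  by move=> er; have := extra_target er; case: (extraP er) => _ cr _ _; lia.
have up r : next_in_row r q -> Z u r = 0.
  move=> /next_in_rowP[cr qr _]; rewrite cq in cr; apply: ascend; first by lia.
    by move=> t ct _; rewrite cu cr -ct; apply/meets_colP; exists t.
  move=> t t' ct ct' ut _; apply: clean_u; [by rewrite ct| by rewrite ct' -cr| ].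
  by apply: contraTneq ut => ->; rewrite ltxx.
have vq : Z v q = 0.
  apply: descend; first by rewrite v0.
    by move=> t ct _; rewrite cq -cu -cv -ct; apply/meets_colP; exists t.
  move=> t t' ct ct' tv _; apply: clean_u; [by rewrite ct cv| by rewrite ct' cq| ].
  by apply: contraTneq tv => ->; rewrite -ltNge v0.
have := comm_eq uq; rewrite (sum_to c1 up) (bigD1 w') //= big1 ?addr0 => [|r rw'].
  have Xu : X u w' != 0 by rewrite X_arrows ex orbT.
  by move/esym/eqP; rewrite mulf_eq0 (negPf Xu) => /eqP.
have [nr'|nr'] := boolP (next_in_row u r); first by rewrite (next_uniq nr' nr) vq mulr0.
rewrite X_eq0 ?mul0r //; apply: contra rw' => /extraP[-> _ _ _].
by rewrite /u rev_ordK.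
Qed.

(* Without an extra arrow at most one positive column of the upper row is
   missing from the lower row; this is enough to ascend. *)
Lemma ascend_almost_nested p q : ch p < 0 -> ch q = - ch p -> meets (ch p) 0 ->
  (forall r r', ch r = ch q -> ch r' = ch q -> 0 < col r -> 0 < col r' ->
    ~~ meets (ch p) (col r) -> ~~ meets (ch p) (col r') -> r = r') ->
  col p < col q -> 0 < col q ->
  (exists2 r, ch r = ch q & col p < col r < col q) ->
  Z p q = 0.
Proof.
move=> cp cq mp almost; have cq0 : 0 < ch q by lia.
have mq : meets (ch q) 0 by rewrite cq; apply: meets_opp.
have low r : ch r = ch q -> col r <= 0 -> meets (ch p) (col r).
  by move=> cr r0; have := @lower_half r; rewrite cr => /(_ cq0 mq r0); rewrite cq opprK.
have {almost} uniq_out r r' : ch r = ch q -> ch r' = ch q ->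
    ~~ meets (ch p) (col r) -> ~~ meets (ch p) (col r') -> r = r'.
  move=> cr cr' mr mr'; apply: almost => //.
    by rewrite ltNge; apply: contra mr; apply: low.
  by rewrite ltNge; apply: contra mr'; apply: low.
elim/col_gt_ind: p q cp cq mp cq0 mq low uniq_out => p IH q cp cq mp cq0 mq low uniq_out pq q0.
move=> [r cr /andP[pr rq]].
have [mr|mr] := boolP (meets (ch p) (col r)); last first.
  apply: ascend => // [t ct qt|t t' ct ct' _ _]; last by apply: clean_opp; lia.
  by apply: contraT => mt; move: rq; rewrite (uniq_out r t cr ct mr mt); lia.
have /meets_colP[r1 cr1 r1r] := mr.
have [p1 np p1r] := prev_exists cr1 (eq_ind_r (fun c => col p < c) pr r1r).
have [cp1 p1p _] := next_in_rowP np.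
apply: (step_up np); [lia | by apply: clean_opp; lia | move=> q' nq].
have [cq' q'q _] := next_in_rowP nq.
apply: IH; rewrite -?cp1 -?cq' //; try lia.
by exists q; [rewrite cq' | lia].
Qed.

(** Both vertices move right until p is next to the middle column. There a q in the middle is
    settled by the skew symmetry, a q beyond it by the additional arrow or by near-nestedness. *)
Lemma lower_to_upper_right p q : ch p < 0 -> ch q = - ch p -> meets (ch p) 0 ->
  col p < 0 -> 0 <= col q -> Z p q = 0.
Proof.
move=> cp + mp; have [w cw w0] := meets_colP _ _ mp.
elim/col_gt_ind: p q cp cw mp => p IH q cp cw mp cq p0 q0.
have [p1 np p1w] := prev_exists cw (eq_ind_r (fun c => col p < c) p0 w0).
have [cp1 p1p mp1] := next_in_rowP np.
have [pw|pw] := eqVneq p1 w.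
  rewrite pw in np cp1 {p1w p1p mp1} => {p1 pw IH}.
  have [q0'|qn0] := eqVneq (col q) 0.
    by rewrite (col0_rev _ w0 (q := q)) ?middle_eq0 ?cw ?cp1 //; rewrite -?cw -?cp1.
  have qpos : 0 < col q by rewrite lt_def qn0.
  have nr := next_rev (etrans (congr1 (meets ^~ 0) cw) mp) np.
  have cr : ch (rev_ord p) = ch q by rewrite rev_chain.
  have rw0 : col (rev_ord w) = 0 by rewrite col_rev w0 oppr0.
  have crpos : 0 < ch (rev_ord p) by rewrite cr cq; lia.
  have [ex|almost] := extra_or_almost_nested crpos nr rw0.
    rewrite rev_ordK in ex; apply: far_eq0 np _ ex qpos => //; first by rewrite cw.
    by rewrite cw.
  apply: ascend_almost_nested => //; first 1 last.
  - by lia.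
  - by exists (rev_ord w); rewrite ?rw0 ?p0 // rev_chain ?cw.
  - by move=> r r'; have := almost r r'; rewrite cr cq opprK.
have p10 : col p1 < 0.
  rewrite -w0 lt_def p1w andbT; apply: contra pw => /eqP E.
  by apply/eqP/col_ch_inj; rewrite ?E // -cp1 cw.
apply: (step_up np); [lia | by apply: clean_opp; lia | move=> q' nq].
have [cq' q'q _] := next_in_rowP nq.
by apply: IH; rewrite -?cp1 -?cq' //; lia.
Qed.

(** The lower row meets all columns <= 0 of the upper row, and the upper row all columns >= 0 of the
    lower one. A pair on one side can thus be moved towards the middle until it straddles it. *)
Lemma lower_to_upper p q : ch p < 0 -> ch q = - ch p -> meets (ch p) 0 ->
  col p < col q -> Z p q = 0.
Proof.
move=> cp cq mp; have cq0 : 0 < ch q by lia.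
have mq : meets (ch q) 0 by rewrite cq; apply: meets_opp.
have [p0|p0] := ltP (col p) 0.
  have [q0|q0 _] := ltP (col q) 0; last exact: lower_to_upper_right.
  elim/col_gt_ind: p q cp cq mp cq0 mq p0 q0 => p IH q cp cq mp cq0 mq p0 q0 pq.
  have := lower_half cq0 mq (ltW q0); rewrite cq opprK => /meets_colP[r cr rq].
  have [p1 np p1r] := prev_exists cr (eq_ind_r (fun c => col p < c) pq rq).
  have [cp1 p1p _] := next_in_rowP np.
  apply: (step_up np); [lia | by apply: clean_opp; lia | move=> q' nq].
  have [cq' q'q _] := next_in_rowP nq.
  have [q'0|q'0] := ltP (col q') 0; first by apply: IH; rewrite -?cp1 -?cq' //; lia.
  by apply: lower_to_upper_right; rewrite -?cp1 -?cq' //; lia.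
elim/col_lt_ind: p q cp cq mp cq0 mq p0 => p IH q cp cq mp cq0 mq p0 pq.
have := upper_half cp mp p0; rewrite -cq => /meets_colP[r cr rp].
have [q' nq rq'] := next_exists cr (eq_ind_r (fun c => c < col q) pq rp).
have [cq' q'q _] := next_in_rowP nq.
apply: (step_down nq); [lia | by apply: clean_opp; lia | move=> p' np].
have [cp' p'p _] := next_in_rowP np.
have [p'0|p'0] := ltP (col p') 0.
  by apply: lower_to_upper_right; rewrite ?cp' ?cq' //; lia.
by apply: IH; rewrite ?cp' ?cq' //; lia.
Qed.

Lemma clean_pairs_eq0 p q : col p < col q ->
  (forall r t, ch r = ch p -> ch t = ch q -> col r <= col t -> clean r t) ->
  Z p q = 0.
Proof.
move=> pq cl; have [sub|sub|[]] := nested_ends pq.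
- by apply: descend => // r t cr ct _; apply: cl.
- by apply: ascend => // r t cr ct _; apply: cl.
- by move=> cp cq mp; apply: lower_to_upper.
Qed.

Theorem centralizer_lowers : lowers col 0 Z.
Proof.
pose from c := [exists p, exists q, extra p q && (ch p == c)].
have fromP p q : extra p q -> from (ch p).
  by move=> e; apply/existsP; exists p; apply/existsP; exists q; rewrite e eqxx.
have from_gt0 c : from c -> 0 < c.
  by case/existsP => p /existsP[q /andP[/extraP[_ cp _ _] /eqP <-]].
have col_gt0 p q : extra p q -> 0 < col p /\ col q = - col p.
  move=> /extraP[-> _ _ [r nr r0]]; split; last by rewrite col_rev.
  by have [_ + _] := next_in_rowP nr; rewrite r0.
(* An extra arrow from u to u-bar perturbs the equations of the pairs that
   start in the chain of u or end in that of u-bar, by entries of Z that start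
   in the chain of u-bar or end in that of u. *)
have stageA p q : ~~ from (ch p) -> ~~ from (- ch q) -> col p < col q -> Z p q = 0.
  move=> fp fq pq; apply: clean_pairs_eq0 => // r t cr ct rt; split=> t' e.
    by move: (fromP _ _ e) fq; rewrite -ct (extra_target e) opprK => ->.
  by move: (fromP _ _ e) fp; rewrite cr => ->.
have stageB p q : ~~ from (- ch q) -> col p < col q -> Z p q = 0.
  move=> fq pq; apply: clean_pairs_eq0 => // r t cr ct rt; split=> t' e.
    by move: (fromP _ _ e) fq; rewrite -ct (extra_target e) opprK => ->.
  have [r0 t'r] := col_gt0 _ _ e; apply: stageA; rewrite ?ct //; last by lia.
  by apply/negP => /from_gt0; have := from_gt0 _ (fromP _ _ e); rewrite (extra_target e); lia.
have stageC p q : ~~ from (ch p) -> col p < col q -> Z p q = 0.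
  move=> fp pq; apply: clean_pairs_eq0 => // r t cr ct rt; split=> t' e.
    have [r0 t'r] := col_gt0 _ _ e; apply: stageA; rewrite ?cr //; last by lia.
    by apply/negP => /from_gt0; have := from_gt0 _ (fromP _ _ e); lia.
  by move: (fromP _ _ e) fp; rewrite cr => ->.
move=> p q; rewrite addr0 => pq; apply: clean_pairs_eq0 => // r t cr ct rt; split=> t' e.
  have [r0 t'r] := col_gt0 _ _ e; apply: stageB; last by lia.
  by apply/negP => /from_gt0; have := from_gt0 _ (fromP _ _ e); lia.
have [r0 t'r] := col_gt0 _ _ e; apply: stageC; last by lia.
by apply/negP => /from_gt0; have := from_gt0 _ (fromP _ _ e); rewrite (extra_target e); lia.
Qed.

End Chains.

(** * The decomposition of a dimension vector *)

Lemma mem_columns s (i : int) : (i \in columns s) = (`|i| <= s%:Z).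
Proof.
apply/mapP/idP => [[t + ->]|si]; first by rewrite mem_iota; lia.
by exists (absz (i + s%:Z)); rewrite ?mem_iota; lia.
Qed.

Lemma In_rcons (T : Type) (L : seq T) (x y : T) :
  List.In y (rcons L x) <-> List.In y L \/ y = x.
Proof.
elim: L => [|z L IHL] /=; first by split=> [[]|[]] //; auto.
by split=> [[|/IHL[]]|[[|?]|?]]; auto; right; apply/IHL; auto.
Qed.

Lemma In_nth (T : Type) (x0 : T) (L : seq T) a : (a < size L)%N -> List.In (nth x0 L a) L.
Proof. by elim: L a => [|x L IHL] [|a] //=; [left | move=> aL; right; apply: IHL]. Qed.

Section Decomposition.

Variables (s : nat) (d : int -> nat).
Hypothesis d_out : forall i : int, s%:Z < `|i| -> d i = 0%N.
Hypothesis d_sym : forall i : int, d (- i) = d i.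
Hypothesis d0_even : ~~ odd (d 0%R).
Implicit Types (f g c : int -> nat) (L : seq (int -> nat)) (i : int).

Definition symmetric_vec f : Prop := forall i, f (- i) = f i.

(* Every vector produced by the procedure is a nondecreasing function of the
   entries of d away from the middle column, so that all level sets are nested. *)
Definition monotone_vec f : Prop :=
  forall i j, i != 0 -> j != 0 -> (d i <= d j)%N -> (f i <= f j)%N.

(** The last clause keeps Case 1 of the small diagrams for d^0 alone. *)
Definition block_ok f : Prop :=
  [/\ symmetric_vec f, monotone_vec f, forall i, (f i <= 2)%N,
      f 0 = 0%N \/ f 0 = 2%N & f 0 = 0%N -> exists i, f i = 2%N].

Definition row_ok f : Prop :=
  [/\ symmetric_vec f, monotone_vec f, forall i, (f i <= 1)%N & f 0 = 0%N].

Definition inside g f : Prop := forall i, i != 0 -> (0 < g i)%N -> f i = 2%N.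

Definition ordered_blocks L : Prop :=
  forall a b, (a < b < size L)%N ->
    let f := nth (fun=> 0%N) L a in let g := nth (fun=> 0%N) L b in
    (f 0 = 2%N -> inside g f) /\ (g 0 = 2%N -> f 0 = 2%N).

Definition block_sum L i : nat := sumn [seq f i | f <- L].

(** By [inv_parity] the odd case occurs at most once: afterwards all remaining entries are even, and
    every further block keeps them even. By [inv_order] and [inv_inside], d^0 and all that is drawn
    after a block through the middle lie, off the middle column, over columns where that block has
    two vertices. *)
Record invariant (f0 : int -> nat) L c : Prop := Invariant {
  inv_sum : forall i, (f0 i + block_sum L i + c i = d i)%N;
  inv_row : row_ok f0;
  inv_blocks : forall f, List.In f L -> block_ok f;
  inv_mono : monotone_vec c;
  inv_even : ~~ odd (c 0%R);
  inv_parity : (forall i, f0 i = 0%N) \/ (forall i, ~~ odd (c i)) /\ c 0 = 0%N;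
  inv_order : ordered_blocks L;
  inv_inside : forall f, List.In f L -> f 0 = 2%N -> inside c f /\ inside f0 f;
  inv_middle : (0 < c 0%R)%N -> forall f, List.In f L -> f 0 = 2%N }.

Lemma block_sum_rcons L f i : block_sum (rcons L f) i = (block_sum L i + f i)%N.
Proof. by rewrite /block_sum map_rcons -cats1 sumn_cat /= addn0. Qed.

Lemma remainderE f0 L c : (forall i, (f0 i + block_sum L i + c i = d i)%N) ->
  forall i, remainder d (f0, L) i = c i.
Proof. by move=> H i; rewrite /remainder /= -/(block_sum L i) -(H i) addKn. Qed.

Section AddBlock.

Variables (f0 : int -> nat) (L : seq (int -> nat)) (c f : int -> nat).
Hypothesis inv : invariant f0 L c.
Hypothesis f_le : forall i, (f i <= c i)%N.
Hypothesis f_ok : block_ok f.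
Hypothesis c_mono : monotone_vec (fun i => (c i - f i)%N).
Hypothesis f_inside : f 0 = 2%N -> inside (fun i => (c i - f i)%N) f.
Hypothesis f_parity : (forall i, ~~ odd (c i)) -> forall i, ~~ odd (f i).
Hypothesis f_middle : (0 < c 0%R)%N -> f 0 = 2%N.

Lemma invariant_add_block : invariant f0 (rcons L f) (fun i => (c i - f i)%N).
Proof.
have [sum row blocks mono even par ord ins mid] := inv.
have f0c : f 0 = 2%N -> (0 < c 0%R)%N by move=> f02; have := f_le 0; rewrite f02; lia.
split=> //.
- by move=> i; rewrite block_sum_rcons -(sum i); have := f_le i; lia.
- by move=> g /In_rcons[/blocks|->].
- have [_ _ _ [->|f02] _] := f_ok; first by rewrite subn0.
  by rewrite f02; have := f_le 0; rewrite f02 => c2; rewrite oddB // (negPf even).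
- case: par => [|[evenc c0]]; [by left | right].
  split=> [i|]; last by rewrite c0.
  by rewrite oddB // (negPf (evenc i)) (negPf (f_parity evenc i)).
- move=> a b /andP[ab]; rewrite size_rcons ltnS leq_eqVlt => /predU1P[bE|bL].
    rewrite !nth_rcons -bE ab ltnn eqxx /=.
    have InL := In_nth (fun=> 0%N) (_ : (a < size L)%N); rewrite -bE ab in InL.
    have {}InL := InL isT; split=> [g02|/f0c/mid->//].
    have [insc _] := ins _ InL g02.
    by move=> i i0 fi; apply: insc => //; apply: leq_trans fi _.
  rewrite !nth_rcons bL (ltn_trans ab bL); apply: ord; exact/andP.
- move=> g /In_rcons[/ins H /H[insc insf0]|->].
    by split=> // i i0 ci; apply: insc => //; lia.
  move=> f02; split; first exact: f_inside.
  case: par => [f00|[_ c0]]; first by move=> i _; rewrite f00.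
  by have := f0c f02; rewrite c0.
- move=> /= c0 g /In_rcons[|->]; first by apply: mid; lia.
  by apply: f_middle; lia.
Qed.

End AddBlock.

Lemma invariant_ext f0 L c c' : c =1 c' -> invariant f0 L c -> invariant f0 L c'.
Proof.
move=> E [sum row blocks mono even par ord ins mid]; split=> //.
- by move=> i; rewrite -E.
- by move=> i j; rewrite -!E; apply: mono.
- by rewrite -E.
- by case: par => [|[ev c0]]; [left | right; split=> [i|]; rewrite -E].
- move=> f Lf f2; have [insc insf] := ins f Lf f2; split=> // i i0.
  by rewrite -E; apply: insc.
- by rewrite -E.
Qed.

Definition good_state (st : decomp_state) : Prop :=
  invariant st.1 st.2 (remainder d st).

Definition leftover (st : decomp_state) : nat :=
  sumn [seq remainder d st i | i <- columns s].

Lemma invariant_good f0 L c : invariant f0 L c -> good_state (f0, L).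
Proof.
by move=> good; apply: (invariant_ext _ good) => i; rewrite (remainderE (inv_sum good)).
Qed.

Section Step.

Variable st : decomp_state.
Hypothesis good : good_state st.
Let c := remainder d st.

Lemma remainder_sym : symmetric_vec c.
Proof.
move=> i; have [sum [f0_sym _ _ _] blocks _ _ _ _ _ _] := good.
have totE : block_sum st.2 (- i) = block_sum st.2 i.
  elim: st.2 blocks => [|f L IHL] blocks //; rewrite /block_sum /= -!/(block_sum L _).
  rewrite IHL => [|g Lg]; last by apply: blocks; right.
  by have [-> _ _ _ _] := blocks f (or_introl erefl).
by rewrite /c /remainder -!/(block_sum _ _) totE d_sym f0_sym.
Qed.

Lemma remainder_out i : i \notin columns s -> c i = 0%N.
Proof.
rewrite mem_columns => si; have := inv_sum good i; rewrite d_out; last by lia.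
by rewrite -/c; lia.
Qed.

Let add_block f :
    (forall i, (f i <= c i)%N) -> (forall i, (0 < c i)%N -> (0 < f i)%N) ->
    block_ok f -> monotone_vec (fun i => (c i - f i)%N) ->
    (f 0 = 2%N -> inside (fun i => (c i - f i)%N) f) ->
    ((forall i, ~~ odd (c i)) -> forall i, ~~ odd (f i)) ->
    ((0 < c 0%R)%N -> f 0 = 2%N) ->
  good_state (st.1, rcons st.2 f) /\
  forall i, (remainder d (st.1, rcons st.2 f) i <= (c i).-1)%N.
Proof.
move=> f_le f_pos f_ok c_mono f_in f_par f_mid.
have inv' := invariant_add_block good f_le f_ok c_mono f_in f_par f_mid.
split=> [|i]; first exact: invariant_good inv'.
by rewrite (remainderE (inv_sum inv')) /= -/c; have := f_pos i; lia.
Qed.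

(** Subtracting 1 from the positive entries below a threshold and 2 from the others preserves their
    order, so monotonicity passes to the remainder. The bound by the predecessor is what makes the
    procedure end in time. *)
Lemma decomp_step_good : good_state (decomp_step s d st) /\
  forall i, (remainder d (decomp_step s d st) i <= (c i).-1)%N.
Proof.
have [sum row blocks mono even par ord ins mid] := good.
have csym := remainder_sym; have cout := remainder_out.
rewrite /decomp_step -/c; case: ifP => [/allP c_eq0|/negbT/allPn[i1 i1s c1]].
  split=> // i; rewrite -/c; have [/c_eq0/eqP->//|/cout->//] := boolP (i \in columns s).
case: ifP => [c0|/negbT]; first last.
  rewrite -leqNgt leqn0 => /eqP c0.
  case: ifP => [/allP ge2|/negbT/allPn[i2 i2s]].
    have {}ge2 i : c i != 0%N -> (2 <= c i)%N.
      move=> ci; have [/ge2/orP[ci0|//]|/cout ci0] := boolP (i \in columns s).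
        by rewrite ci0 in ci.
      by rewrite ci0 in ci.
    apply: add_block => /=.
    - by move=> i; case: eqP => // /eqP/ge2.
    - by move=> i; rewrite lt0n; case: eqP.
    - split=> [i|i j i0 j0 ij|i||_].
      + by rewrite csym.
      + have := mono i j i0 j0 ij; rewrite -/c; case: eqP => // ci; case: eqP => // cj.
        by rewrite cj leqn0 => /eqP.
      + by case: ifP.
      + by rewrite c0; left.
      + by exists i1; rewrite (negPf c1).
    - move=> i j i0 j0 ij; have := mono i j i0 j0 ij; rewrite -/c.
      by case: eqP => // ci; case: eqP => // cj; lia.
    - by rewrite c0.
    - by move=> ev i; case: ifP.
    - by rewrite c0.
  rewrite negb_or -ltnNge => /andP[ci20 ci2].
  set evens := [seq c i | i <- columns s & (0 < c i)%N && ~~ odd (c i)].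
  have evensP t : reflect (exists2 i, c i = t & (0 < t)%N && ~~ odd t) (t \in evens).
    apply: (iffP mapP) => [[i + ->]|[i <- ci]].
      by rewrite mem_filter => /andP[ci _]; exists i.
    exists i => //; rewrite mem_filter ci /=.
    by apply: contraTT ci => /cout ->.
  case E : evens => [|t0 ts].
    have odd_c i : (0 < c i)%N -> odd (c i).
      move=> ci; apply: contraT => nodd.
      suff : c i \in evens by rewrite E.
      by apply/evensP; exists i => //; rewrite ci nodd.
    (* An odd entry is left, so by the parity clause d^0 is still 0 and may be overwritten. *)
    have f00 i : st.1 i = 0%N.
      case: par => [->//|[ev _]].
      have := odd_c i1; rewrite lt0n c1 => /(_ isT); by rewrite (negPf (ev i1)).
    suff inv' : invariant (fun i => if c i == 0%N then 0%N else 1%N) st.2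
        (fun i => (c i - (if c i == 0 then 0 else 1))%N).
      split=> [|i]; first exact: invariant_good inv'.
      by rewrite (remainderE (inv_sum inv')) /=; case: eqP => ?; lia.
    split=> //= [i||||||].
    - by have := sum i; rewrite f00 -/c; case: eqP => ? /=; lia.
    - split=> [i|i j i0 j0 ij|i|]; rewrite ?c0 //.
      + by rewrite csym.
      + have := mono i j i0 j0 ij; rewrite -/c.
        by case: eqP => // ci; case: eqP => // cj; lia.
      + by case: ifP.
    - move=> i j i0 j0 ij; have := mono i j i0 j0 ij; rewrite -/c.
      by case: eqP => // ci; case: eqP => // cj; lia.
    - by rewrite c0.
    - right; split=> [i|]; last by rewrite c0.
      case: eqP => [->//|/eqP]; rewrite -lt0n => ci.
      by rewrite oddB // (odd_c i ci).
    - move=> f Lf f02; have [insc _] := ins f Lf f02.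
      split=> i i0 fi; apply: insc => //; rewrite -/c; first by apply: leq_trans fi (leq_subr _ _).
      by case: (posnP (c i)) fi => // ->.
    - by rewrite c0.
  rewrite -E; set a := head _ _.
  have a_in : a \in evens.
    rewrite -(mem_sort leq) /a; case E' : (sort leq evens) => [|a' t']; last exact: mem_head.
    by have := size_sort leq evens; rewrite E' E.
  have a_min t : t \in evens -> (a <= t)%N.
    rewrite -(mem_sort leq) /a; have := sort_sorted leq_total evens.
    case: (sort leq evens) => [//|a' t'] /= /(order_path_min leq_trans)/allP Ha.
    by rewrite inE => /predU1P[->//|/Ha].
  have /evensP[ia ca /andP[a0 a_even]] := a_in.
  (* The number a is the least positive even entry. If all entries are even, the block therefore has
     no entry 1. *)
  have small i : (0 < c i)%N -> (c i < a)%N -> odd (c i).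
    move=> ci; apply: contraLR => nodd; rewrite -leqNgt; apply: a_min.
    by apply/evensP; exists i => //; rewrite ci nodd.
  have a2 : (2 <= a)%N by case: (a) a0 a_even => [|[]].
  apply: add_block => /=.
  - move=> i; case: eqP => // /eqP; rewrite -lt0n => ci; case: ltnP => // ai; exact: leq_trans ai.
  - by move=> i; rewrite lt0n; case: eqP => // ? _; case: ifP.
  - split=> [i|i j i0 j0 ij|i||_].
    + by rewrite csym.
    + have := mono i j i0 j0 ij; rewrite -/c; case: eqP => // ci; case: eqP => [->|cj].
        by rewrite leqn0 => /eqP.
      by case: (ltnP (c i) a) => ?; case: (ltnP (c j) a) => ? //; lia.
    + by case: ifP => //; case: ifP.
    + by rewrite c0; left.
    + by exists ia; rewrite ca ltnn; case: eqP a0 => // ->.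
  - move=> i j i0 j0 ij; have := mono i j i0 j0 ij; rewrite -/c.
    have := small i; case: eqP => [->//|/eqP]; rewrite -lt0n => ci.
    case: eqP => [->|cj]; first by move=> _; lia.
    case: (ltnP (c i) a) => ai; case: (ltnP (c j) a) => aj; lia.
  - by rewrite c0.
  - move=> ev i; case: eqP => // /eqP; rewrite -lt0n => ci; case: ltnP => // ai.
    by have := small i ci ai; rewrite (negPf (ev i)).
  - by rewrite c0.
have c2 : (2 <= c 0%R)%N.
  by have := even; rewrite -/c; case: (c 0) c0 => [|[]].
apply: add_block => /=.
- by move=> i; rewrite geq_minl.
- by move=> i ci; rewrite leq_min ci.
- split=> [i|i j i0 j0 ij|i||].
  + by rewrite csym.
  + by have := mono i j i0 j0 ij; rewrite -/c; lia.
  + by rewrite geq_minr.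
  + by right; lia.
  + by lia.
- by move=> i j i0 j0 ij; have := mono i j i0 j0 ij; rewrite -/c; lia.
- by move=> _ i i0 /=; lia.
- by move=> ev i; have := ev i; case: (c i) => [|[|m]] //=; rewrite (minn_idPr _).
- by lia.
Qed.

Lemma decomp_step_decreases : (leftover (decomp_step s d st) <= (leftover st).-1)%N.
Proof.
have [_ less] := decomp_step_good; rewrite /leftover -/c.
elim: (columns s) => [|i t IHt] //=; have := less i; lia.
Qed.

End Step.

Lemma iter_decomp_step t :
  let st := iter t (decomp_step s d) (fun=> 0%N, [::]) in
  good_state st /\ (leftover st <= sumn [seq d i | i <- columns s] - t)%N.
Proof.
elim: t => [|t [good less]] /=.
  have E : remainder d (fun=> 0%N, [::]) =1 d by move=> i; rewrite /remainder /= subn0.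
  split; last by rewrite /leftover (eq_map E) subn0.
  by apply: (@invariant_good _ _ d); split=> //=; [left | move=> a b; rewrite andbF].
split; first by have [] := decomp_step_good good.
by rewrite subnS; apply: leq_trans (decomp_step_decreases good) _; rewrite -!subn1 leq_sub2r.
Qed.

Lemma decomposition_good : good_state (decomposition s d).
Proof. by have [] := iter_decomp_step (sumn [seq d i | i <- columns s]). Qed.

Lemma decomposition_sum i :
  ((decomposition s d).1 i + block_sum (decomposition s d).2 i = d i)%N.
Proof.
have [] := iter_decomp_step (sumn [seq d i | i <- columns s]).
rewrite -/(decomposition s d) subnn leqn0 => good /eqP left0.
have zero : remainder d (decomposition s d) i = 0%N.
  have [si|/(remainder_out good)->//] := boolP (i \in columns s).
  move: left0; rewrite /leftover; elim: (columns s) si => // a t IHt.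
  rewrite inE /= => ia /eqP; rewrite addn_eq0 => /andP[/eqP za /eqP zt].
  by case/predU1P: ia => [->|/IHt->].
by rewrite -[RHS](inv_sum good i) zero addn0.
Qed.

(* The vectors d^0, d^1, .., d^m, followed by zeros. *)
Definition block_vec (j : nat) : int -> nat :=
  if j is j'.+1 then nth (fun=> 0%N) (decomposition s d).2 j' else (decomposition s d).1.

Local Notation B := block_vec.

Lemma block_vec_out j : (size (decomposition s d).2 < j)%N -> B j = fun=> 0%N.
Proof. by case: j => // j; rewrite ltnS => jm; rewrite /B nth_default. Qed.

Lemma block_vec_ok j : (0 < j)%N -> (B j = fun=> 0%N) \/ block_ok (B j).
Proof.
case: j => // j _; have [jm|jm] := ltnP j (size (decomposition s d).2).
  by right; apply: (inv_blocks decomposition_good); apply: In_nth.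
by left; rewrite block_vec_out.
Qed.

Lemma row0_ok : row_ok (B 0).
Proof. exact: inv_row decomposition_good. Qed.

Lemma block_vec_sym j i : B j (- i) = B j i.
Proof.
case: j => [|j]; first by have [-> _ _ _] := row0_ok.
by have [->|[-> _ _ _ _]] := @block_vec_ok j.+1 isT.
Qed.

Lemma block_vec_mono j : monotone_vec (B j).
Proof.
case: j => [|j]; first by have [_ ? _ _] := row0_ok.
by have [->|[]] := @block_vec_ok j.+1 isT.
Qed.

Lemma block_vec_le2 j i : (B j i <= 2)%N.
Proof.
case: j => [|j]; first by have [_ _ H _] := row0_ok; apply: leq_trans (H i) _.
by have [->|[_ _ H _ _]] := @block_vec_ok j.+1 isT.
Qed.

Lemma block_vec_middle j : B j 0 = 0%N \/ B j 0 = 2%N.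
Proof.
case: j => [|j]; first by have [_ _ _ ->] := row0_ok; left.
by have [->|[_ _ _ H _]] := @block_vec_ok j.+1 isT; [left|].
Qed.

Lemma block_vec_two j : (0 < j <= size (decomposition s d).2)%N -> B j 0 = 0%N ->
  exists i, B j i = 2%N.
Proof.
case: j => // j /= jm.
by have [_ _ _ _ H] := inv_blocks decomposition_good (In_nth (fun=> 0%N) jm).
Qed.

Lemma block_vec_supp j i : s%:Z < `|i| -> B j i = 0%N.
Proof.
move=> si; have := decomposition_sum i; rewrite d_out //.
case: j => [|j] /=; first by lia.
have [jm|jm _] := ltnP j (size (decomposition s d).2); last by rewrite nth_default.
rewrite /block_sum => /eqP; rewrite addn_eq0 => /andP[_]; rewrite sumnE big_map.
elim: (_.2) j jm => // f L IHL [|j] jm; rewrite big_cons addn_eq0 => /andP[/eqP ? E] //=.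
exact: IHL.
Qed.

(** Blocks are compared in the order of their creation; whatever precedes a block through the middle
    column passes through it too. *)
Lemma block_vec_nested j j' : B j 0 = 2%N -> j != j' ->
  inside (B j') (B j) \/ (B j' 0 = 2%N /\ inside (B j) (B j')).
Proof.
have [_ _ _ r0] := row0_ok; case: j => [|j] j2; first by rewrite r0 in j2.
have jm : (j < size (decomposition s d).2)%N.
  by rewrite ltnNge; apply/negP => jm; move: j2; rewrite /B nth_default.
case: j' => [_|j' jj'].
  left; have [_ _ _ _ _ _ _ H _] := decomposition_good.
  by have [] := H _ (In_nth (fun=> 0%N) jm) j2.
have [j'm|j'm] := ltnP j' (size (decomposition s d).2); last first.
  by left; rewrite /B [nth _ _ j']nth_default // => i _.
have ord := inv_order decomposition_good.
have [lt|gt|E] := ltngtP j j'; last by rewrite E eqxx in jj'.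
  by left; have [H _] := ord j j' (introT andP (conj lt j'm)); apply: H.
have [H1 H2] := ord j' j (introT andP (conj gt jm)).
by right; split; [exact: H2 | apply: H1; exact: H2].
Qed.

End Decomposition.

(** * The line diagram *)

(** The function [chain] takes the place of the height, so that the same notion serves rows and
    chains. *)
Definition next_vertex (V : seq vertex) (chain : vertex -> int) (v w : vertex) : bool :=
  [&& v \in V, w \in V, chain w == chain v, w.1 < v.1
    & all (fun u => ~~ ((chain u == chain v) && (w.1 < u.1 < v.1))) V].

Lemma mem_row_arrows V ex v w :
  ((v, w) \in row_arrows V ex) = (v \notin ex) && next_vertex V snd v w.
Proof.
rewrite mem_filter /= /left_neighbour /next_vertex.
have -> : ((v, w) \in [seq (v, w) | v <- V, w <- V]) = (v \in V) && (w \in V).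
  by apply/allpairsP/andP => [[[a b] /= [? ? [-> ->]]]|[vV wV]] //; exists (v, w).
by case: (v \in V); case: (w \in V); rewrite ?andbF ?andbT //= eq_sym.
Qed.

Lemma next_vertexP V chain v w :
  reflect [/\ v \in V, w \in V, chain w = chain v, w.1 < v.1 &
    forall u, u \in V -> chain u = chain v -> w.1 < u.1 < v.1 -> false]
  (next_vertex V chain v w).
Proof.
apply: (iffP and5P) => [[vV wV /eqP cwv wv /allP none]|[vV wV cwv wv none]].
  by split=> // u uV cu uw; have := none u uV; rewrite cu eqxx uw.
split=> //; first exact/eqP.
by apply/allP => u uV; apply/negP => /andP[/eqP cu uw]; have := none u uV cu uw.
Qed.

Lemma mem_pos_columns s (i : int) : (i \in pos_columns s) = (0 < i <= s%:Z).
Proof.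
apply/mapP/idP => [[t + ->]|si]; first by rewrite mem_iota; lia.
by exists (absz i); rewrite ?mem_iota; lia.
Qed.

Lemma mem_line (I : seq int) (P : pred int) (h a b : int) :
  ((a, b) \in [seq (i, h) | i <- I & P i]) = [&& b == h, a \in I & P a].
Proof.
apply/mapP/and3P => [[i + [-> ->]]|[/eqP -> aI Pa]].
  by rewrite mem_filter => /andP[].
by exists a; rewrite // mem_filter Pa.
Qed.

Lemma mem_opp_line (I : seq int) (P : pred int) (h a b : int) :
  ((a, b) \in [seq (- i, h) | i <- I & P i]) = [&& b == h, - a \in I & P (- a)].
Proof.
apply/mapP/and3P => [[i + [-> ->]]|[/eqP -> aI Pa]].
  by rewrite mem_filter opprK => /andP[].
by exists (- a); rewrite ?opprK // mem_filter Pa.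
Qed.

Lemma sgz_same (a c : int) : a != 0 -> c != 0 -> (0 < a) = (0 < c) -> sgz a = sgz c.
Proof. by rewrite /sgz; case: (ltgtP a 0); case: (ltgtP c 0). Qed.

Lemma sgz_mul_inj (a b c : int) : a != 0 -> b * sgz a = c * sgz a -> b = c.
Proof. by move=> a0; apply: mulIf; rewrite sgz_eq0. Qed.

(** * Small diagrams in closed form *)

Section SmallDiagram.

Variables (s : nat) (f : int -> nat).
Hypothesis f_sym : forall i, f (- i) = f i.
Hypothesis f_le2 : forall i, (f i <= 2)%N.
Hypothesis f_supp : forall i : int, s%:Z < `|i| -> f i = 0%N.
Hypothesis f_mid : f 0 = 0%N \/ f 0 = 2%N.

Definition is_row : bool := all (fun i => (f i == 0%N) || (f i == 1%N)) (columns s).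
Definition is_double : bool := all (fun i => (f i == 0%N) || (f i == 2%N)) (columns s).

Lemma supp_columns i : f i != 0%N -> `|i| <= s%:Z.
Proof. by apply: contraNT; rewrite -ltNge => /f_supp ->. Qed.

(** Outside Case 1, the only vertex of a column with entry 1 is in the upper row to the right of the
    middle and in the lower row to its left: hence the sign condition. *)
Definition in_small (v : vertex) : bool :=
  if (f 0 != 2%N) && is_row then (v.2 == 0) && (f v.1 != 0%N)
  else (`|v.2| == 1) && ((f v.1 == 2%N) || (f v.1 == 1%N) && (0 < v.1 * v.2)).

(* The arrows other than [small_extra] join consecutive vertices of the chains,
   the level sets of this function. They are rows, except in Case 4, whose two
   additional arrows reconnect the rows crosswise in the middle. *)
Definition small_chain (v : vertex) : int :=
  if [|| f 0 == 2%N, is_row | is_double] then v.2 else v.2 * sgz v.1.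

(** For a = 1 and a = 2 these are the columns l and l' at which the additional arrows start. *)
Definition first_col (a : nat) : int := head 0 [seq i <- pos_columns s | (a <= f i)%N].

Definition small_extra (v w : vertex) : bool :=
  [&& f 0 == 2%N, (4 <= count (fun i => f i == 1%N) (columns s))%N,
      v == (first_col 1, 1) & w == (- first_col 1, -1)].

Lemma first_colP a i : 0 < i -> (0 < a)%N -> (a <= f i)%N ->
  [/\ 0 < first_col a, (a <= f (first_col a))%N & first_col a <= i].
Proof.
move=> i0 a0 ai.
have si : i \in [seq i <- pos_columns s | (a <= f i)%N].
  rewrite mem_filter ai mem_pos_columns i0 /=.
  have /supp_columns : f i != 0%N by rewrite -lt0n (leq_trans a0).
  by lia.
have srt : sorted <%R [seq i <- pos_columns s | (a <= f i)%N].
  apply: sorted_filter; first exact: lt_trans.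
  rewrite sorted_map; apply: sub_sorted (iota_ltn_sorted 1 s) => x y /=.
  by rewrite ltz_nat.
have mem z : z \in [seq i <- pos_columns s | (a <= f i)%N] -> 0 < z /\ (a <= f z)%N.
  by rewrite mem_filter mem_pos_columns => /andP[-> /andP[->]].
rewrite /first_col; case: [seq i <- _ | _] si srt mem => [//|z t] si srt mem.
have [z0 az] := mem z (mem_head _ _); split=> //=.
move: si; rewrite inE => /predU1P[->//|it]; apply: ltW.
by move: srt => /= /(order_path_min lt_trans)/allP/(_ i it).
Qed.

Lemma positive_one : f 0 = 2%N -> (0 < count (fun i => f i == 1%N) (columns s))%N ->
  exists2 i, 0 < i & f i = 1%N.
Proof.
move=> f0; rewrite -has_count => /hasP[i _ /eqP fi].
have [i0|i0|i0] := ltgtP i 0; last by rewrite i0 f0 in fi.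
  by exists (- i); [lia | rewrite f_sym].
by exists i.
Qed.

Lemma small_vertices v : (v \in vertices (small_diagram s f)) = in_small v.
Proof.
case: v => a b; rewrite /small_diagram /in_small -/is_row -/is_double.
have : forall i, (i \in 0 :: pos_columns s) = (0 <= i <= s%:Z).
  by move=> i; rewrite inE mem_pos_columns; lia.
cbv zeta; move: (0 :: pos_columns s) => nonneg nonnegE.
rewrite -/is_row -/is_double; move: (columns s) (mem_columns s) => cols colsE.
have fa := f_le2 a; have fna := f_sym a.
have supp : f a != 0%N -> - s%:Z <= a <= s%:Z by move/supp_columns; lia.
have [f02|f02] := eqVneq (f 0) 2%N => /=.
  rewrite !mem_cat !mem_line !mem_opp_line !nonnegE !mem_pos_columns fna.
  have [->|a0] := eqVneq a 0.
    by rewrite f02 oppr0 eqxx /=; case: eqP => [->|?]; rewrite //=; case: eqP => [->|]; lia.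
  have [b1|b1] := eqVneq b 1; first by rewrite b1; move: fa supp a0; case: (f a) => [|[|[|]]] //=; lia.
  have [b2|b2] := eqVneq b (-1); first by rewrite b2; move: fa supp a0; case: (f a) => [|[|[|]]] //=; lia.
  by lia.
have {f02}f0 : f 0 = 0%N by case: f_mid f02 => // ->.
case: ifP => /= row_f.
  by rewrite mem_line colsE; case: (f a != 0%N) supp => [/(_ isT)|_]; lia.
case: ifP => /= double_f.
  have [E|ne] := eqVneq (f a) 1%N.
    move/allP/(_ a): double_f; rewrite mem_columns E /= => nz.
    have : `|a| <= s%:Z by apply: supp_columns; rewrite E.
    by move=> /nz.
  rewrite mem_cat !mem_line colsE /=.
  by move: fa supp ne; case: (f a) => [|[|[|]]] //=; lia.
rewrite !mem_cat !mem_line !mem_opp_line !mem_pos_columns fna.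
have [->|a0] := eqVneq a 0; first by rewrite f0 oppr0 /=; lia.
have [b1|b1] := eqVneq b 1; first by rewrite b1; move: fa supp a0; case: (f a) => [|[|[|]]] //=; lia.
have [b2|b2] := eqVneq b (-1); first by rewrite b2; move: fa supp a0; case: (f a) => [|[|[|]]] //=; lia.
by lia.
Qed.

Let uniq_line (I : seq int) (P : pred int) (h : int) :
  uniq I -> uniq [seq (i, h) | i <- I & P i].
Proof. by move=> uI; rewrite map_inj_uniq ?filter_uniq // => i j []. Qed.

Let uniq_opp_line (I : seq int) (P : pred int) (h : int) :
  uniq I -> uniq [seq (- i, h) | i <- I & P i].
Proof. by move=> uI; rewrite map_inj_uniq ?filter_uniq // => i j [/oppr_inj]. Qed.

Lemma small_uniq : uniq (vertices (small_diagram s f)).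
Proof.
have uc : uniq (columns s) by rewrite map_inj_uniq ?iota_uniq // => i j; lia.
have up : uniq (pos_columns s) by rewrite map_inj_uniq ?iota_uniq // => i j; lia.
have un : uniq (0 :: pos_columns s) by rewrite /= up mem_pos_columns.
rewrite /small_diagram.
have : forall i, (i \in 0 :: pos_columns s) = (0 <= i <= s%:Z).
  by move=> i; rewrite inE mem_pos_columns; lia.
cbv zeta; move: (0 :: pos_columns s) un => nonneg un nonnegE.
rewrite -/is_row -/is_double; move: (columns s) (mem_columns s) uc => cols colsE uc.
have memE := (mem_cat, mem_line, mem_opp_line, nonnegE, mem_pos_columns, colsE).
case: eqP => f02 /=.
  rewrite !cat_uniq !uniq_line ?uniq_opp_line // andbT /=.
  do !(apply/andP; split); apply/hasPn => -[a b]; rewrite !memE; lia.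
case: ifP => _ /=; first exact: uniq_line.
case: ifP => _ /=.
  by rewrite cat_uniq !uniq_line // andbT; apply/hasPn => -[a b]; rewrite !memE; lia.
rewrite !cat_uniq !uniq_line ?uniq_opp_line // andbT /=.
by do !(apply/andP; split); apply/hasPn => -[a b]; rewrite !memE; lia.
Qed.

Lemma small_count (c : int) :
  count (fun v => v.1 == c) (vertices (small_diagram s f)) = f c.
Proof.
rewrite -size_filter.
have /perm_size -> : perm_eq [seq v <- vertices (small_diagram s f) | v.1 == c]
    [seq v <- [:: (c, 0); (c, 1); (c, -1)] | in_small v].
  apply: uniq_perm; rewrite ?filter_uniq ?small_uniq //.
    by rewrite /= !inE !xpair_eqE eqxx.
  move=> [a b]; rewrite !mem_filter small_vertices !inE !xpair_eqE /=.
  case: (a =P c) => [->|_]; last by rewrite /= andbF.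
  have [|_] := boolP (in_small (c, b)); rewrite ?andbF //= /in_small /=.
  by case: ifP => _ /andP[b01 _]; lia.
rewrite size_filter /= /in_small /=; case: ifP => [/andP[_ /allP row_f]|_].
  have [fc|fc] := eqVneq (f c) 0%N; first by rewrite fc.
  have := row_f c; rewrite mem_columns supp_columns // (negPf fc) => /(_ isT)/eqP ->.
  by [].
have := f_le2 c; have [->|c0] := eqVneq c 0.
  by case: f_mid => ->.
by case: (f c) => [|[|[|]]] //= _; move: c0; rewrite mulr1 mulrN1; case: ltgtP; lia.
Qed.

Lemma eq_next_vertex V ch1 ch2 v w : ch1 =1 ch2 ->
  next_vertex V ch1 v w = next_vertex V ch2 v w.
Proof.
move=> E; rewrite /next_vertex !E; congr [&& _, _, _, _ & _].
by apply: eq_all => u; rewrite E.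
Qed.

Section TwoCrossings.

Variables (V : seq vertex).
Hypothesis V_mem : forall a b, ((a, b) \in V) =
  (`|b| == 1) && ((f a == 2%N) || (f a == 1%N) && (0 < a * b)).
Hypothesis f0 : f 0 = 0%N.
Let l := first_col 1.
Let l' := first_col 2.

(** On one side of the middle, rows and chains agree up to a sign. Across the middle, the
    consecutive vertices of a chain are those closest to it on either side, and these are the ends
    of the two additional arrows. *)
Lemma crossing_arrows i i' v w : 0 < i -> f i = 1%N -> 0 < i' -> f i' = 2%N ->
  (v \notin [:: (l, 1); (l', -1)]) && next_vertex V snd v w ||
    ((v, w) \in [:: ((l, 1), (- l, -1)); ((l', -1), (- l', 1))]) =
  next_vertex V (fun v => v.2 * sgz v.1) v w.
Proof.
move=> i0 fi i'0 fi'.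
have [l0 fl _] := @first_colP 1 i i0 isT (eq_leq (esym fi)).
have [l'0 fl' _] := @first_colP 2 i' i'0 isT (eq_leq (esym fi')).
have lmin a : 0 < a -> (0 < f a)%N -> l <= a.
  by move=> a0 fa; have [_ _] := @first_colP 1 a a0 isT fa.
have l'min a : 0 < a -> f a = 2%N -> l' <= a.
  by move=> a0 fa; have [_ _] := @first_colP 2 a a0 isT (eq_leq (esym fa)).
rewrite -/l -/l' in l0 fl l'0 fl'.
have fl'2 : f l' = 2%N by have := f_le2 l'; lia.
have Vcase a b : (a, b) \in V -> [/\ a != 0, b = 1 \/ b = -1, (0 < f a)%N &
    a * b < 0 -> f a = 2%N].
  rewrite V_mem => /andP[b1 fa]; split.
  - by apply: contraTneq fa => ->; rewrite f0 mul0r.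
  - by move: b1; lia.
  - by case/orP: fa => [/eqP->|/andP[/eqP->]].
  - by case/orP: fa => [/eqP->//|/andP[_]]; lia.
have VI a b : b = 1 \/ b = -1 -> (0 < f a)%N -> (a * b < 0 -> f a = 2%N) -> a != 0 ->
    (a, b) \in V.
  move=> b1 fa fab a0; rewrite V_mem; apply/andP; split; first by case: b1 => ->.
  have := f_le2 a; move: fa fab; case: (f a) => [|[|[|m]]] //= _ fab _.
  have ab0 : a * b != 0 by case: b1 => ->; rewrite ?mulr1 ?mulrN1 ?oppr_eq0.
  by rewrite lt_def ab0 leNgt; apply/negP => /fab.
have Vl : (l, 1) \in V by apply: VI; [left | exact: fl | lia | lia].
have Vl_ : (- l, -1) \in V by apply: VI; [right | rewrite f_sym; exact: fl | lia | lia].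
have Vl' : (l', -1) \in V by apply: VI; [right | rewrite fl'2 | move=> _ | lia].
have Vl'_ : (- l', 1) \in V by apply: VI; [left | rewrite f_sym fl'2 | rewrite f_sym | lia].
have pos (a : int) : 0 < a -> sgz a = 1 by move=> /gtr0_sgz.
have neg (a : int) : a < 0 -> sgz a = -1 by move=> /ltr0_sgz.
have sgn (a : int) : a != 0 -> 0 < a /\ sgz a = 1 \/ a < 0 /\ sgz a = -1.
  by case: (ltgtP a 0) => // ?; [right; rewrite neg | left; rewrite pos].
case: v w => a b [a' b']; apply/idP/idP.
  case/orP => [/andP[vex /next_vertexP[/= vV wV bb aa none]]|].
    have [a0 b1 fa fab] := Vcase _ _ vV; have [a'0 b'1 fa' fab'] := Vcase _ _ wV.
    rewrite !inE !xpair_eqE negb_or in vex.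
    (* Otherwise (l, 1) or (l', -1), the last vertex of its row to the right of the middle, would
       lie strictly between the two ends or be the excluded source. *)
    have same : (0 < a) = (0 < a').
      apply/idP/idP => [apos|]; last by lia.
      rewrite ltNge; apply/negP => a'le0; case: b1 => b1; rewrite b1 in fab vex bb none *.
        have la := lmin a apos fa.
        by have /= := none (l, 1) Vl erefl; move: vex; lia.
      have fa2 : f a = 2%N by apply: fab; lia.
      have la := l'min a apos fa2.
      by have /= := none (l', -1) Vl' erefl; move: vex; lia.
    apply/next_vertexP; split=> //=.
      by rewrite bb (sgz_same a0 a'0 same).
    move=> [c e] cV /= ce ac; have [c0 e1 fc fce] := Vcase _ _ cV.
    apply: (none (c, e)) => //=; have sc : sgz c = sgz a.
      by apply: sgz_same => //; clear -same ac; lia.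
    by move: ce; rewrite sc => /(sgz_mul_inj a0).
  rewrite !inE !xpair_eqE => /orP[/andP[/andP[/eqP-> /eqP->] /andP[/eqP-> /eqP->]]|
    /andP[/andP[/eqP-> /eqP->] /andP[/eqP-> /eqP->]]]; apply/next_vertexP; split=> //=.
  - by rewrite (pos l) // (neg (- l)) ?oppr_lt0.
  - by lia.
  - move=> [c e] cV /= ce lc; have [c0 e1 fc fce] := Vcase _ _ cV.
    have [[cp _]|[cn _]] := sgn c c0; first by have := lmin c cp fc; lia.
    by have := lmin (- c); rewrite oppr_gt0 f_sym => /(_ cn fc); lia.
  - by rewrite (pos l') // (neg (- l')) ?oppr_lt0.
  - by lia.
  - move=> [c e] cV /= ce lc; have [c0 e1 fc fce] := Vcase _ _ cV.
    rewrite (pos l') // in ce.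
    have [[cp sc]|[cn sc]] := sgn c c0; rewrite sc in ce.
      have fc2 : f c = 2%N by apply: fce; rewrite (_ : e = -1) ?mulrN1; lia.
      by have := l'min c cp fc2; lia.
    have fc2 : f c = 2%N by apply: fce; rewrite (_ : e = 1) ?mulr1; lia.
    by have := l'min (- c); rewrite oppr_gt0 f_sym => /(_ cn fc2); lia.
move=> /next_vertexP[/= vV wV bb aa none].
have [a0 b1 fa fab] := Vcase _ _ vV; have [a'0 b'1 fa' fab'] := Vcase _ _ wV.
have [same|diff] := eqVneq (0 < a) (0 < a').
  have sa : sgz a' = sgz a.
    exact: sgz_same a'0 a0 (esym same).
  have b'b : b' = b by move: bb; rewrite sa => /(sgz_mul_inj a0).
  rewrite b'b in bb wV fab' b'1 *.
  apply/orP; left; apply/andP; split.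
    rewrite !inE !xpair_eqE; apply/negP => /orP[]/andP[/eqP aE /eqP bE].
      by have := lmin a'; rewrite aE in same aa; lia.
    rewrite aE bE in same aa fab'; have := l'min a'; have a'pos : 0 < a' by lia.
    have fa'2 : f a' = 2%N by apply: fab'; lia.
    by move=> /(_ a'pos fa'2); lia.
  apply/next_vertexP; split=> //= -[c e] cV /= ce ac.
  have [c0 e1 fc fce] := Vcase _ _ cV; apply: (none (c, e)) => //=; rewrite ce.
  by rewrite (sgz_same c0 a0) //; clear -same ac; lia.
have apos : 0 < a by lia.
have a'neg : a' < 0 by lia.
rewrite (pos a) // (neg a') // mulr1 mulrN1 in bb none *.
have b'E : b' = - b by lia.
apply/orP; right; rewrite !inE !xpair_eqE b'E.
case: b1 => b1; rewrite b1 in b'E bb none fab *.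
  have la := lmin a apos fa; have aE : a = l.
    have [//|al] := eqVneq a l; have /= := none (l, 1) Vl; rewrite (pos l) // => /(_ erefl).
    by lia.
  have la' := lmin (- a'); rewrite oppr_gt0 f_sym in la'; have {}la' := la' a'neg fa'.
  have a'E : a' = - l.
    have [//|al] := eqVneq a' (- l); have /= := none (- l, -1) Vl_.
    by rewrite (neg (- l)) ?oppr_lt0 // => /(_ erefl); lia.
  by rewrite aE a'E !eqxx.
have fa2 : f a = 2%N by apply: fab; lia.
have la := l'min a apos fa2; have aE : a = l'.
  have [//|al] := eqVneq a l'; have /= := none (l', -1) Vl'; rewrite (pos l') // => /(_ erefl).
  by lia.
have la' := l'min (- a'); rewrite oppr_gt0 f_sym in la'.
have fa'2 : f a' = 2%N by apply: fab'; rewrite b'E; lia.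
have {}la' := la' a'neg fa'2.
have a'E : a' = - l'.
  have [//|al] := eqVneq a' (- l'); have /= := none (- l', 1) Vl'_.
  by rewrite (neg (- l')) ?oppr_lt0 // => /(_ erefl); lia.
by rewrite aE a'E !eqxx orbT.
Qed.

End TwoCrossings.

Lemma small_arrows v w : ((v, w) \in arrows (small_diagram s f)) =
  next_vertex (vertices (small_diagram s f)) small_chain v w || small_extra v w.
Proof.
have memV := small_vertices.
rewrite /small_extra; have [f02|f02] := eqVneq (f 0) 2%N.
  rewrite /small_diagram f02 /= mem_cat mem_row_arrows in_nil /=; congr (_ || _).
    by apply: eq_next_vertex => u; rewrite /small_chain f02 eqxx.
  by rewrite -/(first_col 1); case: ifP => _; rewrite ?inE ?xpair_eqE ?andbF.
have f0 : f 0 = 0%N by case: f_mid f02 => // ->.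
rewrite orbF; move: memV; rewrite /small_diagram (negPf f02) -/is_row -/is_double.
have [row_f|nrow] := boolP is_row.
  move=> _; rewrite mem_row_arrows in_nil /=.
  by apply: eq_next_vertex => u; rewrite /small_chain row_f orbT.
have [double_f|ndouble] := boolP is_double.
  move=> _; rewrite mem_row_arrows in_nil /=.
  by apply: eq_next_vertex => u; rewrite /small_chain double_f !orbT.
rewrite [vertices _]/=; set V := _ ++ _ => memV; rewrite [arrows _]/= mem_cat mem_row_arrows.
have -> : head 0 [seq i <- pos_columns s | f i == 2%N] = first_col 2.
  by congr head; apply: eq_filter => i; have := f_le2 i; lia.
rewrite -/(first_col 1).
rewrite (@eq_next_vertex V small_chain (fun v => v.2 * sgz v.1)); last first.
  by move=> u; rewrite /small_chain (negPf f02) (negPf nrow) (negPf ndouble).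
have pos_entry a : (exists2 i, i \in columns s & f i == a) -> a != 0%N -> exists2 i, 0 < i & f i = a.
  move=> [i _ /eqP fi] a0; have [i0|i0|i0] := ltgtP i 0.
  - by exists (- i); [lia | rewrite f_sym].
  - by exists i.
  - by rewrite i0 f0 in fi; rewrite -fi eqxx in a0.
have [i i0 fi] : exists2 i, 0 < i & f i = 1%N.
  apply: pos_entry => //; have /allPn[i ic] := ndouble; rewrite negb_or => /andP[n0 n2].
  by exists i => //; have := f_le2 i; lia.
have [i' i'0 fi'] : exists2 i, 0 < i & f i = 2%N.
  apply: pos_entry => //; have /allPn[j jc] := nrow; rewrite negb_or => /andP[n0 n2].
  by exists j => //; have := f_le2 j; lia.
apply: crossing_arrows i0 fi i'0 fi' => // a b.
by rewrite memV /in_small (negPf nrow) andbF.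
Qed.

End SmallDiagram.

Lemma vertices_superpose D L :
  vertices (foldl superpose D L) = vertices D ++ flatten [seq vertices E | E <- L].
Proof. by elim: L D => [|E L IHL] D /=; rewrite ?cats0 // IHL catA. Qed.

Lemma arrows_superpose D L :
  arrows (foldl superpose D L) = arrows D ++ flatten [seq arrows E | E <- L].
Proof. by elim: L D => [|E L IHL] D /=; rewrite ?cats0 // IHL catA. Qed.

Definition unstretch (v : vertex) : vertex := (v.1, sgz v.2).

(** The index of the block that contains v, since d^j is drawn at heights j and - j. *)
Definition height (v : vertex) : nat := absz v.2.

Lemma unstretchK v : stretch_vertex (height v) (unstretch v) = v.
Proof. by case: v => a b; rewrite /stretch_vertex /unstretch /= -intEsg. Qed.

(** * The stretched and superposed diagram *)

Section LineDiagram.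

Variables (s : nat) (d : int -> nat).
Hypothesis d_out : forall i : int, s%:Z < `|i| -> d i = 0%N.
Hypothesis d_sym : forall i : int, d (- i) = d i.
Hypothesis d0_even : ~~ odd (d 0%R).

Local Notation B := (block_vec s d).
Let m := size (decomposition s d).2.
Local Notation D := (line_diagram s d).

Let B_sym j i : B j (- i) = B j i. Proof. exact: block_vec_sym. Qed.
Let B_le2 j i : (B j i <= 2)%N. Proof. exact: block_vec_le2. Qed.
Let B_supp j i : s%:Z < `|i| -> B j i = 0%N. Proof. exact: block_vec_supp. Qed.
Let B_mid j : B j 0 = 0%N \/ B j 0 = 2%N. Proof. exact: block_vec_middle. Qed.

Let sv j := small_vertices (B_sym j) (B_le2 j) (@B_supp j) (B_mid j).
Let sa j := small_arrows (B_sym j) (B_le2 j) (@B_supp j) (B_mid j).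

Lemma row0_is_row : is_row s (B 0) && (B 0 0 != 2%N).
Proof.
have [_ _ le1 ->] := row0_ok d_out d_sym d0_even; rewrite andbT.
by apply/allP => i _; have := le1 i; lia.
Qed.

Lemma block_not_row j : (0 < j <= m)%N -> (B j 0 != 2%N) && is_row s (B j) = false.
Proof.
move=> jm; have [E|->//] := B_mid j; apply/negP => /andP[_ /allP row_j].
have [i i2] := block_vec_two d_out d_sym d0_even jm E.
have := row_j i; rewrite mem_columns i2 => /(_ _)/negP; case=> //.
by apply: (supp_columns (f := B j)); [exact: B_supp | rewrite i2].
Qed.

Lemma in_small_height j v : (j <= m)%N -> in_small s (B j) v -> height v = (j != 0%N).
Proof.
rewrite /in_small /height; case: j => [_|j jm].
  by have /andP[-> ->] := row0_is_row; rewrite /= => /andP[/eqP->].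
by rewrite block_not_row // => /andP[/eqP v1 _]; lia.
Qed.

Lemma height_stretch j v : (j <= m)%N -> in_small s (B j) v ->
  height (stretch_vertex j v) = j /\ unstretch (stretch_vertex j v) = v.
Proof.
move=> jm /(in_small_height jm); case: v => a b; rewrite /height /unstretch /stretch_vertex /=.
case: j jm => [|j] jm /= h; first by have -> : b = 0 by lia.
have [->|->] : b = 1 \/ b = -1 by lia.
  by rewrite mul1r.
by rewrite mulN1r sgzN; split; [lia | ].
Qed.

Definition piece j : diagram := stretch j (small_diagram s (B j)).

Lemma piece_vertices j v : (j <= m)%N ->
  (v \in vertices (piece j)) = (height v == j) && in_small s (B j) (unstretch v).
Proof.
move=> jm; apply/mapP/andP => [[u + ->]|[/eqP <- iv]].
  rewrite sv => iu.
  by have [-> ->] := height_stretch jm iu.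
exists (unstretch v); first by rewrite sv.
by rewrite unstretchK.
Qed.

Lemma small_arrow_ends j v w : (v, w) \in arrows (small_diagram s (B j)) ->
  in_small s (B j) v /\ in_small s (B j) w.
Proof.
rewrite sa => /orP[/next_vertexP[]|].
  by rewrite !sv.
case/and4P => /eqP f0 cnt /eqP -> /eqP ->.
have [i i0 fi] := positive_one (B_sym j) (B_mid j) f0 (leq_trans (isT : 0 < 4)%N cnt).
have [l0 fl _] := @first_colP s (B j) (@B_supp j) (B_mid j) 1 i i0 isT (eq_leq (esym fi)).
rewrite /in_small f0 /= mulr1 mulrNN mulr1 B_sym l0 !andbT.
by have := B_le2 j (first_col s (B j) 1); lia.
Qed.

Lemma piece_arrows j v w : (j <= m)%N ->
  ((v, w) \in arrows (piece j)) = [&& height v == j, height w == j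
    & (unstretch v, unstretch w) \in arrows (small_diagram s (B j))].
Proof.
move=> jm; apply/mapP/and3P => [[[v0 w0] vw0 [-> ->]]|[/eqP vj /eqP wj vw]].
  have [iv iw] := small_arrow_ends vw0; rewrite /=.
  by have [-> ->] := height_stretch jm iv; have [-> ->] := height_stretch jm iw.
by exists (unstretch v, unstretch w); rewrite //= -{1}vj -wj !unstretchK.
Qed.

(** All of d^0 is drawn at height 0, so it is fixed by stretching with factor 0 and need not be
    treated apart from the other pieces. *)
Lemma stretch0_id : piece 0 = small_diagram s (decomposition s d).1.
Proof.
rewrite /piece /stretch -[B 0]/(decomposition s d).1.
have fixed v : in_small s (B 0) v -> stretch_vertex 0 v = v.
  case: v => a b; rewrite /in_small; have /andP[-> ->] := row0_is_row.
  by rewrite /stretch_vertex /= mulr0 => /andP[/eqP ->].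
case E : (small_diagram _ _) => [V A] /=; congr Diagram.
  rewrite -[RHS]map_id; apply/eq_in_map => v vV; apply: fixed.
  by rewrite -sv [small_diagram _ _]E.
rewrite -[RHS]map_id; apply/eq_in_map => -[v w] vwA.
have [|iv iw] := @small_arrow_ends 0 v w; first by rewrite [small_diagram _ _]E.
by rewrite /= !fixed.
Qed.

Lemma line_pieces (T : eqType) (part : diagram -> seq T) x :
  (forall E L, part (foldl superpose E L) = part E ++ flatten [seq part F | F <- L]) ->
  reflect (exists2 j, (j <= m)%N & x \in part (piece j)) (x \in part D).
Proof.
move=> partE; rewrite /line_diagram partE mem_cat -stretch0_id -map_comp; apply: (iffP orP).
  case=> [x0|/flattenP[P]]; first by exists 0%N.
  case/mapP => j; rewrite mem_iota add0n => /andP[_ jm] -> xE.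
  by exists j.+1.
case=> -[|j] jm xj; [by left | right].
apply/flattenP; exists (part (piece j.+1)) => //.
by apply/mapP; exists j; rewrite ?mem_iota.
Qed.

Definition in_line (v : vertex) : bool :=
  if v.2 == 0 then B 0 v.1 != 0%N
  else (B (height v) v.1 == 2%N) || (B (height v) v.1 == 1%N) && (0 < v.1 * v.2).

Lemma line_vertices v : (v \in vertices D) = (height v <= m)%N && in_small s (B (height v)) (unstretch v).
Proof.
apply/(line_pieces _ vertices_superpose)/andP => [[j jm]|[hm iv]].
  by rewrite piece_vertices // => /andP[/eqP->].
by exists (height v); rewrite // piece_vertices ?eqxx.
Qed.

Lemma line_verticesE v : (v \in vertices D) = in_line v.
Proof.
rewrite line_vertices /in_line /in_small; case: v => a b; rewrite /height /unstretch /=.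
have [->|b0] := eqVneq b 0.
  by have /andP[-> ->] := row0_is_row; rewrite /= ?eqxx.
have [bm|bm] := leqP (absz b) m; last first.
  by rewrite (block_vec_out (s := s) (d := d)).
rewrite block_not_row; last by lia.
by rewrite normr_sgz b0 /= -[0 < a * sgz b]sgz_gt0 sgzM sgz_id -sgzM sgz_gt0.
Qed.

(** Applied to the stretched vertex, [small_chain] gives plus or minus the index of the block, which
    separates the chains of different blocks. *)
Definition line_chain (v : vertex) : int := small_chain s (B (height v)) v.

Definition line_extra (v w : vertex) : bool :=
  let f := B (height v) in
  [&& f 0 == 2%N, (4 <= count (fun i => f i == 1%N) (columns s))%N,
      v == (first_col s f 1, (height v)%:Z) &
      w == (- first_col s f 1, - (height v)%:Z)].

Lemma line_col_neq0 v : v \in vertices D -> v.1 = 0 -> B (height v) 0 = 2%N.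
Proof.
rewrite line_verticesE /in_line => + v0; rewrite v0.
have [_ _ _ r0] := row0_ok d_out d_sym d0_even.
case: (v.2 =P 0) => _; first by rewrite r0.
by have [->|->] := B_mid (height v).
Qed.

Lemma middle_height j : B j 0 = 2%N -> (0 < j)%N.
Proof.
by have [_ _ _ r0] := row0_ok d_out d_sym d0_even; case: j => //; rewrite r0.
Qed.

Lemma line_chain_abs v : v \in vertices D -> absz (line_chain v) = height v.
Proof.
move=> vD; rewrite /line_chain /small_chain; case: ifP => // /norP[f0 _].
have v0 : v.1 != 0 by apply: contra f0 => /eqP v0; rewrite line_col_neq0.
rewrite abszM (_ : absz (sgz v.1) = 1%N) ?muln1 //.
by rewrite /sgz; case: ltgtP v0.
Qed.

Lemma line_chainE v : v \in vertices D ->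
  line_chain v = small_chain s (B (height v)) (unstretch v) * (height v)%:Z.
Proof.
move=> vD; rewrite /line_chain /small_chain /unstretch /height /=.
case: ifP => _; first by rewrite -intEsg.
by rewrite mulrAC -intEsg.
Qed.

Lemma line_chain_eq v u : v \in vertices D -> u \in vertices D ->
  (line_chain u == line_chain v) = (height u == height v) &&
  (small_chain s (B (height v)) (unstretch u) == small_chain s (B (height v)) (unstretch v)).
Proof.
move=> vD uD; have [uv|uv] := eqVneq (height u) (height v); last first.
  apply: contraNF uv => /eqP E.
  by rewrite -(line_chain_abs vD) -(line_chain_abs uD) E.
rewrite !line_chainE // uv /=; have [h0|h0] := eqVneq (height v) 0%N.
  have z w : height w = 0%N -> unstretch w = (w.1, 0).
    by case: w => a b; rewrite /height /unstretch /= => /eqP; rewrite absz_eq0 => /eqP ->.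
  rewrite h0 !mulr0 eqxx !z ?uv //; rewrite /small_chain /=.
  by case: ifP; rewrite ?mul0r eqxx.
by apply/eqP/eqP => [/mulIf->|->] //; rewrite ?eqz_nat; lia.
Qed.

Lemma line_arrows v w : ((v, w) \in arrows D) =
  next_vertex (vertices D) line_chain v w || line_extra v w.
Proof.
have small_in u : u \in vertices D -> unstretch u \in vertices (small_diagram s (B (height u))).
  by rewrite line_vertices => /andP[_]; rewrite sv.
have lift_in j u : (j <= m)%N -> u \in vertices (small_diagram s (B j)) ->
    [/\ stretch_vertex j u \in vertices D, height (stretch_vertex j u) = j
      & unstretch (stretch_vertex j u) = u].
  rewrite sv => jm iu; have [h1 h2] := height_stretch jm iu.
  by rewrite line_vertices h1 h2 jm.
have arrE : ((v, w) \in arrows D) = [&& (height v <= m)%N, height w == height v &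
    (unstretch v, unstretch w) \in arrows (small_diagram s (B (height v)))].
  apply/(line_pieces _ arrows_superpose)/and3P => [[j jm]|[vm /eqP wv vw]].
    by rewrite piece_arrows // => /and3P[/eqP vj wj vw]; rewrite vj.
  by exists (height v); rewrite // piece_arrows // wv eqxx.
have extraE : (height v <= m)%N -> height w = height v ->
    small_extra s (B (height v)) (unstretch v) (unstretch w) = line_extra v w.
  move=> vm wv; rewrite /small_extra /line_extra; case: eqP => //= f0.
  congr (_ && _); apply/andP/andP => -[/eqP E1 /eqP E2].
    rewrite -{1}[v]unstretchK -{1}[w]unstretchK E1 E2 wv /stretch_vertex /=.
    by rewrite mul1r mulN1r !eqxx.
  have h0 := middle_height f0; have := congr1 fst E1; have := congr1 snd E1.
  have := congr1 fst E2; have := congr1 snd E2; rewrite /unstretch /= => -> -> -> ->.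
  by rewrite sgzN gtr0_sgz ?ltz_nat // !eqxx.
have nextE : (height v <= m)%N -> height w = height v ->
    next_vertex (vertices (small_diagram s (B (height v)))) (small_chain s (B (height v)))
      (unstretch v) (unstretch w) = next_vertex (vertices D) line_chain v w.
  move=> vm wv; apply/next_vertexP/next_vertexP => -[vV wV cc lt none].
    have [vD _ _] := lift_in _ _ vm vV; rewrite unstretchK in vD.
    have [wD _ _] := lift_in _ _ vm wV; rewrite -wv unstretchK in wD.
    split=> //; first by apply/eqP; rewrite line_chain_eq // wv cc !eqxx.
    move=> u uD /eqP; rewrite line_chain_eq // => /andP[/eqP uv /eqP cu] bet.
    by apply: (none (unstretch u)) => //; rewrite -uv; apply: small_in.
  split; [exact: small_in | by rewrite -wv; apply: small_in | | by [] |].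
    by move/eqP: cc; rewrite line_chain_eq // => /andP[_ /eqP].
  move=> u uV cu bet; have [uD uh uu] := lift_in _ _ vm uV.
  apply: (none (stretch_vertex (height v) u)) => //.
  by apply/eqP; rewrite line_chain_eq // uh uu cu !eqxx.
rewrite arrE; apply/and3P/orP => [[vm /eqP wv]|].
  by rewrite sa nextE // extraE // => /orP.
case=> [nx|ex].
  have [vD wD /eqP cc _ _] := next_vertexP _ _ _ _ nx.
  move: cc; rewrite line_chain_eq // => /andP[/eqP wv _].
  have vm : (height v <= m)%N by move: vD; rewrite line_vertices => /andP[].
  by rewrite wv eqxx sa nextE ?nx.
have vm : (height v <= m)%N.
  rewrite leqNgt; apply/negP => vm; case/and4P: ex => /eqP f0 _ _ _; move: f0.
  by rewrite (block_vec_out (s := s) (d := d)).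
have wv : height w = height v.
  by case/and4P: ex => _ _ _ /eqP ->; rewrite /height /= abszN absz_nat.
by rewrite wv eqxx sa extraE // ex orbT.
Qed.

End LineDiagram.

(** This turns a count of vertices into a condition on labels. *)
Lemma nth_sorted_downset (T : eqType) (x0 : T) (le : rel T) (P : pred T) (t : seq T) i :
  (forall x y, le x y -> P y -> P x) -> transitive le -> sorted le t ->
  (i < size t)%N -> P (nth x0 t i) = (i < count P t)%N.
Proof.
move=> down tr; elim: t i => [|x t IHt] i //= pt it.
have [Px|nPx] := boolP (P x); last first.
  have t0 y : y \in t -> ~~ P y.
    move=> yt; apply: contra nPx; apply: down.
    by have /allP := order_path_min tr pt; apply.
  have -> : count P t = 0%N.
    by apply/eqP; rewrite -leqn0 leqNgt -has_count; apply/hasPn => y /t0.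
  by case: i it => [|i] it /=; rewrite ?(negPf nPx) // (negPf (t0 _ (mem_nth _ it))).
by case: i it => [|i] it //=; rewrite IHt // (path_sorted pt).
Qed.

Definition neg_vertex (v : vertex) : vertex := (- v.1, - v.2).

Lemma neg_vertexK : involutive neg_vertex.
Proof. by case=> a b; rewrite /neg_vertex /= !opprK. Qed.

Lemma vertex_le_trans : transitive vertex_le.
Proof. by move=> [a b] [a' b'] [a'' b'']; rewrite /vertex_le /=; lia. Qed.

Lemma vertex_le_total : total vertex_le.
Proof. by move=> [a b] [a' b']; rewrite /vertex_le /=; lia. Qed.

Lemma vertex_le_anti : antisymmetric vertex_le.
Proof. by move=> [a b] [a' b']; rewrite /vertex_le /= => H; congr (_, _); lia. Qed.

Lemma vertex_le_neg v w : vertex_le (neg_vertex v) (neg_vertex w) = vertex_le w v.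
Proof. by case: v w => a b [a' b']; rewrite /vertex_le /=; lia. Qed.

(** * Labels, columns and the symmetry of the diagram *)

Section SortedDiagram.

Variables (n s : nat) (d : int -> nat).
Hypothesis dim_d : symplectic_dimvec n s d.

Lemma dimvec_out (i : int) : s%:Z < `|i| -> d i = 0%N.
Proof. by case: dim_d => H _ _ _; apply: H. Qed.
Lemma dimvec_sym (i : int) : d (- i) = d i.
Proof. by case: dim_d. Qed.
Lemma dimvec_even : ~~ odd (d 0%R).
Proof. by case: dim_d => _ _ _ ->; rewrite -doubleB odd_double. Qed.

Local Notation d_out := dimvec_out.
Local Notation d_sym := dimvec_sym.
Local Notation d0_even := dimvec_even.
Local Notation B := (block_vec s d).
Local Notation D := (line_diagram s d).
Let m := size (decomposition s d).2.

Let B_sym j i : B j (- i) = B j i. Proof. exact: (block_vec_sym d_out d_sym d0_even). Qed.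
Let B_le2 j i : (B j i <= 2)%N. Proof. exact: (block_vec_le2 d_out d_sym d0_even). Qed.
Let B_supp j i : s%:Z < `|i| -> B j i = 0%N. Proof. exact: (block_vec_supp d_out d_sym d0_even). Qed.
Let B_mid j : B j 0 = 0%N \/ B j 0 = 2%N. Proof. exact: (block_vec_middle d_out d_sym d0_even). Qed.

Lemma line_verticesD :
  vertices D = flatten [seq vertices (piece s d j) | j <- iota 0 m.+1].
Proof.
rewrite /line_diagram vertices_superpose -(stretch0_id d_out d_sym d0_even) /= -map_comp.
by congr (_ ++ flatten _); rewrite -[1%N]addn0 iotaDl -map_comp.
Qed.

Lemma line_uniq : uniq (vertices D).
Proof.
rewrite line_verticesD.
have piece_uniq j : (j <= m)%N -> uniq (vertices (piece s d j)).
  move=> jm; rewrite map_inj_in_uniq; first exact: (small_uniq s (B_mid j)).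
  move=> u v; rewrite !(small_vertices (B_sym j) (B_le2 j) (@B_supp j) (B_mid j)) => iu iv E.
  have [_ <-] := height_stretch d_out d_sym d0_even jm iu.
  by have [_ <-] := height_stretch d_out d_sym d0_even jm iv; rewrite E.
have : all (fun j => j <= m)%N (iota 0 m.+1) by apply/allP => j; rewrite mem_iota; lia.
elim: (iota 0 m.+1) (iota_uniq 0 m.+1) => //= j J IHJ /andP[jJ uJ] /andP[jm Jm].
rewrite cat_uniq piece_uniq // IHJ // andbT /=; apply/hasPn => v /flattenP[t].
case/mapP => j' j'J ->; rewrite /= (piece_vertices d_out d_sym d0_even _ jm).
rewrite (piece_vertices d_out d_sym d0_even); last by move/allP: Jm; apply.
by case/andP => /eqP E _; apply/negP => /andP[/eqP E' _]; rewrite -E' E j'J in jJ.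
Qed.

Lemma line_count (c : int) : count (fun v => v.1 == c) (vertices D) = d c.
Proof.
rewrite line_verticesD count_flatten -map_comp.
rewrite -(decomposition_sum d_out d_sym d0_even c).
transitivity (sumn [seq B j c | j <- iota 0 m.+1]).
  congr sumn; apply: eq_map => j /=; rewrite /piece count_map.
  exact: (small_count (B_sym j) (B_le2 j) (@B_supp j) (B_mid j)).
have nthE : [seq B j c | j <- iota 1 m] = [seq f c | f <- (decomposition s d).2].
  rewrite -[1%N]addn0 iotaDl -map_comp -[in RHS](mkseq_nth (fun=> 0%N) (decomposition s d).2).
  by rewrite /mkseq -map_comp.
by rewrite /= nthE.
Qed.

Lemma line_sym v : (neg_vertex v \in vertices D) = (v \in vertices D).
Proof.
rewrite !(line_verticesE d_out d_sym d0_even); case: v => a b.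
rewrite /in_line /neg_vertex /height -[(- a, - b).1]/(- a) -[(- a, - b).2]/(- b).
by rewrite oppr_eq0 abszN !B_sym mulrNN.
Qed.

Lemma line_columns v : v \in vertices D -> `|v.1| <= s%:Z.
Proof.
move=> vD; rewrite leNgt; apply/negP => /d_out d0.
have : (0 < count (fun u : vertex => u.1 == v.1) (vertices D))%N.
  by rewrite -has_count; apply/hasP; exists v.
by rewrite line_count d0.
Qed.

Lemma count_fibres (V : seq vertex) (T : seq int) : uniq T ->
  count (fun v => v.1 \in T) V = sumn [seq count (fun v => v.1 == t) V | t <- T].
Proof.
elim: T => [_|t T IHT /= /andP[tT uT]]; first by rewrite (@eq_count _ _ pred0) ?count_pred0.
rewrite -IHT // -count_predUI (@eq_count _ (predI _ _) pred0) ?count_pred0 ?addn0.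
  by apply: eq_count => v /=; rewrite inE.
by move=> v /=; apply/negP => /andP[/eqP ->]; apply/negP.
Qed.

Lemma line_count_in (T : seq int) : uniq T ->
  count (fun v => v.1 \in T) (vertices D) = sumn [seq d t | t <- T].
Proof. by move=> uT; rewrite count_fibres //; congr sumn; apply: eq_map => t; apply: line_count. Qed.

Lemma sumn_d_iota a b : sumn [seq d t%:Z | t <- iota a b] = (\sum_(a <= t < a + b) d t%:Z)%N.
Proof. by rewrite sumnE big_map /index_iota addKn. Qed.

Lemma sumn_d_opp_iota a b : sumn [seq d t | t <- [seq - t%:Z | t <- iota a b]] =
  (\sum_(a <= t < a + b) d t%:Z)%N.
Proof.
by rewrite -map_comp -sumn_d_iota; congr sumn; apply: eq_map => t /=; rewrite d_sym.
Qed.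

Lemma cpart_total : (cpart d s.+1 = n)%N.
Proof.
case: dim_d => _ _ le_n d0; rewrite /cpart -[d 0%N]/(d 0) d0 -doubleB doubleK subnK //.
Qed.

Lemma size_line : size (vertices D) = (n + n)%N.
Proof.
pose T := [seq - t%:Z | t <- iota 1 s] ++ 0 :: [seq t%:Z | t <- iota 1 s].
have uT : uniq T.
  rewrite cat_uniq /= !map_inj_uniq ?iota_uniq //=; last by move=> i j; lia.
    rewrite negb_or andbT -andbA; apply/and3P; split.
    - by apply/negP => /mapP[t]; rewrite mem_iota; lia.
    - apply/hasPn => i /mapP[t + ->]; rewrite mem_iota => ts.
      by apply/negP => /mapP[u]; rewrite mem_iota; lia.
    - by apply/negP => /mapP[t]; rewrite mem_iota; lia.
  by move=> i j; lia.
have -> : size (vertices D) = count (fun v => v.1 \in T) (vertices D).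
  rewrite -count_predT; apply: eq_in_count => -[a b] /line_columns /= vs; apply/esym.
  rewrite mem_cat inE; have [v0|v0|v0] := ltgtP a 0; last by rewrite orbT.
    by apply/orP; left; apply/mapP; exists (absz a); [rewrite mem_iota|]; lia.
  by apply/orP; right; apply/mapP; exists (absz a); [rewrite mem_iota|]; lia.
rewrite line_count_in // map_cat sumn_cat /= sumn_d_opp_iota -map_comp sumn_d_iota.
case: dim_d => _ _ le_n d0; rewrite add1n d0; move: le_n.
by move: (\sum_(1 <= i < _) _)%N => S; rewrite -!addnn; lia.
Qed.

Lemma line_count_le i : (1 <= i <= s.+1)%N ->
  (count (fun v => (v.1 <= - i%:Z)%R) (vertices D) + cpart d i = n)%N.
Proof.
move=> /andP[i1 si]; pose T := [seq - t%:Z | t <- iota i (s.+1 - i)].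
have uT : uniq T by rewrite map_inj_uniq ?iota_uniq // => a b; lia.
have -> : count (fun v : vertex => v.1 <= - i%:Z) (vertices D) =
    count (fun v => v.1 \in T) (vertices D).
  apply: eq_in_count => -[a b] /line_columns /= vs; apply/idP/mapP => [vi|[t]].
    by exists (absz a); [rewrite mem_iota|]; lia.
  by rewrite mem_iota; lia.
rewrite line_count_in // sumn_d_opp_iota subnKC // -[RHS]cpart_total /cpart addnCA.
by congr (_ + _)%N; rewrite addnC -big_cat_nat.
Qed.

Definition sorted_vertices : seq vertex := sort vertex_le (vertices D).

Lemma mem_sorted v : (v \in sorted_vertices) = (v \in vertices D).
Proof. exact: mem_sort. Qed.

Lemma size_sorted : size sorted_vertices = (n + n)%N.
Proof. by rewrite size_sort size_line. Qed.

Lemma uniq_sorted : uniq sorted_vertices.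
Proof. by rewrite sort_uniq line_uniq. Qed.

(** Negation preserves the set of vertices and reverses their order. Hence the vertex labelled - i
    is the negative of the one labelled i. *)
Lemma sorted_neg : [seq neg_vertex v | v <- rev sorted_vertices] = sorted_vertices.
Proof.
apply: (sorted_eq vertex_le_trans vertex_le_anti).
- rewrite map_rev rev_sorted sorted_map; apply: sub_sorted (sort_sorted vertex_le_total _).
  by move=> v w /=; rewrite vertex_le_neg.
- exact: sort_sorted vertex_le_total _.
apply: uniq_perm; rewrite ?uniq_sorted //.
  by rewrite map_inj_uniq ?rev_uniq ?uniq_sorted //; exact: inv_inj neg_vertexK.
move=> v; rewrite -[v in LHS]neg_vertexK mem_map ?mem_rev ?mem_sorted ?line_sym //.
exact: inv_inj neg_vertexK.
Qed.

Local Notation lv := (labelled_vertex (n := n) s d).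

Lemma lv_in p : lv p \in vertices D.
Proof. by rewrite -mem_sorted mem_nth // size_sorted. Qed.

Lemma lv_inj : injective lv.
Proof.
move=> p q /eqP; rewrite /labelled_vertex nth_uniq ?uniq_sorted ?size_sorted //.
by move/eqP/val_inj.
Qed.

Lemma lv_surj v : v \in vertices D -> exists p : 'I_(n + n), lv p = v.
Proof.
rewrite -mem_sorted => vV; have vi : (index v sorted_vertices < n + n)%N.
  by rewrite -size_sorted index_mem.
by exists (Ordinal vi); rewrite /labelled_vertex nth_index.
Qed.

Lemma lv_rev p : lv (rev_ord p) = neg_vertex (lv p).
Proof.
rewrite /labelled_vertex -/sorted_vertices -[in LHS]sorted_neg.
have pn := ltn_ord p; rewrite (nth_map (0, 0)) ?size_rev ?size_sorted //=; last by lia.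
rewrite nth_rev size_sorted /=; last by lia.
by congr (neg_vertex (nth _ _ _)); lia.
Qed.

Definition vcol (p : 'I_(n + n)) : int := (lv p).1.

Lemma vcol_rev p : vcol (rev_ord p) = - vcol p.
Proof. by rewrite /vcol lv_rev. Qed.

Lemma vcol_bound p : `|vcol p| <= s%:Z.
Proof. exact: line_columns (lv_in p). Qed.

(** Exactly n - c_i vertices lie in the columns up to - i. They carry the smallest labels, which are
    those of the basis of V_{-i}. *)
Lemma vcol_flag i p : (1 <= i <= s.+1)%N ->
  (label p <= - (cpart d i)%:Z - 1) = (vcol p <= - i%:Z).
Proof.
move=> si; have := line_count_le si.
rewrite /vcol /labelled_vertex -/sorted_vertices.
rewrite (@nth_sorted_downset _ _ vertex_le (fun v => v.1 <= - i%:Z)) ?size_sorted //.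
- have -> : count (fun v => v.1 <= - i%:Z) sorted_vertices =
      count (fun v => v.1 <= - i%:Z) (vertices D).
    by apply/permP; rewrite perm_sort.
  by rewrite /label; have := ltn_ord p; case: (ltnP p n) => ? ? ?; lia.
- by move=> [a b] [a' b']; rewrite /vertex_le /=; lia.
- exact: vertex_le_trans.
- exact: sort_sorted vertex_le_total _.
Qed.

Lemma vcol_le (p q : 'I_(n + n)) : (p <= q)%N -> vcol p <= vcol q.
Proof.
move=> pq; have := sorted_leq_nth vertex_le_trans _ (0, 0) (sort_sorted vertex_le_total (vertices D)).
move=> /(_ _)/(_ p q); rewrite !inE -/sorted_vertices size_sorted !ltn_ord => H.
have : vertex_le (lv p) (lv q) by apply: H => // v; rewrite /vertex_le lexx eqxx orbT.
by rewrite /vertex_le /vcol; case: (lv p) (lv q) => a b [a' b'] /=; lia.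
Qed.

End SortedDiagram.

Lemma sgz_cases (e : int) : e != 0 -> (sgz e = 1 /\ 0 < e) \/ (sgz e = -1 /\ e < 0).
Proof. by rewrite /sgz; case: ltgtP; [right|left|]. Qed.

Lemma height_opp (e : int) (j : nat) : height (e, - j%:Z) = j.
Proof. by rewrite /height abszN. Qed.

(** * The columns met by a chain *)

Section DiagramRows.

Variables (n s : nat) (d : int -> nat).
Hypothesis dim_d : symplectic_dimvec n s d.

Let d_out := dimvec_out dim_d.
Let d_sym := dimvec_sym dim_d.
Let d0_even := dimvec_even dim_d.

Local Notation B := (block_vec s d).
Local Notation D := (line_diagram s d).
Local Notation lv := (labelled_vertex (n := n) s d).
Local Notation col := (vcol (n := n) s d).
Local Notation chain := (line_chain s d).

Let B_sym j i : B j (- i) = B j i. Proof. exact: (block_vec_sym d_out d_sym d0_even). Qed.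
Let B_le2 j i : (B j i <= 2)%N. Proof. exact: (block_vec_le2 d_out d_sym d0_even). Qed.
Let B_supp j i : s%:Z < `|i| -> B j i = 0%N. Proof. exact: (block_vec_supp d_out d_sym d0_even). Qed.
Let B_mid j : B j 0 = 0%N \/ B j 0 = 2%N. Proof. exact: (block_vec_middle d_out d_sym d0_even). Qed.

Definition vchain (p : 'I_(n + n)) : int := chain (lv p).

Definition vextra (p q : 'I_(n + n)) : bool := line_extra s d (lv p) (lv q).

Lemma vchain_abs p : absz (vchain p) = height (lv p).
Proof. exact: (line_chain_abs d_out d_sym d0_even (lv_in dim_d p)). Qed.

Lemma line_chain2 v : B (height v) 0 = 2%N -> chain v = v.2.
Proof. by rewrite /line_chain /small_chain => ->. Qed.

(** The chain could lose the sign of the height only in the middle column, where [sgz] vanishes; but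
    a block with vertices there has the height itself as chain. *)
Lemma line_chain_inj v u : v \in vertices D -> u \in vertices D ->
  v.1 = u.1 -> chain v = chain u -> v = u.
Proof.
move=> vD uD cvu chvu.
have huv : height v = height u.
  by rewrite -(line_chain_abs d_out d_sym d0_even vD) chvu (line_chain_abs d_out d_sym d0_even uD).
have v2 : v.2 = u.2.
  move: chvu; rewrite /line_chain /small_chain huv cvu; case: ifP => // /norP[f0 _].
  apply: sgz_mul_inj; apply: contra f0 => /eqP u0.
  by rewrite (line_col_neq0 d_out d_sym d0_even uD u0).
by case: v u cvu v2 {vD uD chvu huv} => a b [a' b'] /= -> ->.
Qed.

Lemma vcol_chain_inj p q : col p = col q -> vchain p = vchain q -> p = q.
Proof.
move=> cpq chpq; apply: (lv_inj dim_d).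
by apply: line_chain_inj; rewrite ?lv_in.
Qed.

(** In Case 4 a chain passes from one row to the other at the middle, so negation maps it to itself;
    elsewhere negation changes the sign of the row. *)
Lemma line_chain_neg v : v \in vertices D -> chain (neg_vertex v) =
  if [|| B (height v) 0 == 2%N, is_row s (B (height v)) | is_double s (B (height v))]
  then - chain v else chain v.
Proof.
move=> vD; rewrite /line_chain /small_chain /neg_vertex /height abszN -/(height v) /=.
by case: ifP => // _; rewrite sgzN mulrNN.
Qed.

Lemma height_neg v : height (neg_vertex v) = height v.
Proof. by rewrite /height abszN. Qed.

Lemma next_vertex_neg v w : next_vertex (vertices D) chain v w ->
  next_vertex (vertices D) chain (neg_vertex w) (neg_vertex v).
Proof.
have ab := line_chain_abs d_out d_sym d0_even.
have negD := line_sym dim_d.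
case/next_vertexP => vD wD cwv lt none; have hwv : height w = height v.
  by rewrite -ab // cwv ab.
apply/next_vertexP; split; rewrite ?negD //=.
- by rewrite !line_chain_neg // hwv cwv.
- by rewrite ltrN2.
move=> u uD cu bet; have huw : height u = height w.
  by rewrite -ab // cu ab ?negD // height_neg.
apply: (none (neg_vertex u)); rewrite ?negD //=; last by move: bet; lia.
by rewrite -cwv line_chain_neg // cu line_chain_neg // huw; case: ifP => ->; rewrite ?opprK.
Qed.

Lemma line_extra_neg v w : line_extra s d v w ->
  line_extra s d (neg_vertex w) (neg_vertex v).
Proof.
rewrite /line_extra => H; have /and4P[_ _ /eqP vE /eqP wE] := H.
have [E1 E2] : neg_vertex w = v /\ neg_vertex v = w.
  by rewrite {1}wE {2}vE /neg_vertex; split; rewrite -?vE -?wE [RHS]surjective_pairing wE vE //= !opprK.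
by rewrite E1 E2.
Qed.

Lemma arrows_neg v w :
  ((neg_vertex w, neg_vertex v) \in arrows D) = ((v, w) \in arrows D).
Proof.
have one u t : (u, t) \in arrows D -> (neg_vertex t, neg_vertex u) \in arrows D.
  rewrite !(line_arrows d_out d_sym d0_even) => /orP[nx|ex].
    by rewrite next_vertex_neg.
  by rewrite line_extra_neg ?orbT.
by apply/idP/idP => /one; rewrite ?neg_vertexK.
Qed.

Lemma meets_vertex c e : reflect (exists2 u, u \in vertices D & chain u = c /\ u.1 = e)
  (meets col vchain c e).
Proof.
apply: (iffP idP) => [/meets_colP[r <- <-]|[u uD [<- <-]]].
  by exists (lv r); rewrite ?lv_in.
by have [r <-] := lv_surj dim_d uD; apply/meets_colP; exists r.
Qed.

Lemma meets_middle j c e : B j 0 = 2%N -> absz c = j ->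
  meets col vchain c e = (B j e == 2%N) || (B j e == 1%N) && (0 < e * c).
Proof.
move=> f0 cj; have j0 := middle_height d_out d_sym d0_even f0.
have inD u : height u = j ->
    (u \in vertices D) = (B j u.1 == 2%N) || (B j u.1 == 1%N) && (0 < u.1 * u.2).
  move=> hu; rewrite (line_verticesE d_out d_sym d0_even) /in_line hu ifF //.
  by move: hu; rewrite /height; lia.
apply/meets_vertex/idP => [[u uD [uc <-]]|H].
  have hu : height u = j by rewrite -(line_chain_abs d_out d_sym d0_even uD) uc.
  by move: uD; rewrite inD // -uc line_chain2 ?hu.
by exists (e, c); [rewrite inD | rewrite line_chain2 //= /height cj].
Qed.

(** The threshold a is 1 for the row d^0 and 2 for a block of Case 3. In Case 4 it is 1 for the
    positive chain, which meets all columns of the block, and 2 for the negative one. *)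
Lemma meets_level v : v \in vertices D -> B (height v) 0 = 0%N ->
  exists2 a, (0 < a)%N & forall e, meets col vchain (chain v) e = (a <= B (height v) e)%N.
Proof.
move=> vD f0; pose j := height v; rewrite -/j in f0 *.
have inD := line_verticesE d_out d_sym d0_even.
have hb := line_chain_abs d_out d_sym d0_even.
have le2 := B_le2 j.
have [j0|j0] := eqVneq j 0%N.
  have row_f : is_row s (B j).
    by have := row0_is_row d_out d_sym d0_even; rewrite j0 => /andP[].
  exists 1%N => // e; have cE : chain v = 0 by apply/eqP; rewrite -absz_eq0 hb // -/j j0.
  apply/meets_vertex/idP => [[u uD [uc <-]]|H].
    have hu : height u = 0%N by rewrite -hb // uc cE.
    move: uD; rewrite inD /in_line ifT; first by rewrite j0 lt0n.
    by rewrite -absz_eq0 -[absz _]/(height u) hu.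
  exists (e, 0); first by rewrite inD; rewrite j0 lt0n in H; exact: H.
  rewrite cE; split=> //; rewrite /line_chain /small_chain (_ : height (e, 0) = j); last by rewrite j0.
  by rewrite row_f /= orbT.
have not_row : is_row s (B j) = false.
  have jm : (0 < j <= size (decomposition s d).2)%N.
    by move: vD; rewrite (line_vertices d_out d_sym d0_even) -/j => /andP[-> _]; rewrite lt0n j0.
  by have := block_not_row d_out d_sym d0_even jm; rewrite f0.
have inD' u : height u = j ->
    (u \in vertices D) = (B j u.1 == 2%N) || (B j u.1 == 1%N) && (0 < u.1 * u.2).
  by move=> hu; rewrite inD /in_line hu ifF //; move: hu j0; rewrite /height; lia.
have chE u : height u = j ->
    chain u = if is_double s (B j) then u.2 else u.2 * sgz u.1.
  by move=> hu; rewrite /line_chain /small_chain hu f0 not_row.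
have nz e : B j e != 0%N -> e != 0 by apply: contra => /eqP ->; rewrite f0.
have cabs : absz (chain v) = j by rewrite hb.
have [dbl|dbl] := boolP (is_double s (B j)).
  have no1 e : B j e != 1%N.
    apply/negP => /eqP E; have /allP/(_ e) := dbl; rewrite E mem_columns => /(_ _)/negP; case=> //.
    by apply: (supp_columns (f := B j)); [exact: B_supp | rewrite E].
  exists 2%N => // e; apply/meets_vertex/idP => [[u uD [uc <-]]|H].
    have hu : height u = j by rewrite -hb // uc.
    by move: uD; rewrite inD' // (negPf (no1 _)) orbF => /eqP ->.
  exists (e, chain v).
    by rewrite inD' //= (_ : B j e == 2%N) //; have := le2 e; lia.
  by rewrite chE ?dbl.
have [pos|neg] := leP 0 (chain v).
  have cj : chain v = j%:Z by move: cabs; lia.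
  exists 1%N => // e; apply/meets_vertex/idP => [[u uD [uc <-]]|H].
    have hu : height u = j by rewrite -hb // uc.
    by move: uD; rewrite inD' //; case: (B j u.1).
  have e0 : e != 0 by apply: nz; rewrite -lt0n.
  have [[se es]|[se es]] := sgz_cases e0.
    exists (e, j%:Z); last by rewrite chE //= (negPf dbl) se mulr1 cj.
    by rewrite inD' //= pmulr_rgt0 // ltz_nat lt0n j0 andbT; have := le2 e; lia.
  exists (e, - j%:Z); last by rewrite chE ?height_opp //= (negPf dbl) se mulrN1 opprK cj.
  rewrite inD' ?height_opp //= mulrN -mulNr pmulr_rgt0 ?oppr_gt0 // ltz_nat lt0n j0 andbT.
  by have := le2 e; lia.
have cj : chain v = - j%:Z by move: cabs; lia.
exists 2%N => // e; apply/meets_vertex/idP => [[u uD [uc <-]]|H].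
  have hu : height u = j by rewrite -hb // uc.
  have u0 : u.1 != 0.
    by apply: contraTneq uD => u0; rewrite inD' // u0 f0.
  move: uD; rewrite inD' // => /orP[/eqP -> //|/andP[_ u12]].
  move: uc u12 neg; rewrite chE // (negPf dbl).
  by case: u {hu u0} => a b /=; rewrite mulrC -sgz_gt0 sgzM => <-; rewrite -sgz_lt0 sgzM sgz_id; lia.
have e0 : e != 0 by apply: nz; move: H; lia.
have f2 : B j e == 2%N by have := le2 e; lia.
have [[se es]|[se es]] := sgz_cases e0.
  exists (e, - j%:Z); first by rewrite inD' ?height_opp //= f2.
  by rewrite chE ?height_opp //= (negPf dbl) se mulr1 cj.
exists (e, j%:Z); first by rewrite inD' //= f2.
by rewrite chE //= (negPf dbl) se mulrN1 cj.
Qed.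

End DiagramRows.

(** * Nestedness of the chains and the entries of x *)

Section DiagramChains.

Variables (n s : nat) (d : int -> nat).
Hypothesis dim_d : symplectic_dimvec n s d.

Let d_out := dimvec_out dim_d.
Let d_sym := dimvec_sym dim_d.
Let d0_even := dimvec_even dim_d.

Local Notation B := (block_vec s d).
Local Notation D := (line_diagram s d).
Local Notation lv := (labelled_vertex (n := n) s d).
Local Notation col := (vcol (n := n) s d).
Local Notation ch := (vchain (n := n) s d).
Local Notation extra := (vextra (n := n) s d).

Let B_sym j i : B j (- i) = B j i. Proof. exact: (block_vec_sym d_out d_sym d0_even). Qed.
Let B_le2 j i : (B j i <= 2)%N. Proof. exact: (block_vec_le2 d_out d_sym d0_even). Qed.
Let B_supp j i : s%:Z < `|i| -> B j i = 0%N. Proof. exact: (block_vec_supp d_out d_sym d0_even). Qed.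
Let B_mid j : B j 0 = 0%N \/ B j 0 = 2%N. Proof. exact: (block_vec_middle d_out d_sym d0_even). Qed.
Let inD p := lv_in dim_d p.

Lemma meets_self p : meets col ch (ch p) (col p).
Proof. by apply/meets_colP; exists p. Qed.

Lemma meets0_middle p : meets col ch (ch p) 0 -> B (height (lv p)) 0 = 2%N.
Proof.
case/meets_colP => r cr /(line_col_neq0 d_out d_sym d0_even (inD r)).
by rewrite -(vchain_abs dim_d) cr vchain_abs.
Qed.

Lemma rev_vchain p : meets col ch (ch p) 0 -> ch (rev_ord p) = - ch p.
Proof.
move=> /meets0_middle f0; rewrite /vchain (lv_rev dim_d) !line_chain2 //.
by rewrite height_neg.
Qed.

Lemma upper_vchain p : ch p < 0 -> meets col ch (ch p) 0 -> 0 <= col p ->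
  meets col ch (- ch p) (col p).
Proof.
move=> chp /meets0_middle f0 p0; have := meets_self p.
rewrite !(meets_middle dim_d (j := height (lv p))) ?abszN ?(vchain_abs dim_d) //.
case/orP => [->//|/andP[_ lt0]]; have : col p * ch p <= 0 by nia.
by rewrite leNgt lt0.
Qed.

Lemma nested_vchain p q : col p < col q ->
  [\/ forall r, ch r = ch p -> col r <= col p -> meets col ch (ch q) (col r),
      forall r, ch r = ch q -> col q <= col r -> meets col ch (ch p) (col r)
    | [/\ ch p < 0, ch q = - ch p & meets col ch (ch p) 0]].
Proof.
move=> pq; pose f := B (height (lv p)); pose g := B (height (lv q)).
have in2 i j : B (height (lv i)) 0 = 2%N -> inside (B (height (lv j))) (B (height (lv i))) ->
    forall r, ch r = ch j -> meets col ch (ch i) (col r).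
  move=> f2 ins r rj.
  rewrite (meets_middle dim_d _ f2) ?(vchain_abs dim_d) //.
  have [->|r0] := eqVneq (col r) 0; first by rewrite f2.
  rewrite ins // -(vchain_abs dim_d) -rj (vchain_abs dim_d).
  have := inD r; rewrite (line_verticesE d_out d_sym d0_even) /in_line lt0n.
  case: eqP => [r2 |_]; first by rewrite /height r2.
  by rewrite -[(lv r).1]/(col r); case: (B _ _).
have [f0|f2] := B_mid (height (lv p)); last first.
  have [E|ne] := eqVneq (height (lv p)) (height (lv q)); last first.
    have [ins|[g2 ins]] := block_vec_nested d_out d_sym d0_even f2 ne.
      by constructor 2 => r rq _; apply: in2 rq.
    by constructor 1 => r rp _; apply: in2 rp.
  have chE : ch q = ch p \/ ch q = - ch p.
    by move: E; rewrite -!(vchain_abs dim_d); lia.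
  case: chE => chE.
    by constructor 1 => r rp _; rewrite chE -rp meets_self.
  have j0 := middle_height d_out d_sym d0_even f2; rewrite -(vchain_abs dim_d) in j0.
  have mp e c : absz c = absz (ch p) -> meets col ch c e = (f e == 2%N) || (f e == 1%N) && (0 < e * c).
    by rewrite (vchain_abs dim_d) => cE; rewrite (meets_middle dim_d _ f2).
  have [pos|neg] := ltP 0 (ch p); last first.
    constructor 3; split=> //; first by lia.
    by rewrite mp // /f f2.
  have [q0|q0] := leP 0 (col q).
    constructor 2 => r rq qr; have := meets_self r; rewrite rq chE !mp ?abszN //.
    case/orP => [->//|/andP[_ lt0]]; have : col r * - ch p <= 0 by nia.
    by rewrite leNgt lt0.
  constructor 1 => r rp pr; have := meets_self r; rewrite rp chE !mp ?abszN //.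
  case/orP => [->//|/andP[_ lt0]]; have : col r * ch p <= 0 by nia.
  by rewrite leNgt lt0.
have [g0|g2] := B_mid (height (lv q)); last first.
  have ne : height (lv q) != height (lv p) by apply: contraTneq isT => E; rewrite -E g2 in f0.
  have [ins|[]] := block_vec_nested d_out d_sym d0_even g2 ne; last by rewrite f0.
  by constructor 1 => r rp _; apply: in2 rp.
have [a a0 fE] := meets_level dim_d (inD p) f0.
have [b b0 gE] := meets_level dim_d (inD q) g0.
case: (boolP [forall r, (ch r == ch p) ==> meets col ch (ch q) (col r)]) => [/forallP sub|].
  by constructor 1 => r rp _; have := sub r; rewrite rp eqxx.
case/forallPn => r; rewrite negb_imply => /andP[/eqP rp nrq].
constructor 2 => t tq _.
have := meets_self t; rewrite tq gE => bt; rewrite fE.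
have := meets_self r; rewrite rp fE => ar; rewrite gE in nrq.
have r0 : col r != 0 by apply: contraTneq ar => ->; rewrite f0 -ltnNge.
have t0 : col t != 0 by apply: contraTneq bt => ->; rewrite g0 -ltnNge.
have mono j := block_vec_mono d_out d_sym d0_even j.
have [dtr|drt] := leqP (d (col t)) (d (col r)).
  by case/negP: nrq; apply: leq_trans bt _; apply: mono.
by apply: leq_trans ar _; apply: mono => //; apply: ltnW.
Qed.

Lemma vextraP p q : extra p q -> [/\ q = rev_ord p, 0 < ch p, meets col ch (ch p) 0
  & exists2 r, next_in_row col ch p r & col r = 0].
Proof.
case/and4P => /eqP f2 cnt /eqP pE /eqP qE; set j := height (lv p) in f2 cnt pE qE.
have j0 := middle_height d_out d_sym d0_even f2.
have chp : ch p = j%:Z by rewrite /vchain line_chain2 // pE.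
have [i i0 fi] := positive_one (B_sym j) (B_mid j) f2 (leq_trans (isT : 0 < 4)%N cnt).
have first := @first_colP s (B j) (@B_supp j) (B_mid j) 1.
have [l0 fl _] := first i i0 isT (eq_leq (esym fi)).
have colp : col p = first_col s (B j) 1 by rewrite /vcol pE.
have m0 : meets col ch (ch p) 0 by rewrite (meets_middle dim_d _ f2) ?chp ?f2.
split=> //; first by apply: (lv_inj dim_d); rewrite (lv_rev dim_d) qE pE.
  by rewrite chp ltz_nat.
have /meets_colP[r rp r0] := m0; exists r => //.
apply/and3P; split; [by rewrite rp | by rewrite r0 colp | apply/forallP => t].
rewrite r0 colp; apply/negP => /and3P[/eqP tp t0 tl].
have := meets_self t; rewrite tp (meets_middle dim_d _ f2) ?chp // => ft.
have ft1 : (1 <= B j (col t))%N by move: ft; case: (B j (col t)).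
by have [_ _] := first _ t0 isT ft1; rewrite leNgt tl.
Qed.

Lemma vextra_or_almost_nested p r : 0 < ch p -> next_in_row col ch p r -> col r = 0 ->
  extra p (rev_ord p) \/
  forall q q', ch q = ch p -> ch q' = ch p -> 0 < col q -> 0 < col q' ->
    ~~ meets col ch (- ch p) (col q) -> ~~ meets col ch (- ch p) (col q') -> q = q'.
Proof.
move=> chp nx r0; have [rp rlp last] := next_in_rowP nx.
have f2 : B (height (lv p)) 0 = 2%N.
  by apply: meets0_middle; apply/meets_colP; exists r.
set j := height (lv p) in f2.
have first := @first_colP s (B j) (@B_supp j) (B_mid j) 1.
have p0 : 0 < col p by rewrite -r0.
have chE : ch p = j%:Z by rewrite /j -(vchain_abs dim_d); lia.
have chabs : absz (- ch p) = j by rewrite abszN (vchain_abs dim_d).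
have mE c e : absz c = j -> meets col ch c e = (B j e == 2%N) || (B j e == 1%N) && (0 < e * c).
  exact: meets_middle.
have fpos e : meets col ch (ch p) e -> (1 <= B j e)%N.
  by rewrite mE ?chE //; case: (B j e).
have [l0 fl lp] := first _ p0 isT (fpos _ (meets_self p)).
have pl : col p = first_col s (B j) 1.
  apply/eqP; rewrite eq_le lp andbT; rewrite leNgt; apply/negP => lt.
  have : meets col ch (ch p) (first_col s (B j) 1).
    rewrite mE ?chE //; have := B_le2 j (first_col s (B j) 1).
    have -> : 0 < first_col s (B j) 1 * j by apply: mulr_gt0 => //; rewrite -chE.
    by rewrite andbT; move: fl; case: (B j _) => [|[|[|]]].
  case/meets_colP => t tp tl; have := last t tp; rewrite tl r0 => /(_ lt).
  by rewrite leNgt l0.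
have [many|few] := leqP 4 (count (fun i => B j i == 1%N) (columns s)).
  left; rewrite /vextra /line_extra -/j f2 eqxx many /= (lv_rev dim_d).
  have pE : lv p = (first_col s (B j) 1, j%:Z).
    by rewrite [lv p]surjective_pairing -[(lv p).1]/(col p) pl -chE /vchain line_chain2.
  by rewrite pE /neg_vertex /= !eqxx.
right=> q q' cq cq' q0 q'0 nq nq'; apply: (vcol_chain_inj dim_d); last by rewrite cq.
have one t : ch t = ch p -> ~~ meets col ch (- ch p) (col t) -> B j (col t) = 1%N.
  move=> ct; rewrite mE // => /norP[n2 _]; have := meets_self t.
  by rewrite ct mE ?chE // (negPf n2) => /andP[/eqP].
have [fq fq'] := (one _ cq nq, one _ cq' nq').
apply/eqP; apply: contraLR few => ne; rewrite -leqNgt -size_filter.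
(* By symmetry each positive column with entry 1 has a negative partner, so two such columns would
   give four entries 1. *)
apply: (@uniq_leq_size _ [:: col q; - col q; col q'; - col q']).
  by rewrite /= !inE; move: ne q0 q'0; lia.
move=> e eE; have fe : B j e = 1%N.
  by move: eE; rewrite !inE => /or4P[]/eqP ->; rewrite ?B_sym.
rewrite mem_filter fe mem_columns; have : `|e| <= s%:Z; last by lia.
by apply: (supp_columns (f := B j)); [exact: B_supp | rewrite fe].
Qed.

Lemma next_vchain p q : next_in_row col ch p q = next_vertex (vertices D) (line_chain s d) (lv p) (lv q).
Proof.
apply/and3P/next_vertexP => [[/eqP cq lt /forallP none]|[_ _ cq lt none]].
  split; rewrite ?inD // => u uD cu bet; have [r rE] := lv_surj dim_d uD.
  by have := none r; rewrite /vchain /vcol rE cu eqxx bet.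
split; [exact/eqP | by [] | apply/forallP => r].
by apply/negP => /andP[/eqP cr bet]; have := none (lv r) (inD r) cr bet.
Qed.

Lemma arrow_vertices p q : ((lv p, lv q) \in arrows D) = next_in_row col ch p q || extra p q.
Proof. by rewrite (line_arrows d_out d_sym d0_even) next_vchain. Qed.

Lemma arrow_col p q : (lv p, lv q) \in arrows D -> col q < col p.
Proof.
rewrite arrow_vertices => /orP[/next_in_rowP[]//|/vextraP[-> _ _ [r /next_in_rowP[_ rp _] r0]]].
by rewrite (vcol_rev dim_d); move: rp; rewrite r0; lia.
Qed.

Variable k : closedFieldType.
Local Notation X := (diagram_element k n s d).

Lemma diagram_elementE p q :
  X p q = if (lv p, lv q) \in arrows D then eps k p q else 0.
Proof.
rewrite summxE (bigD1 p) //= [X in _ + X]big1 ?addr0 => [|p' /negPf ne]; last first.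
  rewrite summxE big1 // => q' _; rewrite !mxE.
  by rewrite (inj_eq (@label_inj n)) eq_sym ne mulr0.
rewrite summxE; case: ifP => pq; last first.
  rewrite big1 // => q' pq'; rewrite !mxE !(inj_eq (@label_inj n)).
  case: (eqVneq q q') => [E|]; last by rewrite andbF mulr0.
  by rewrite -E pq in pq'.
rewrite (bigD1 q) //= [X in _ + X]big1 ?addr0 => [|q' /andP[_ /negPf ne]].
  by rewrite !mxE !eqxx mulr1.
by rewrite !mxE !(inj_eq (@label_inj n)) [q == q']eq_sym ne andbF mulr0.
Qed.

(** Arrows go left and labels increase to the right, so every arrow lowers the label and takes the
    sign of its source. *)
Lemma arrow_eps p q : (lv p, lv q) \in arrows D -> eps k p q = lsign k p.
Proof.
move=> pq; have qp : (q < p)%N.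
  rewrite ltnNge; apply/negP => /(vcol_le dim_d); rewrite leNgt => /negP; case.
  exact: arrow_col.
rewrite epsE; last by rewrite ltNge label_le -ltnNge.
have -> : (label p < 0) = ~~ (n <= p)%N by rewrite /label; case: (ltnP p n) => ?; lia.
by rewrite /lsign; case: (n <= p)%N.
Qed.

Lemma diagram_element_arrows p q : (X p q != 0) = next_in_row col ch p q || extra p q.
Proof.
rewrite -arrow_vertices diagram_elementE; case: ifP => [pq|_]; last by rewrite eqxx.
by rewrite arrow_eps // lsign_neq0.
Qed.

Lemma diagram_element_nil : nil_lie col X.
Proof.
split=> [|p q lt].
  apply/sadj_skewP => p q; rewrite !diagram_elementE.
  have revE : (lv (rev_ord q), lv (rev_ord p)) \in arrows D = ((lv p, lv q) \in arrows D).
    by rewrite !(lv_rev dim_d) (arrows_neg dim_d).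
  rewrite revE; case: ifP => pq; last by rewrite mulr0 oppr0.
  rewrite !arrow_eps ?revE // lsign_rev mulrAC lsign_sqr mul1r //.
rewrite diagram_elementE; case: ifP => // /arrow_col; move: lt; lia.
Qed.

End DiagramChains.

Theorem theorem4p3 (k : closedFieldType) (n s : nat) (d : int -> nat)
    (char_k : 2%N \notin [pchar k]%R)
    (dim_d : symplectic_dimvec n s d) (proper_d : proper_dimvec s d) :
  richardson_element (@parabolic k n s d) (diagram_element k n s d).
Proof.
have char2 : (2%:R : k) != 0 by move: char_k; rewrite inE /=.
pose col := vcol (n := n) s d.
have col_rev p : col (rev_ord p) = - col p := vcol_rev dim_d p.
have nilX := diagram_element_nil dim_d k.
have onto : ad_onto col (diagram_element k n s d).
  apply: ad_onto_dual => // Z sZ comm.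
  apply: (centralizer_lowers (vcol_chain_inj dim_d) col_rev (rev_vchain dim_d)
    (vextraP dim_d) (vextra_or_almost_nested dim_d) (upper_vchain dim_d)
    (nested_vchain dim_d) char2 (diagram_element_arrows dim_d k)) => //.
  by have [] := nilX.
have [opn dns] := orbit_open_dense col_rev char2 nilX onto.
apply: (richardson_iff (Q := para_group col (R := k)) (U := nil_lie col (R := k))) => //.
  move=> g; apply: parabolicP => //; first exact: vcol_bound.
  by move=> i p si; apply: vcol_flag.
by move=> Y; apply: lie_radicalP.
Qed.
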